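(* Let $\mu$ be a nonnegative Radon measure on $\mathbb R^d$. Then for $\mu$-a.e. $x_0\in\mathbb R^d$, writing $k=k(x_0)=\dim T_\mu(x_0)$, every measure $\nu\in\mathrm{Tan}(\mu,x_0)$ satisfies $$\nu=\big(\mathcal H^k\llcorner T_\mu(x_0)\big)\otimes\eta\qquad\text{in }\mathbb R^d,$$ where $\eta$ is a Radon measure on $T_\mu(x_0)^\perp$ (and $\mathbb R^d$ is identified with $T_\mu(x_0)\times T_\mu(x_0)^\perp$). In particular, if $\mu$ admits a $k$-dimensional tangent space $V$ at $x_0$ (with $k=k(x_0)$), then $T_\mu(x_0)=V$; in general, if $\mu$ admits a tangent space $V$ at $x_0$ of arbitrary dimension, one has $T_\mu(x_0)\subset V$.
   Context: Preiss tangent measures: $\mathrm{Tan}(\mu,x_0)$ is the set of all nonzero nonnegative Radon measures $\nu$ on $\mathbb R^d$ for which there are $c_j>0$ and $r_j\to0$ ($r_j>0$) with $\lim_j c_j\int\varphi\big(\frac{x-x_0}{r_j}\big)d\mu(x)=\int\varphi\,d\nu$ for every $\varphi\in C^0_c(\mathbb R^d)$. Tangent space: an $m$-dimensional linear subspace $V\subset\mathbb R^d$ is tangent to $\mu$ at $x_0$ if there is a constant $\theta>0$ with $\lim_{h\to0^+}h^{-m}\int\varphi\big(\frac{x-x_0}{h}\big)d\mu(x)=\theta\int_V\varphi\,d\mathcal H^m$ for every $\varphi\in C^0_c(\mathbb R^d)$. $\mathcal H^m$ is the $m$-dimensional Hausdorff measure. $\mathcal D(\mathbb R^d)$ is the space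 of smooth compactly supported functions; $\operatorname{Lip}_1(\mathbb R^d)$ the real $1$-Lipschitz functions. Let $\mathcal M_{0,1}(\mathbb R^d)$ be the finite signed Borel measures $f$ with $\int df=0$ and $\int|x|\,d|f|<\infty$, with norm $\|f\|_{\mathrm{KR}}=\sup\{\int u\,df: u\in\operatorname{Lip}_1(\mathbb R^d)\}$. The Arens-Eells space $\mathrm{AE}(\mathbb R^d)$ is the completion of $\mathcal M_{0,1}(\mathbb R^d)$ for this norm, identified with a subspace of distributions: $f\in\mathcal D'(\mathbb R^d)$ belongs to $\mathrm{AE}(\mathbb R^d)$ iff $\langle f,\varphi_n\rangle\to0$ for every sequence $(\varphi_n)\subset\mathcal D(\mathbb R^d)$ with $\sup_n\|\nabla\varphi_n\|_\infty<\infty$ and $\varphi_n\to c$ pointwise for some constant $c\in\mathbb R$. For a nonnegative Radon measure $\mu$, set $\mathcal T_\mu:=\{\sigma\in(L^1_\mu(\mathbb R^d))^d: -\operatorname{div}(\sigma\mu)\in\mathrm{AE}(\mathbb R^d)\}$. There is a $\mu$-measurable map $x\mapsto T_\mu(x)$ valued in the linear subspaces of $\mathbb R^d$, unique up to $\mu$-null sets, such that for $\sigma\in(L^1_\mu)^d$: $\sigma\in\mathcal T_\mu\iff\sigma(x)\in T_\mu(x)$ $\mu$-a.e. (the MK tangent bundle). *)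

(* Defs.v *)
From HB Require Import structures.
From mathcomp Require Import all_boot all_order all_algebra.
From mathcomp Require Import all_classical all_reals all_analysis.

Set Implicit Arguments.
Unset Strict Implicit.
Unset Printing Implicit Defensive.

Import Order.TTheory GRing.Theory Num.Theory.
Import numFieldNormedType.Exports.

Local Open Scope classical_set_scope.
Local Open Scope ring_scope.

(* Borel sigma-algebra on matrices, hence on 'rV[R]_d. *)
HB.instance Definition _ (R : realType) (m n : nat) :=
  @isMeasurable.Build (sigma_display (@open 'M[R]_(m, n))) 'M[R]_(m, n)
    <<s @open 'M[R]_(m, n) >> (@sigma_algebra0 _ setT (@open 'M[R]_(m, n)))
    (@sigma_algebraC _ (@open 'M[R]_(m, n)))
    (@sigma_algebra_bigcup _ setT (@open 'M[R]_(m, n))).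

(* The library norm `|x| on 'rV[R]_d is the sup norm (it induces the usual
   topology); the metric notions below use the Euclidean norm instead. *)
Section Euclidean.
Context {R : realType} {d : nat}.
Implicit Types (x y : 'rV[R]_d) (V : {vspace 'rV[R]_d}).

Definition dot x y : R := \sum_(i < d) x ord0 i * y ord0 i.

Definition enorm x : R := Num.sqrt (dot x x).

Definition orth V : set 'rV[R]_d := [set x | forall y, y \in V -> dot x y = 0].

Definition Lip1 : set ('rV[R]_d -> R) :=
  [set u | forall x y, `|u x - u y| <= enorm (x - y)].

End Euclidean.

Section TestFunctions.
Context {R : realType} {d : nat}.
Implicit Types phi : 'rV[R]_d -> R.

Definition partial (i : 'I_d) phi : 'rV[R]_d -> R :=
  fun x => 'D_(delta_mx ord0 i) phi x.

Fixpoint classC (n : nat) phi : Prop :=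
  if n is n'.+1 then
    (forall x, differentiable phi x) /\ (forall i, classC n' (partial i phi))
  else continuous phi.

Definition compactly_supported phi : Prop :=
  compact (closure [set x | phi x != 0]).

Definition Cc0 : set ('rV[R]_d -> R) :=
  [set phi | continuous phi /\ compactly_supported phi].

Definition testfun : set ('rV[R]_d -> R) :=
  [set phi | (forall n, classC n phi) /\ compactly_supported phi].

End TestFunctions.

Section Hausdorff.
Context {R : realType} {d : nat}.
Implicit Types A : set 'rV[R]_d.

(* Lebesgue measure pi^(m/2) / Gamma(m/2 + 1) of the unit ball of R^m, through
   omega_(m+2) = 2 pi / (m+2) * omega_m. *)
Fixpoint ball_volume (m : nat) : R :=
  match m with
  | 0%N => 1
  | 1%N => 2
  | m'.+2 => 2 * pi / m'.+2%:R * ball_volume m'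
  end.

(* -oo on the empty set, which is why hausdorff_gauge singles that set out. *)
Definition ediam A : \bar R :=
  ereal_sup [set (enorm (x - y))%:E | x in A & y in A].

(* With 0 ^+ 0 = 1, so that the 0-dimensional measure is the counting one. *)
Definition hausdorff_gauge (m : nat) A : \bar R :=
  if `[< A = set0 >] then 0%E
  else ((ball_volume m / 2 ^+ m)%:E * ediam A ^+ m)%E.

Definition hausdorff_delta (m : nat) (delta : R) A : \bar R :=
  ereal_inf [set (\sum_(0 <= i <oo) hausdorff_gauge m (C i))%E |
    C in [set C : nat -> set 'rV[R]_d |
      A `<=` \bigcup_i C i /\ forall i, (ediam (C i) <= delta%:E)%E]].

Definition hausdorff (m : nat) A : \bar R :=
  ereal_sup [set hausdorff_delta m delta A | delta in [set t : R | 0 < t]].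

End Hausdorff.

(* On R^d, Borel measures that are finite on compact sets are regular. *)
Definition radon (R : realType) (d : nat)
    (mu : {measure set 'rV[R]_d -> \bar R}) : Prop :=
  forall K, compact K -> (mu K < +oo)%E.

Definition restr (R : realType) (T : Type) (mu : set T -> \bar R) (D : set T)
  : set T -> \bar R := fun A => mu (A `&` D).

(* nu = (H^k restricted to V) (x) eta with k = \dim V, where R^d is identified
   with V x orth V by (y, z) |-> y + z. A measure on orth V is a measure on R^d
   that gives mass 0 to the complement of orth V. *)
Definition is_hausdorff_product (R : realType) (d : nat) (V : {vspace 'rV[R]_d})
    (eta nu : {measure set 'rV[R]_d -> \bar R}) : Prop :=
  eta (~` orth V) = 0%E /\
  forall A, measurable A ->
    nu A = pushforward (restr (hausdorff (\dim V)) [set` V] \x eta)%E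
             (fun p : 'rV[R]_d * 'rV[R]_d => p.1 + p.2) A.

Section Tangent.
Context {R : realType} {d : nat}.
Implicit Types (mu nu : {measure set 'rV[R]_d -> \bar R}).

Definition tangent_measures mu (x0 : 'rV[R]_d) : set {measure set 'rV[R]_d -> \bar R} :=
  [set nu | [/\ radon nu, nu [set: 'rV[R]_d] <> 0%E &
    exists c r : nat -> R,
      [/\ forall j, 0 < c j, forall j, 0 < r j, r j @[j --> \oo] --> (0 : R) &
        forall phi, Cc0 phi ->
          (c j * \int[mu]_x phi ((r j)^-1 *: (x - x0))) @[j --> \oo]
            --> (\int[nu]_x phi x : R)]]].

Definition tangent_space mu (x0 : 'rV[R]_d) (V : {vspace 'rV[R]_d}) : Prop :=
  exists2 theta : R, 0 < theta &
    forall phi, Cc0 phi ->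
      ((h ^+ \dim V)^-1 * \int[mu]_x phi (h^-1 *: (x - x0))) @[h --> 0^'+]
        --> (theta * fine (\int[hausdorff (\dim V)]_(x in [set` V]) (phi x)%:E)%E : R).

End Tangent.

Section ArensEells.
Context {R : realType} {d : nat}.
Implicit Types (f g : {charge set 'rV[R]_d -> \bar R}).

Definition hahn f :
    {PN : set 'rV[R]_d * set 'rV[R]_d | hahn_decomposition f PN.1 PN.2}.
Proof.
apply: cid; have [P [N PN]] := Hahn_decomposition f.
by exists (P, N).
Defined.

Definition abs_charge f : set 'rV[R]_d -> \bar R :=
  charge_variation (svalP (hahn f)).

Definition charge_int f (u : 'rV[R]_d -> R) : R :=
  \int[jordan_pos (svalP (hahn f))]_x u x -
  \int[jordan_neg (svalP (hahn f))]_x u x.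

Definition M01 f : Prop :=
  f [set: 'rV[R]_d] = 0%E /\ (\int[abs_charge f]_x (enorm x)%:E < +oo)%E.

Definition KRnorm f : \bar R := ereal_sup [set (charge_int f u)%:E | u in Lip1].

(* The image in the space of distributions of the completion of M01: F is the
   distributional limit of a sequence of M01 that is Cauchy for KRnorm. Only the
   values of F on testfun matter, and such a limit is always a distribution. *)
Definition AE (F : ('rV[R]_d -> R) -> R) : Prop :=
  exists f : nat -> {charge set 'rV[R]_d -> \bar R},
    [/\ forall n, M01 (f n),
        forall eps : R, 0 < eps -> exists N : nat, forall m n : nat,
          (N <= m)%N -> (N <= n)%N ->
          (KRnorm (cadd (f m) (copp (f n))) < eps%:E)%E &
        forall phi, testfun phi -> charge_int (f n) phi @[n --> \oo] --> F phi].

End ArensEells.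

Section MKbundle.
Context {R : realType} {d : nat}.
Implicit Types (mu : {measure set 'rV[R]_d -> \bar R}).
Implicit Types (sigma : 'rV[R]_d -> 'rV[R]_d).

Definition L1field mu sigma : Prop :=
  forall i : 'I_d, mu.-integrable setT (EFin \o (fun x => sigma x ord0 i)).

(* The distribution - div (sigma mu). *)
Definition neg_div mu sigma (phi : 'rV[R]_d -> R) : R :=
  \int[mu]_x (\sum_(i < d) sigma x ord0 i * partial i phi x).

Definition MKfields mu : set ('rV[R]_d -> 'rV[R]_d) :=
  [set sigma | L1field mu sigma /\ AE (neg_div mu sigma)].

(* Measurability of a closed-valued multifunction: the points whose value meets
   a given open set form a set that is measurable for the completion of mu. *)
Definition mu_measurable_bundle mu (T : 'rV[R]_d -> {vspace 'rV[R]_d}) : Prop :=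
  forall U : set 'rV[R]_d, open U ->
    exists2 B : set 'rV[R]_d, measurable B &
      mu.-negligible ([set x | exists2 v, v \in T x & U v] `+` B).

(* T is (a representative of) the tangent bundle T_mu. *)
Definition MK_tangent_bundle mu (T : 'rV[R]_d -> {vspace 'rV[R]_d}) : Prop :=
  mu_measurable_bundle mu T /\
  forall sigma, L1field mu sigma ->
    (MKfields mu sigma <-> {ae mu, forall x, sigma x \in T x}).

End MKbundle.

(* Main.v *)
From HB Require Import structures.
Require Import Defs.
From mathcomp Require Import all_boot all_order all_algebra.
From mathcomp Require Import all_classical all_reals all_analysis.
From mathcomp Require Import measurable_realfun lra ring.
Import Order.TTheory GRing.Theory Num.Theory.
Import numFieldNormedType.Exports.
Set Implicit Arguments.
Unset Strict Implicit.
Unset Printing Implicit Defensive.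
Local Open Scope classical_set_scope.
Local Open Scope ring_scope.

(** The theorem says that a blow-up of [mu] at a typical point [x0] is invariant under
    the translations along [T x0].

    Let [sigma] be a bounded Borel section of [T], cut off outside a ball. Then
    F = - div (sigma mu) is an element of the Arens-Eells space, that is, a limit
    of finite charges, uniform on 1-Lipschitz functions; so [F] is small on
    1-Lipschitz functions that are uniformly small ([AE_small]). Functions psi of
    size [r] and slope at most 1/2, each supported in one of a family of disjoint
    balls of small radii [r], can be added with arbitrary signs without leaving the
    1-Lipschitz functions. Hence the numbers |F psi| have a small sum, and a Vitali
    covering argument shows that, at almost every [x], F psi = o(mu (ball x (3 r)))
    for such functions supported in [ball x r] ([AE_blowup]). Rescaling a fixed test
    function [phi] to the scale [r] gives such a psi, and F psi is then a
    multiple of the integral of sigma . (grad phi)((x - x0) / r) against [mu]. At a Lebesgue point [x0]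
    of [sigma], the value sigma x may be replaced by sigma x0. In the limit, every blow-up
    [nu] of [mu] at [x0] satisfies

      the integral of (sigma x0) . grad phi against nu is 0

    for every test function [phi] ([blowup_divergence_free]). Measurability of the bundle
    makes the projections on [T x] of the basis vectors into sections with Borel
    representatives ([tangent_sections]). These are countably many and span [T x], so
    outside of one null set this holds for all the blow-ups and with every vector
    of [T x0] in place of sigma x0 ([ae_blowup_divergence_free]).

    A measure that kills the derivatives of test functions in the direction [v] is
    invariant under the translation by [v] ([shift_invariant]). Invariance under all of
    a subspace [V] makes it a product, by uniqueness of translation-invariant measures
    on [V] in the form of a Tonelli argument ([product_decomposition]); this is the first
    claim. It requires that the Hausdorff measure of dimension [\dim V] be a Borel measure,
    positive and finite on balls of [V].

    If [V] is tangent to [mu] at [x0], the Hausdorff measure on [V] is a blow-up, hence is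
    invariant along [T x0]. A translation that preserves it must map [V] to
    itself, so [T x0] is contained in [V] ([plane_measure_directions]); this is the last
    claim, and the second one follows by comparing dimensions. *)

(** * Euclidean geometry and Borel sets *)

Lemma ex_invn (R : realType) (e : R) : 0 < e -> exists n : nat, n.+1%:R^-1 < e.
Proof.
by move=> e0; exists (Num.truncn e^-1); rewrite invf_plt ?posrE// truncnS_gt.
Qed.

Section Geometry.
Context {R : realType} {d : nat}.
Implicit Types (x y z : 'rV[R]_d) (r e : R).

Lemma norm_coord x (i : 'I_d) : `|x ord0 i| <= `|x|.
Proof.
rewrite [leRHS]mx_normrE.
exact: (le_bigmax _ (fun ij => `|x ij.1 ij.2|) (ord0, i)).
Qed.

Lemma norm_le_coord x e : 0 <= e -> (forall i, `|x ord0 i| <= e) -> `|x| <= e.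
Proof.
move=> e0 H; rewrite [leLHS]mx_normrE; apply/bigmax_leP; split=> // -[i j] _ /=.
by rewrite (ord1 i).
Qed.

Lemma norm_lt_coord x e : 0 < e -> (forall i, `|x ord0 i| < e) -> `|x| < e.
Proof.
move=> e0 H; rewrite [ltLHS]mx_normrE; apply/bigmax_ltP; split=> // -[i j] _ /=.
by rewrite (ord1 i).
Qed.

Lemma ballP x y r : ball x r y <-> `|x - y| < r.
Proof. by rewrite -ball_normE. Qed.

Lemma dotC x y : dot x y = dot y x.
Proof. by apply: eq_bigr => i _; rewrite mulrC. Qed.

Lemma dotDl x y z : dot (x + y) z = dot x z + dot y z.
Proof. by rewrite -big_split; apply: eq_bigr => i _; rewrite !mxE mulrDl. Qed.

Lemma dotZl (a : R) x y : dot (a *: x) y = a * dot x y.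
Proof. by rewrite mulr_sumr; apply: eq_bigr => i _; rewrite !mxE mulrA. Qed.

Lemma dotDr x y z : dot x (y + z) = dot x y + dot x z.
Proof. by rewrite dotC dotDl !(dotC x). Qed.

Lemma dotZr (a : R) x y : dot x (a *: y) = a * dot x y.
Proof. by rewrite dotC dotZl (dotC x). Qed.

Lemma dotNl x y : dot (- x) y = - dot x y.
Proof. by rewrite -scaleN1r dotZl mulN1r. Qed.

Lemma dotNr x y : dot x (- y) = - dot x y.
Proof. by rewrite dotC dotNl dotC. Qed.

Lemma dot0l x : dot 0 x = 0.
Proof. by rewrite -(scale0r 0) dotZl mul0r. Qed.

Lemma dot0r x : dot x 0 = 0.
Proof. by rewrite dotC dot0l. Qed.

Lemma dot_ge0 x : 0 <= dot x x.
Proof. by apply: sumr_ge0 => i _; rewrite -expr2 sqr_ge0. Qed.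

Lemma dot_eq0 x : dot x x = 0 -> x = 0.
Proof.
move/psumr_eq0P => H; apply/rowP => i; rewrite mxE.
apply/eqP; rewrite -sqrf_eq0 expr2; apply/eqP/H => // j _.
by rewrite -expr2 sqr_ge0.
Qed.

Lemma dot_delta x i : dot x (delta_mx ord0 i) = x ord0 i.
Proof.
rewrite /dot (bigD1 i)//= mxE !eqxx mulr1 big1 ?addr0// => j ji.
by rewrite mxE (negbTE ji) andbF mulr0.
Qed.

Lemma enorm_ge0 x : 0 <= enorm x. Proof. exact: sqrtr_ge0. Qed.

Lemma sqr_enorm x : enorm x ^+ 2 = dot x x.
Proof. by rewrite sqr_sqrtr// dot_ge0. Qed.

Lemma enormZ (a : R) x : enorm (a *: x) = `|a| * enorm x.
Proof.
by rewrite /enorm dotZl dotZr mulrA -expr2 sqrtrM ?sqr_ge0// sqrtr_sqr.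
Qed.

Lemma enormN x : enorm (- x) = enorm x.
Proof. by rewrite -scaleN1r enormZ normrN1 mul1r. Qed.

Lemma enorm0 : enorm (0 : 'rV[R]_d) = 0.
Proof. by rewrite /enorm dot0l sqrtr0. Qed.

Lemma norm_le_enorm x : `|x| <= enorm x.
Proof.
apply: norm_le_coord => [|i]; first exact: enorm_ge0.
rewrite -sqrtr_sqr ler_wsqrtr// /dot (bigD1 i)//= -expr2 lerDl.
by apply: sumr_ge0 => j _; rewrite -expr2 sqr_ge0.
Qed.

Lemma enorm_le_norm x : enorm x <= d%:R * `|x|.
Proof.
rewrite -(ger0_norm (mulr_ge0 (ler0n _ d) (normr_ge0 x))) -sqrtr_sqr.
apply: ler_wsqrtr; rewrite exprMn.
apply: (@le_trans _ _ (\sum_(i < d) `|x| ^+ 2)).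
  apply: ler_sum => i _; rewrite -expr2 -real_normK ?num_real//.
  by rewrite ler_sqr ?nnegrE//; exact: norm_coord.
rewrite sumr_const card_ord -[leLHS]mulr_natl; apply: ler_wpM2r; first exact: sqr_ge0.
by rewrite -natrX ler_nat; case: d => // n; rewrite -mulnn leq_pmull.
Qed.

Lemma dot_enorm x y : dot x y <= enorm x * enorm y.
Proof.
have [y0|y0] := eqVneq (dot y y) 0.
  by rewrite (dot_eq0 y0) dot0r enorm0 mulr0.
have yp : 0 < dot y y by rewrite lt_neqAle eq_sym y0 dot_ge0.
have := dot_ge0 (dot y y *: x - dot x y *: y).
rewrite !(dotDl, dotDr, dotNl, dotNr, dotZl, dotZr) (dotC y x).
set a := dot y y in yp *; set b := dot x y; set c := dot x x => H.
have {}H : 0 <= a * (a * c - b ^+ 2).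
  by apply: le_trans H _; rewrite le_eqVlt; apply/orP; left; apply/eqP; ring.
rewrite pmulr_rge0// subr_ge0 in H.
rewrite /enorm -sqrtrM ?dot_ge0//.
by apply: le_trans (ler_norm _) _; rewrite -sqrtr_sqr ler_wsqrtr// mulrC.
Qed.

Lemma enormD x y : enorm (x + y) <= enorm x + enorm y.
Proof.
rewrite -(@ler_pXn2r _ 2)// ?nnegrE ?addr_ge0 ?enorm_ge0//.
rewrite sqr_enorm dotDl !dotDr (dotC y x) sqrrD !sqr_enorm.
have := dot_enorm x y; lra.
Qed.

Lemma coord_le_enorm (i : 'I_d) x y : x ord0 i - y ord0 i <= enorm (x - y).
Proof.
apply: le_trans (norm_le_enorm _); apply: le_trans (norm_coord (x - y) i).
by rewrite !mxE ler_norm.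
Qed.

Lemma continuous_coord_fun i : continuous (fun x : 'rV[R]_d => x ord0 i).
Proof. exact: coord_continuous. Qed.

Lemma continuous_dot y : continuous (fun x : 'rV[R]_d => dot x y).
Proof.
rewrite /dot; elim: (index_enum 'I_d) => [|i s IH].
  by under eq_fun do rewrite big_nil; exact: cst_continuous.
under eq_fun do rewrite big_cons.
have ci : continuous (fun z : 'rV[R]_d => z ord0 i * y ord0 i).
  by move=> z; apply: continuousM; [exact: continuous_coord_fun|exact: cst_continuous].
by move=> x; exact: (continuousD (ci x) (IH x)).
Qed.

Lemma continuous_enorm : continuous (enorm : 'rV[R]_d -> R).
Proof.
have c : continuous (fun x : 'rV[R]_d => dot x x).
  rewrite /dot; elim: (index_enum 'I_d) => [|i s IH].
    by under eq_fun do rewrite big_nil; exact: cst_continuous.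
  under eq_fun do rewrite big_cons.
  move=> x; have ci := @continuous_coord_fun i x.
  exact: (continuousD (continuousM ci ci) (IH x)).
by move=> x; apply: (continuous_comp (c x)); exact: sqrt_continuous.
Qed.

(** Rational balls form a countable basis, which reduces Borel measurability to balls. *)
Lemma rat_ball (U : set 'rV[R]_d) x : open U -> U x ->
  exists (q : 'rV[rat]_d) (n : nat),
    ball (map_mx ratr q : 'rV[R]_d) n.+1%:R^-1 x /\
    ball (map_mx ratr q : 'rV[R]_d) n.+1%:R^-1 `<=` U.
Proof.
move=> oU Ux; have /nbhs_ballP[e /= e0 eU] := open_nbhs_nbhs (conj oU Ux).
have [|n ne] := @ex_invn R (e / 2); first by rewrite divr_gt0.
have np : 0 < n.+1%:R^-1 :> R by rewrite invr_gt0.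
have /choice[q qx] : forall i : 'I_d, exists q : rat, `|x ord0 i - ratr q| < n.+1%:R^-1.
  move=> i; have [q] := @rat_in_itvoo R (x ord0 i - n.+1%:R^-1) (x ord0 i + n.+1%:R^-1)
     ltac:(by rewrite ltrBlDr -addrA ltrDl addr_gt0).
  by rewrite in_itv/= => qi; exists q; rewrite ltr_distl -ltr_distlC ltr_distl.
have bx : ball (map_mx ratr (\row_i q i) : 'rV[R]_d) n.+1%:R^-1 x.
  apply/ballP; rewrite distrC; apply: norm_lt_coord => // i; rewrite !mxE; exact: qx.
exists (\row_i q i), n; split => // y yb; apply: eU.
apply: (@le_ball _ _ _ (n.+1%:R^-1 + n.+1%:R^-1)); last exact: (ball_triangle (ball_sym bx) yb).
by rewrite [leRHS](splitr e) lerD// ltW.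
Qed.

Lemma open_measurable_rV (U : set 'rV[R]_d) : open U -> measurable U.
Proof. by move=> oU; apply: sub_sigma_algebra. Qed.

Lemma closed_measurable_rV (U : set 'rV[R]_d) : closed U -> measurable U.
Proof.
move=> cU; rewrite -(setCK U); apply: measurableC.
by apply: open_measurable_rV; exact: closed_openC.
Qed.

Lemma compact_measurable_rV (U : set 'rV[R]_d) : compact U -> measurable U.
Proof. by move=> cU; apply: closed_measurable_rV; exact: compact_closed. Qed.

Lemma measurable_ball_rV x r : measurable (ball x r).
Proof. by apply: open_measurable_rV; exact: ball_open. Qed.

Lemma continuous_measurable_rV (f : 'rV[R]_d -> R) :
  continuous f -> measurable_fun setT f.
Proof.
move=> /continuousP cf; apply: (measurability _ (RGenOpens.measurableE R)) => //.
move=> _ [U [a [b ->]] <-]; rewrite setTI; apply: open_measurable_rV.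
by apply: cf; exact: interval_open.
Qed.

Lemma measurable_coord i : measurable_fun setT (fun x : 'rV[R]_d => x ord0 i).
Proof. by apply: continuous_measurable_rV; exact: coord_continuous. Qed.

(** The balls of the sup norm are products of intervals, and every open set is a
    countable union of rational ones. *)
Lemma measurable_fun_rV dT (T : measurableType dT) (f : T -> 'rV[R]_d) :
  (forall i, measurable_fun setT (fun x : T => f x ord0 i)) -> measurable_fun setT f.
Proof.
move=> mf; apply: (measurability (@open 'rV[R]_d)) => //.
move=> _ [U oU <-]; rewrite setTI.
pose P (p : 'rV[rat]_d * nat) := `[<ball (map_mx ratr p.1 : 'rV[R]_d) p.2.+1%:R^-1 `<=` U>].
have -> : f @^-1` U = \bigcup_(p in [set p | P p]) (f @^-1` ball (map_mx ratr p.1 : 'rV[R]_d) p.2.+1%:R^-1).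
  apply/seteqP; split => x /=.
    by move=> /(rat_ball oU)[q [n [xq qU]]]; exists (q, n) => //; apply/asboolP.
  by move=> [p /asboolP pU] /pU.
rewrite bigcup_mkcond; apply: countable_bigcupT_measurable => // p.
case: ifPn => // _.
have -> : f @^-1` ball (map_mx ratr p.1 : 'rV[R]_d) p.2.+1%:R^-1 =
   \bigcap_(i in [set: 'I_d]) ((fun x : T => f x ord0 i) @^-1` (ball (ratr (p.1 ord0 i) : R) p.2.+1%:R^-1)).
  apply/seteqP; split => x /=.
    move=> /ballP H i _ /=; rewrite -ball_normE/=; apply: le_lt_trans H.
    by have := norm_coord (map_mx ratr p.1 - f x) i; rewrite !mxE.
  move=> H; apply/ballP; apply: norm_lt_coord => [|i]; first by rewrite invr_gt0.
  by have := H i I; rewrite /= -ball_normE/= !mxE.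
apply: fin_bigcap_measurable; [exact: finite_finset|].
by move=> i _; rewrite -[X in measurable X]setTI; apply: mf => //; exact: measurable_ball.
Qed.

End Geometry.

(** * A Vitali covering criterion *)

Section Covering.
Context {R : realType} {d : nat}.
Local Notation E := 'rV[R]_d.
Implicit Types (D s : seq (E * R)) (mu : {measure set E -> \bar R}).

Definition disjoint_balls D :=
  uniq D /\ forall p q, p \in D -> q \in D -> p != q ->
    forall z, ball p.1 p.2 z -> ball q.1 q.2 z -> False.

Lemma exists_max_radius p s :
  exists2 q, q \in p :: s & forall u, u \in p :: s -> u.2 <= q.2.
Proof.
elim: s p => [|a s IH] p.
  by exists p; rewrite ?mem_head// => u; rewrite inE => /eqP ->.
have [q qs qmax] := IH a; have [pq|qp] := leP p.2 q.2.
  exists q; first by rewrite inE qs orbT.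
  by move=> u; rewrite inE => /orP[/eqP ->//|]; exact: qmax.
exists p; first exact: mem_head.
move=> u; rewrite inE => /orP[/eqP ->//|/qmax us].
exact: le_trans us (ltW qp).
Qed.

(** Greedy selection: a ball of largest radius is kept, and the balls that meet it
    are dropped, since its threefold enlargement contains them. *)
Lemma finite_vitali s : (forall p, p \in s -> 0 < p.2) ->
  exists D, [/\ disjoint_balls D, {subset D <= s} &
    forall p, p \in s -> exists2 q, q \in D & ball p.1 p.2 `<=` ball q.1 (3 * q.2)].
Proof.
move: {2}(size s) (leqnn (size s)) => n; elim: n s => [|n IH] s.
  by rewrite leqn0 size_eq0 => /eqP -> _; exists [::].
case: s => [_ _|p0 s0]; first by exists [::].
move: (p0 :: s0) (exists_max_radius p0 s0) => s [p ps pmax] sn s0'.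
pose disj (q : E * R) := `[<forall z, ball p.1 p.2 z -> ball q.1 q.2 z -> False>].
pose s' := [seq q <- s | (q != p) && disj q].
have [|q|D [[uD dD] Ds' Dcov]] := IH s'.
- rewrite -ltnS (leq_trans _ sn)// size_filter -[ltnRHS](count_predC (pred1 p)).
  rewrite -[ltnLHS]add0n -addSn leq_add ?sub_count//.
    by rewrite -has_count has_pred1.
  by move=> q /andP[].
- by rewrite mem_filter => /andP[_ /s0'].
have pD : p \notin D by apply/negP => /Ds'; rewrite mem_filter eqxx.
have pdisj q : q \in D -> forall z, ball p.1 p.2 z -> ball q.1 q.2 z -> False.
  by move=> /Ds'; rewrite mem_filter => /andP[/andP[_ /asboolP]].
exists (p :: D); split.
- split; first by rewrite /= pD.
  move=> q u; rewrite !inE => /orP[/eqP ->|qD] /orP[/eqP ->|uD'].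
  + by rewrite eqxx.
  + by move=> _; exact: pdisj.
  + by move=> _ z qz pz; exact: (pdisj _ qD z).
  + exact: dD.
- by move=> q; rewrite inE => /orP[/eqP ->//|/Ds']; rewrite mem_filter => /andP[].
- move=> q qs.
  have [dq|/asboolPn/existsNP[z /not_implyP[pz /not_implyP[qz _]]]] := boolP (disj q).
    have [->|qp] := eqVneq q p.
      exists p; first exact: mem_head.
      by apply: le_ball; rewrite ler_peMl ?ler1n// ltW// s0'.
    have [|u uD' qu] := Dcov q; first by rewrite mem_filter qp dq.
    by exists u => //; rewrite inE uD' orbT.
  exists p; first exact: mem_head.
  move=> w qw; apply: (@le_ball _ _ _ (p.2 + (q.2 + q.2))).
    by have := pmax _ qs; lra.
  exact: ball_triangle pz (ball_triangle (ball_sym qz) qw).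
Qed.

Lemma measure_bigsetU_le mu (I : eqType) (s : seq I) (B : I -> set E) :
  (forall i, measurable (B i)) ->
  (mu (\big[setU/set0]_(i <- s) B i) <= \sum_(i <- s) mu (B i))%E.
Proof.
move=> mB; elim: s => [|i s IH]; first by rewrite !big_nil measure0.
rewrite !big_cons; apply: le_trans (measureU2 _ _ _) _ => //.
  exact: bigsetU_measurable.
exact: leeD2l.
Qed.

Lemma mem_bigsetU (I : eqType) (s : seq I) (B : I -> set E) x :
  (\big[setU/set0]_(i <- s) B i) x <-> exists2 i, i \in s & B i x.
Proof.
elim: s => [|i s IH]; first by rewrite big_nil; split => // -[].
rewrite big_cons; split.
  case=> [Bx|/IH[j js Bx]]; first by exists i; rewrite ?mem_head.
  by exists j; rewrite // inE js orbT.
case=> j; rewrite inE => /orP[/eqP ->|js] Bx; first by left.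
by right; apply/IH; exists j.
Qed.

(** The Lindelof property turns an arbitrary union of balls into an increasing
    sequence of finite unions, and [finite_vitali] bounds each of these. *)
Lemma vitali_measure_le mu (F : set (E * R)) (C : \bar R) :
  (forall p, F p -> 0 < p.2) ->
  (forall D, disjoint_balls D -> (forall p, p \in D -> F p) ->
    (\sum_(p <- D) mu (ball p.1 (3 * p.2)) <= C)%E) ->
  (mu (\bigcup_(p in F) ball p.1 p.2) <= C)%E.
Proof.
move=> F0 FC.
pose rb (c : 'rV[rat]_d * nat) : set E := ball (map_mx ratr c.1 : E) c.2.+1%:R^-1.
(* [f k] is a ball of the family that contains the k-th rational ball, if any does *)
have /choice[f fP] : forall k : nat, exists o : option (E * R),
    (forall p, o = Some p -> F p) /\
    (forall c p, unpickle k = Some c -> F p -> rb c `<=` ball p.1 p.2 ->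
       exists2 p', o = Some p' & rb c `<=` ball p'.1 p'.2).
  move=> k.
  have [[c [p [kc Fp cp]]]|H] := pselect (exists c p, [/\ unpickle k = Some c, F p & rb c `<=` ball p.1 p.2]).
    exists (Some p); split; first by move=> ? [<-].
    by move=> c' p' kc' _ _; exists p => //; move: kc'; rewrite kc => -[<-].
  by exists None; split => // c p kc Fp cp; exfalso; apply: H; exists c, p.
pose L N := pmap f (iota 0 N).
pose G N : set E := \big[setU/set0]_(p <- L N) ball p.1 p.2.
have LF N p : p \in L N -> F p.
  rewrite mem_pmap => /mapP[k _ /esym fk]; exact: (fP k).1.
have mG N : measurable (G N).
  by apply: bigsetU_measurable => p _; exact: measurable_ball_rV.
have -> : \bigcup_(p in F) ball p.1 p.2 = \bigcup_N G N.
  apply/seteqP; split => x; last first.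
    by move=> [N _ /mem_bigsetU[p /LF Fp px]]; exists p.
  move=> [p Fp px].
  have [q [n [qx qp]]] := rat_ball (@ball_open _ _ p.1 p.2) px.
  have [_ /(_ (q, n) p (pickleK _) Fp qp)[p' fp' qp']] := fP (pickle (q, n)).
  exists (pickle (q, n)).+1 => //; apply/mem_bigsetU; exists p'; last exact: qp'.
  rewrite mem_pmap; apply/mapP; exists (pickle (q, n)); last by rewrite fp'.
  by rewrite mem_iota/= add0n.
have GC N : (mu (G N) <= C)%E.
  have [|D [dD DL Dcov]] := @finite_vitali (L N); first by move=> p /LF/F0.
  apply: le_trans (FC D dD _); last by move=> p /DL/LF.
  apply: le_trans (measure_bigsetU_le mu D _); last first.
    by move=> p; exact: measurable_ball_rV.
  apply: le_measure; rewrite ?inE//.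
    by apply: bigsetU_measurable => p _; exact: measurable_ball_rV.
  move=> x /mem_bigsetU[p /Dcov[q qD pq] /pq qx]; apply/mem_bigsetU.
  by exists q.
have GG : {homo G : n m / (n <= m)%N >-> (n <= m)%O}.
  move=> n m nm; apply/subsetPset => x /mem_bigsetU[p + px].
  rewrite mem_pmap => /mapP[k kn fk]; apply/mem_bigsetU; exists p => //.
  rewrite mem_pmap; apply/mapP; exists k => //.
  by move: kn; rewrite !mem_iota !add0n/= => /leq_trans; apply.
have cv := @nondecreasing_cvg_mu _ _ _ mu G mG (bigcupT_measurable _ mG) GG.
rewrite -(cvg_lim _ cv)//; apply: lime_le; first by apply/cvg_ex; eexists; exact: cv.
exact: nearW.
Qed.

(** The form in which coverings are used: a bad event [P x r] fails at almost every
    [x] for all small [r] as soon as disjoint bad balls have enlargements of small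
    total mass. This is why all the estimates at small scales below compare a
    quantity attached to [ball x r] with the mass of [ball x (3 * r)]: it makes
    them true almost everywhere for an arbitrary Radon measure. *)
Lemma vitali_ae mu (P : E -> R -> Prop) :
  (forall e : R, 0 < e -> exists2 rho : E -> R, (forall x, 0 < rho x) &
     forall D, disjoint_balls D ->
       (forall p, p \in D -> [/\ 0 < p.2, p.2 < rho p.1 & P p.1 p.2]) ->
       (\sum_(p <- D) mu (ball p.1 (3 * p.2)) <= e%:E)%E) ->
  {ae mu, forall x, exists2 rho : R, 0 < rho &
     forall r, 0 < r -> r < rho -> ~ P x r}.
Proof.
move=> H.
have /choice[rho rhoP] : forall n : nat, exists rho : E -> R, (forall x, 0 < rho x) /\
     forall D, disjoint_balls D ->
       (forall p, p \in D -> [/\ 0 < p.2, p.2 < rho p.1 & P p.1 p.2]) ->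
       (\sum_(p <- D) mu (ball p.1 (3 * p.2)) <= (n.+1%:R^-1)%:E)%E.
  by move=> n; have [|rho r0 rP] := H n.+1%:R^-1; [rewrite invr_gt0|exists rho].
pose F n := [set p : E * R | [/\ 0 < p.2, p.2 < rho n p.1 & P p.1 p.2]].
pose U n : set E := \bigcup_(p in F n) ball p.1 p.2.
have mU n : measurable (U n).
  by apply: open_measurable_rV; apply: bigcup_open => p _; exact: ball_open.
have Un n : (mu (U n) <= (n.+1%:R^-1)%:E)%E.
  by apply: vitali_measure_le => [p []//|D dD DF]; exact: (rhoP n).2.
exists (\bigcap_n U n); split.
- exact: bigcapT_measurable.
- apply/eqP; rewrite eq_le measure_ge0 andbT.
  apply/lee_addgt0Pr => e e0; rewrite add0e.
  have [n ne] := ex_invn e0.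
  apply: (@le_trans _ _ (mu (U n))).
    apply: le_measure; rewrite ?inE//; first exact: bigcapT_measurable.
    exact: bigcap_inf.
  by apply: le_trans (Un n) _; rewrite lee_fin ltW.
- move=> x /= Hx n _; apply: contrapT => Ux; apply: Hx.
  exists (rho n x); first exact: (rhoP n).1.
  move=> r r0 rn Pxr; apply: Ux; exists (x, r) => //=.
  exact: ballxx.
Qed.

End Covering.

(** * Small Lipschitz functions and the Arens-Eells space *)

Section Charges.
Context {R : realType} {d : nat}.
Local Notation E := 'rV[R]_d.
Implicit Types (f g h : {charge set E -> \bar R}) (u : E -> R).

Local Notation pos f := (jordan_pos (svalP (hahn f))).
Local Notation neg f := (jordan_neg (svalP (hahn f))).

Lemma bounded_integrable (m : {measure set E -> \bar R}) u (M : R) :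
  (m setT < +oo)%E -> measurable_fun setT u -> (forall x, `|u x| <= M) ->
  m.-integrable setT (EFin \o u).
Proof.
move=> mT mu uM; apply: measurable_bounded_integrable => //.
by exists M; split; [exact: num_real|move=> t Mt x _; exact: le_trans (uM x) (ltW Mt)].
Qed.

Lemma Rintegral_bound (m : {measure set E -> \bar R}) u (M : R) :
  (m setT < +oo)%E -> measurable_fun setT u -> (forall x, `|u x| <= M) ->
  `|\int[m]_x u x| <= M * fine (m setT).
Proof.
move=> mT mu uM.
have ui := bounded_integrable mT mu uM.
apply: le_trans (le_normr_Rintegral measurableT ui) _.
rewrite -Rintegral_cst//; apply: le_Rintegral => //.
  apply: (@bounded_integrable _ _ M) => // [|x]; first exact: measurableT_comp.
  by rewrite normr_id.
apply: (@bounded_integrable _ _ M) => // x; rewrite ger0_norm//.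
exact: le_trans (uM x).
Qed.

Lemma Rintegral_measure_add (m1 m2 : {measure set E -> \bar R}) u :
  m1.-integrable setT (EFin \o u) -> m2.-integrable setT (EFin \o u) ->
  \int[measure_add m1 m2]_x u x = \int[m1]_x u x + \int[m2]_x u x.
Proof.
move=> i1 i2; rewrite /Rintegral integral_measure_add// fineD//.
  exact: integrable_fin_num i1.
exact: integrable_fin_num i2.
Qed.

Lemma charge_fineE f A : measurable A ->
  fine (f A) = fine (pos f A) - fine (neg f A).
Proof.
move=> mA; rewrite (jordan_decomp (svalP (hahn f)) mA) /cadd/= cscaleN1.
by rewrite fineD ?fineN//; rewrite ?fin_numN fin_num_measure.
Qed.

Definition charge_mass f : R := fine (pos f setT) + fine (neg f setT).

Lemma charge_mass_ge0 f : 0 <= charge_mass f.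
Proof. by rewrite addr_ge0// fine_ge0// measure_ge0. Qed.

Lemma jordan_lty f : ((pos f setT < +oo)%E * (neg f setT < +oo)%E)%type.
Proof. by rewrite !ltey_eq !fin_num_measure. Qed.

Lemma charge_int_bound f u (M : R) : measurable_fun setT u ->
  (forall x, `|u x| <= M) -> `|charge_int f u| <= M * charge_mass f.
Proof.
move=> mu uM; rewrite /charge_int (le_trans (ler_normB _ _))// mulrDr.
by rewrite lerD// Rintegral_bound// jordan_lty.
Qed.

Lemma charge_intN f u (M : R) : measurable_fun setT u ->
  (forall x, `|u x| <= M) -> charge_int f (fun x => - u x) = - charge_int f u.
Proof.
move=> mu uM.
have H (m : {finite_measure set E -> \bar R}) : \int[m]_x (- u x) = - \int[m]_x u x.
  under eq_Rintegral do rewrite -mulN1r.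
  rewrite RintegralZl ?mulN1r//.
  by apply: bounded_integrable mu uM; rewrite ltey_eq fin_num_measure.
by rewrite /charge_int !H; ring.
Qed.

(** [charge_int] goes through a Jordan decomposition, which is not additive in the
    charge. The decompositions are compared through the equality of measures
    h+ + f- + g+ = h- + f+ + g-. *)
Lemma charge_intB h f g u (M : R) :
  (forall A, measurable A -> h A = (f A - g A)%E) ->
  measurable_fun setT u -> (forall x, `|u x| <= M) ->
  charge_int h u = charge_int f u - charge_int g u.
Proof.
move=> hfg mu uM.
have I (m : {finite_measure set E -> \bar R}) : m.-integrable setT (EFin \o u).
  by apply: bounded_integrable mu uM; rewrite ltey_eq fin_num_measure.
have Ia (m1 m2 : {finite_measure set E -> \bar R}) :
    (measure_add m1 m2).-integrable setT (EFin \o u).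
  apply: (bounded_integrable _ mu uM).
  by rewrite [ltLHS]measure_addE ltey_eq fin_numD !fin_num_measure.
have : \int[measure_add (measure_add (pos h) (neg f)) (pos g)]_x u x =
       \int[measure_add (measure_add (neg h) (pos f)) (neg g)]_x u x.
  rewrite /Rintegral; congr (fine _); apply: eq_measure_integral => A mA _.
  have addE (m1 m2 : {measure set E -> \bar R}) : measure_add m1 m2 A = (m1 A + m2 A)%E.
    exact: measure_addE.
  rewrite [LHS]addE [RHS]addE [X in (X + _)%E = _]addE [X in _ = (X + _)%E]addE.
  have := congr1 fine (hfg A mA).
  rewrite fineB ?fin_num_measure// (charge_fineE h mA) (charge_fineE f mA).
  rewrite (charge_fineE g mA) => H.
  rewrite -[LHS]fineK ?fin_numD ?fin_num_measure//.
  rewrite -[RHS]fineK ?fin_numD ?fin_num_measure//.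
  rewrite !fineD ?fin_numD ?fin_num_measure//.
  by congr EFin; move: H; clear; lra.
rewrite !Rintegral_measure_add//; try exact: I; try exact: (Ia (pos h) (neg f));
  try exact: (Ia (neg h) (pos f)).
by rewrite /charge_int; lra.
Qed.

Lemma charge_int_KR f u : Lip1 u -> ((charge_int f u)%:E <= KRnorm f)%E.
Proof. by move=> uL; apply: ereal_sup_ubound; exists u. Qed.

Lemma Lip1N u : Lip1 u -> Lip1 (fun x => - u x).
Proof. by move=> uL x y; rewrite -opprD normrN; exact: uL. Qed.

(** On 1-Lipschitz functions [F] is uniformly close to the integral against one
    fixed finite charge, and that integral is small on uniformly small functions. *)
Lemma AE_small (F : (E -> R) -> R) : AE F ->
  forall e : R, 0 < e -> exists2 rho : R, 0 < rho &
    forall u, testfun u -> Lip1 u -> (forall x, `|u x| <= rho) -> `|F u| <= e.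
Proof.
move=> [f [fM fC fF]] e e0.
have e20 : 0 < e / 2 by rewrite divr_gt0.
have [N NP] := fC _ e20.
exists (e / 2 / (charge_mass (f N) + 1)).
  by rewrite divr_gt0// ltr_wpDl// charge_mass_ge0.
move=> u tu uL ur.
have mu : measurable_fun setT u by apply: continuous_measurable_rV; exact: (tu.1 0%N).
suff H : forall n, (N <= n)%N -> `|charge_int (f n) u| <= e.
  have /cvg_norm cF := fF u tu.
  rewrite -(cvg_lim _ cF)//; apply: limr_le; first by apply/cvg_ex; eexists; exact: cF.
  by exists N => // n Nn; exact: H.
move=> n Nn.
have hE : charge_int (cadd (f n) (copp (f N))) u = charge_int (f n) u - charge_int (f N) u.
  by apply: charge_intB mu ur => A mA.
have K1 : charge_int (f n) u - charge_int (f N) u < e / 2.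
  by rewrite -hE -lte_fin; apply: le_lt_trans (charge_int_KR _ uL) (NP _ _ _ _).
have K2 : - (charge_int (f n) u - charge_int (f N) u) < e / 2.
  rewrite -hE -(charge_intN _ mu ur) -lte_fin.
  by apply: le_lt_trans (charge_int_KR _ (Lip1N uL)) (NP _ _ _ _).
have K3 : `|charge_int (f N) u| <= e / 2.
  apply: le_trans (charge_int_bound _ mu ur) _.
  rewrite -[leRHS]mulr1 -mulrA ler_pM2l// mulrC ler_pdivrMr ?mul1r ?lerDl//.
  by rewrite ltr_wpDl// charge_mass_ge0.
move: K1 K2 K3; clear; rewrite !ler_norml => K1 K2 /andP[? ?].
by apply/andP; split; lra.
Qed.

End Charges.

(** * Test functions *)

Section Smooth.
Context {R : realType} {d : nat}.
Local Notation E := 'rV[R]_d.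
Implicit Types (f g phi : E -> R) (x y v w : E).

Lemma classCS n f : classC n.+1 f ->
  (forall x, differentiable f x) /\ (forall i, classC n (partial i f)).
Proof. by []. Qed.

Lemma classC_continuous n f : classC n f -> continuous f.
Proof.
by case: n => [//|n [df _]] x; exact: (differentiable_continuous (df x)).
Qed.

Lemma classC_weaken n f : classC n.+1 f -> classC n f.
Proof.
elim: n f => [|n IH] f; first exact: classC_continuous.
by move=> [df pf]; split => // i; apply: IH; exact: pf.
Qed.

Lemma classC_cst n (c : R) : classC n (fun _ : E => c).
Proof.
elim: n c => [|n IH] c; first exact: cst_continuous.
split=> [x|i]; first exact: differentiable_cst.
rewrite (_ : partial i _ = (fun=> 0)) //; apply/funext => x.
exact: derive_cst.
Qed.

Lemma classC_add n f g : classC n f -> classC n g ->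
  classC n (fun x => f x + g x).
Proof.
elim: n f g => [|n IH] f g.
  by move=> cf cg x; exact: (continuousD (cf x) (cg x)).
move=> /classCS[df pf] /classCS[dg pg]; split=> [x|i]; first exact: differentiableD.
rewrite (_ : partial i _ = (fun x => partial i f x + partial i g x)); first by apply: IH; [exact: pf|exact: pg].
by apply/funext => x; apply: deriveD; exact: diff_derivable.
Qed.

Lemma classC_mul n f g : classC n f -> classC n g ->
  classC n (fun x => f x * g x).
Proof.
elim: n f g => [|n IH] f g.
  by move=> cf cg x; exact: (continuousM (cf x) (cg x)).
move=> cf cg; have [df pf] := classCS cf; have [dg pg] := classCS cg.
split=> [x|i]; first exact: differentiableM.
rewrite (_ : partial i _ =
  (fun x => f x * partial i g x + g x * partial i f x)).
  by apply: classC_add; apply: IH; solve [exact: classC_weaken|exact: pf|exact: pg].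
by apply/funext => x; apply: deriveM; exact: diff_derivable.
Qed.

Lemma classC_prod n (I : Type) (s : seq I) (F : I -> E -> R) :
  (forall i, classC n (F i)) -> classC n (fun x => \prod_(i <- s) F i x).
Proof.
move=> cF; elim: s => [|i s IH].
  by under eq_fun do rewrite big_nil; exact: classC_cst.
by under eq_fun do rewrite big_cons; exact: classC_mul.
Qed.

Lemma is_diff_affine (a : R) w x :
  is_diff x (fun y : E => a *: y + w) ( *:%R a).
Proof.
have H : is_diff x (fun y : E => a *: y + w) (a *: id + 0) by exact: is_diffD.
by apply: is_diff_eq H _; apply/funext => y; rewrite /= addr0.
Qed.

Lemma derive_affine f (a : R) w x v : (forall x, differentiable f x) ->
  'D_v (fun y => f (a *: y + w)) x = a * 'D_v f (a *: x + w).
Proof.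
move=> df; have [dA eA] := is_diff_affine a w x.
pose A (y : E) := a *: y + w.
rewrite (deriveE _ (df _)) (deriveE _ (@differentiable_comp _ _ _ _ A f _ dA (df _))).
have e := congr1 (fun F : E -> R => F v) (@diff_comp _ _ _ _ A f _ dA (df _)).
rewrite [LHS]e /= (_ : 'd A x v = a *: v) ?linearZ//.
exact: (congr1 (fun F : E -> E => F v) eA).
Qed.

Lemma classC_affine n f (a : R) w : classC n f ->
  classC n (fun x => f (a *: x + w)).
Proof.
elim: n f => [|n IH] f.
  move=> cf x; have [dA _] := is_diff_affine a w x.
  exact: (continuous_comp (differentiable_continuous dA) (cf _)).
move=> /classCS[df pf]; split=> [x|i].
  have [dA _] := is_diff_affine a w x.
  exact: (@differentiable_comp _ _ _ _ (fun y : E => a *: y + w) f).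
rewrite (_ : partial i _ = (fun x => a * partial i f (a *: x + w))).
  by apply: classC_mul; [exact: classC_cst|apply: IH; exact: pf].
by apply/funext => x; exact: derive_affine.
Qed.

Lemma derive_partial f x v : differentiable f x ->
  'D_v f x = \sum_(i < d) v ord0 i * partial i f x.
Proof.
move=> df; rewrite deriveE// {1}(row_sum_delta v) linear_sum.
by apply: eq_bigr => i _; rewrite linearZ /partial deriveE.
Qed.

Lemma partial_affine f i (a : R) w x : (forall x, differentiable f x) ->
  partial i (fun y => f (a *: y + w)) x = a * partial i f (a *: x + w).
Proof. exact: derive_affine. Qed.

Lemma mean_value f y v : (forall x, differentiable f x) ->
  exists2 s : R, 0 <= s <= 1 & f (y + v) - f y = 'D_v f (y + s *: v).
Proof.
move=> df; pose g (t : R) := f (y + t *: v).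
have dg (t : R) : is_derive t 1 g ('D_v f (y + t *: v)).
  have e : (fun h : R => h^-1 *: ((g \o shift t) (h *: 1) - g t)) =
      (fun h : R => h^-1 *: ((f \o shift (y + t *: v)) (h *: v) - f (y + t *: v))).
    apply/funext => h; rewrite /g /=; congr (_ *: (f _ - _)).
    have -> : h *: (1 : R) = h by exact: mulr1.
    by rewrite scalerDl addrCA.
  have := @diff_derivable _ _ _ f _ v (df (y + t *: v)); rewrite /derivable -e => dv.
  by split; rewrite // /derive e.
have cg : {within `[0, 1], continuous g}.
  apply: continuous_subspaceT => t.
  by apply: differentiable_continuous; apply/derivable1_diffP; by case: (dg t).
have [s s01] := MVT_segment ler01 (fun t _ => dg t) cg.
rewrite subr0 mulr1 /g scale1r scale0r addr0 => H.
by exists s; first by move: s01; rewrite in_itv.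
Qed.

Lemma compactly_supportedP phi : compactly_supported phi <->
  exists2 M : R, 0 < M & forall x, M < `|x| -> phi x = 0.
Proof.
split.
  move=> /compact_bounded[M [_ HM]]; exists (`|M| + 1).
    by rewrite ltr_wpDl.
  move=> x; apply: contraPP => /eqP px; apply/negP; rewrite -leNgt.
  apply: HM; first by rewrite (le_lt_trans (ler_norm M))// ltrDl.
  exact: subset_closure.
move=> [M M0 HM]; apply: bounded_closed_compact; last exact: closed_closure.
exists M; split; first exact: num_real.
move=> N MN x xA /=; rewrite leNgt; apply/negP => Nx.
have [y [/= py]] : [set x | phi x != 0] `&` ball x (`|x| - M) !=set0.
  by apply: xA; apply: nbhsx_ballx; rewrite subr_gt0 (lt_trans MN).
move=> /ballP xy; have /eqP := py; apply; apply: HM.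
have := ler_normD (x - y) y; rewrite subrK; move: xy; clear; lra.
Qed.

Lemma partial_out f (M : R) i x : (forall x, M < `|x| -> f x = 0) ->
  M < `|x| -> partial i f x = 0.
Proof.
move=> fM Mx; rewrite /partial -(derive_cst (0 : R) x (delta_mx ord0 i)).
apply: near_eq_derive.
apply/nbhs_ballP; exists (`|x| - M) => /=; first by rewrite subr_gt0.
move=> y /ballP xy; apply: fM.
have := ler_normD (x - y) y; rewrite subrK; move: xy; clear; lra.
Qed.

Lemma testfun_cont phi : testfun phi -> continuous phi.
Proof. by move=> [H _]; exact: (H 0%N). Qed.

Lemma testfun_diff phi x : testfun phi -> differentiable phi x.
Proof. by move=> [H _]; exact: (H 1%N).1. Qed.

Lemma testfun_Cc0 phi : testfun phi -> Cc0 phi.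
Proof. by move=> H; split; [exact: testfun_cont|exact: H.2]. Qed.

Lemma testfun_partial i phi : testfun phi -> testfun (partial i phi).
Proof.
move=> [H K]; split; first by move=> n; exact: (H n.+1).2.
have /compactly_supportedP[M M0 HM] := K.
apply/compactly_supportedP; exists M => // x; exact: partial_out.
Qed.

Lemma testfun_sum (I : eqType) (s : seq I) (F : I -> E -> R) :
  (forall i, i \in s -> testfun (F i)) -> testfun (fun x => \sum_(i <- s) F i x).
Proof.
elim: s => [|i s IH] tF.
  under eq_fun do rewrite big_nil; split; first by move=> n; exact: classC_cst.
  by apply/compactly_supportedP; exists 1.
under eq_fun do rewrite big_cons.
have [|cs /compactly_supportedP[M M0 HM]] := IH.
  by move=> j js; apply: tF; rewrite inE js orbT.
have [ci /compactly_supportedP[N N0 HN]] := tF i (mem_head _ _).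
split; first by move=> n; exact: classC_add.
apply/compactly_supportedP; exists (M + N); first exact: addr_gt0.
move=> x Mx; rewrite HM ?HN ?addr0//; move: M0 N0 Mx; clear; lra.
Qed.

Lemma testfun_scale (a : R) phi : testfun phi -> testfun (fun x => a * phi x).
Proof.
move=> [H /compactly_supportedP[M M0 HM]]; split.
  by move=> n; apply: classC_mul; [exact: classC_cst|exact: H].
by apply/compactly_supportedP; exists M => // x /HM ->; rewrite mulr0.
Qed.

Lemma testfun_affine (a : R) w phi : a != 0 -> testfun phi ->
  testfun (fun x => phi (a *: x + w)).
Proof.
move=> a0 [H /compactly_supportedP[M M0 HM]]; split.
  by move=> n; exact: classC_affine.
have an : 0 < `|a| by rewrite normr_gt0.
apply/compactly_supportedP; exists ((M + `|w|) / `|a|).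
  by rewrite divr_gt0// ltr_pwDl.
move=> x; rewrite ltr_pdivrMr// => Hx; apply: HM.
have := ler_normB (a *: x + w) w; rewrite addrK normrZ.
move: Hx; rewrite [_ * `|a|]mulrC; clear; lra.
Qed.

Lemma Cc0_bounded phi : Cc0 phi -> exists2 M : R, 0 < M & forall x, `|phi x| <= M.
Proof.
move=> [cphi K]; have /compactly_supportedP[M M0 HM] := K.
have /compact_bounded[N [_ HN]] : compact (phi @` closure [set x | phi x != 0]).
  by apply: continuous_compact K; exact: continuous_subspaceT.
exists (`|N| + 1); first by rewrite ltr_wpDl.
move=> x; have [->|px] := eqVneq (phi x) 0; first by rewrite normr0 addr_ge0.
apply: HN; first by rewrite (le_lt_trans (ler_norm N))// ltrDl.
by exists x => //; exact: subset_closure.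
Qed.

Lemma testfun_lipschitz phi : testfun phi ->
  exists2 L : R, 0 < L & forall x y, `|phi x - phi y| <= L * enorm (x - y).
Proof.
move=> tphi.
have /choice[M MP] : forall i, exists M : R, forall x, `|partial i phi x| <= M.
  by move=> i; have [M _ HM] := Cc0_bounded (testfun_Cc0 (testfun_partial i tphi)); exists M.
have M0 i : 0 <= M i by exact: le_trans (MP i 0).
exists (\sum_i M i + 1); first by rewrite ltr_wpDl// sumr_ge0.
move=> x y; have [s _] := mean_value y (x - y) (fun z => testfun_diff z tphi).
rewrite (addrC y) subrK => ->; rewrite derive_partial; last exact: testfun_diff.
apply: le_trans (ler_norm_sum _ _ _) _; rewrite mulrDl mul1r mulr_suml.
rewrite ler_wpDr ?enorm_ge0//; apply: ler_sum => i _.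
rewrite normrM mulrC ler_pM//.
exact: le_trans (norm_coord _ _) (norm_le_enorm _).
Qed.

End Smooth.

(** * Elements of the Arens-Eells space at small scales *)

Section Blowup_control.
Context {R : realType} {d : nat}.
Local Notation E := 'rV[R]_d.
Implicit Types (D : seq (E * R)) (psi : E -> R) (F : (E -> R) -> R).
Implicit Types (mu : {measure set E -> \bar R}).

(** The constant 1/2 is what makes signed sums of such functions over disjoint
    balls 1-Lipschitz, see [disjoint_sum_Lip1]. *)
Definition adapted (x : E) (r : R) psi : Prop :=
  [/\ testfun psi, forall y z, `|psi y - psi z| <= enorm (y - z) / 2,
      forall y, `|psi y| <= r & forall y, ~ ball x r y -> psi y = 0].

Definition test_linear F : Prop := forall (I : eqType) (s : seq I) (a : I -> R) (psi : I -> E -> R),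
  (forall i, i \in s -> testfun (psi i)) ->
  F (fun x => \sum_(i <- s) a i * psi i x) = \sum_(i <- s) a i * F (psi i).

(** [F] has density zero with respect to [mu] at [x], as tested at scale [r] by
    functions of size [r] and slope of order one. *)
Definition AE_blowup_point mu F (x : E) := forall dl : R, 0 < dl ->
  exists2 rho : R, 0 < rho &
    forall r psi, 0 < r -> r < rho -> adapted x r psi ->
      (`|F psi|%:E <= dl%:E * mu (ball x (3 * r)))%E.

Section disjoint_sum.
Variables (D : seq (E * R)) (psi : E * R -> E -> R) (a : E * R -> R).
Hypotheses (dD : disjoint_balls D) (a1 : forall p, `|a p| <= 1).
Hypothesis psiD : forall p, p \in D -> adapted p.1 p.2 (psi p).

Let Psi x := \sum_(p <- D) a p * psi p x.

Lemma disjoint_sum_value x :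
  (exists p, [/\ p \in D, ball p.1 p.2 x & Psi x = a p * psi p x]) \/
  ((forall p, p \in D -> ~ ball p.1 p.2 x) /\ Psi x = 0).
Proof.
have [[p [pD px]]|H] := pselect (exists p, p \in D /\ ball p.1 p.2 x).
  left; exists p; split => //; rewrite /Psi (bigD1_seq p)//=; last exact: dD.1.
  rewrite big_seq_cond big1 ?addr0// => q /andP[qD qp].
  have [_ _ _ H] := psiD qD.
  by rewrite H ?mulr0// => qx; exact: (dD.2 _ _ qD pD qp x).
have H' p : p \in D -> ~ ball p.1 p.2 x by move=> pD px; apply: H; exists p.
right; split=> //; rewrite /Psi big_seq big1// => p pD.
by have [_ _ _ ->] := psiD pD; rewrite ?mulr0//; exact: H'.
Qed.

Lemma disjoint_sum_out p x : p \in D -> ~ ball p.1 p.2 x -> psi p x = 0.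
Proof. by move=> pD; have [_ _ _] := psiD pD; apply. Qed.

Lemma disjoint_sum_half p x y : p \in D -> ~ ball p.1 p.2 y ->
  `|a p * psi p x| <= enorm (x - y) / 2.
Proof.
move=> pD py; rewrite normrM -[leRHS]mul1r ler_pM// -[psi p x]subr0.
rewrite -(disjoint_sum_out pD py).
by have [_ H _ _] := psiD pD; exact: H.
Qed.

(** For points in two different balls, each of the two nonzero terms vanishes at the
    other point, so each contributes at most half of the distance. *)
Lemma disjoint_sum_Lip1 : Lip1 Psi.
Proof.
have tr (x y : E) : enorm (y - x) = enorm (x - y) by rewrite -opprB enormN.
have e0 (x y : E) : enorm (x - y) / 2 <= enorm (x - y).
  by rewrite ler_pdivrMr// ler_peMr ?enorm_ge0// ler1n.
move=> x y; case: (disjoint_sum_value x) => [[p [pD px ->]]|[Hx ->]];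
  case: (disjoint_sum_value y) => [[q [qD qy ->]]|[Hy ->]].
- have [->|pq] := eqVneq p q.
    apply: le_trans (e0 x y); rewrite -mulrBr normrM -[leRHS]mul1r ler_pM//.
    by have [_ H _ _] := psiD qD; exact: H.
  apply: le_trans (ler_normB _ _) _; rewrite [leRHS](splitr (enorm _)) lerD//.
    by apply: disjoint_sum_half => // py; exact: (dD.2 _ _ pD qD pq y).
  by rewrite -tr; apply: disjoint_sum_half => // qx; exact: (dD.2 _ _ pD qD pq x).
- by rewrite subr0; apply: le_trans (e0 x y); apply: disjoint_sum_half => //; exact: Hy.
- rewrite sub0r normrN; apply: le_trans (e0 x y); rewrite -tr.
  by apply: disjoint_sum_half => //; exact: Hx.
- by rewrite subrr normr0 enorm_ge0.
Qed.

Lemma disjoint_sum_bound (rho : R) : 0 <= rho -> (forall p, p \in D -> p.2 <= rho) ->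
  forall x, `|Psi x| <= rho.
Proof.
move=> rho0 Dr x; case: (disjoint_sum_value x) => [[p [pD px ->]]|[_ ->]]; last by rewrite normr0.
rewrite normrM -[leRHS]mul1r ler_pM// (le_trans _ (Dr _ pD))//.
by have [_ _ H _] := psiD pD.
Qed.

Lemma disjoint_sum_testfun : testfun Psi.
Proof.
by apply: testfun_sum => p pD; apply: testfun_scale; have [] := psiD pD.
Qed.

End disjoint_sum.

(** Were [F psi] large compared with the mass of [ball x (3 * r)] on many disjoint
    balls, the sum of the functions [psi] with the signs of [F psi] would be a
    uniformly small 1-Lipschitz function on which [F] is not small, against
    [AE_small]. The Vitali criterion concludes. *)
Lemma AE_blowup mu F : AE F -> test_linear F ->
  {ae mu, forall x, AE_blowup_point mu F x}.
Proof.
move=> AF linF.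
pose P (n : nat) (x : E) (r : R) := exists2 psi, adapted x r psi &
  (n.+1%:R^-1%:E * mu (ball x (3 * r)) < `|F psi|%:E)%E.
suff : forall n, {ae mu, forall x, exists2 rho : R, 0 < rho &
     forall r, 0 < r -> r < rho -> ~ P n x r}.
  move=> /ae_foralln; apply: filterS => x Hx dl dl0.
  have [n ne] := ex_invn dl0.
  have [rho rho0 H] := Hx n; exists rho => // r psi r0 rr psix.
  rewrite leNgt; apply/negP => lt; apply: (H r r0 rr); exists psi => //.
  by apply: le_lt_trans lt; rewrite lee_wpmul2r ?measure_ge0// lee_fin ltW.
move=> n; apply: vitali_ae => e e0.
have en0 : 0 < e / n.+1%:R by rewrite divr_gt0.
have [rho rho0 Hrho] := AE_small AF en0.
exists (fun=> rho) => // D dD DP.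
have /choice[psi psiP] : forall p, exists psi, p \in D ->
    adapted p.1 p.2 psi /\ (n.+1%:R^-1%:E * mu (ball p.1 (3 * p.2)) < `|F psi|%:E)%E.
  move=> p; have [pD|] := boolP (p \in D); last by exists (fun=> 0).
  by have [_ _ [psi ? ?]] := DP _ pD; exists psi.
pose a p := Num.sg (F (psi p)).
have a1 p : `|a p| <= 1 by rewrite /a normr_sg; case: (_ == 0).
have psiD p : p \in D -> adapted p.1 p.2 (psi p) by move/psiP => [].
have tPsi := disjoint_sum_testfun a psiD.
have H : \sum_(p <- D) `|F (psi p)| <= e / n.+1%:R.
  rewrite (_ : \sum_(p <- D) _ = F (fun x => \sum_(p <- D) a p * psi p x)).
    apply: le_trans (ler_norm _) _; apply: Hrho => //.
      exact: disjoint_sum_Lip1.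
    apply: disjoint_sum_bound => //; first exact: ltW.
    by move=> p /DP[_ /ltW].
  rewrite linF; last by move=> p /psiD[].
  by apply: eq_bigr => p _; rewrite normrEsg.
have n0 : 0 < n.+1%:R :> R by [].
rewrite -(@lee_pmul2l _ (n.+1%:R^-1)%:E) ?fin_numE// ?lte_fin ?invr_gt0//.
rewrite ge0_sume_distrr; last by move=> p _; exact: measure_ge0.
apply: (@le_trans _ _ (\sum_(p <- D) `|F (psi p)|%:E)%E).
  rewrite !big_seq; apply: lee_sum => p pD; apply: ltW; exact: (psiP p pD).2.
by rewrite sumEFin lee_fin mulrC.
Qed.

End Blowup_control.

(** * Outer regularity and density points *)

Section Regularity.
Context {R : realType} {d : nat}.
Local Notation E := 'rV[R]_d.
Implicit Types (mu m : {measure set E -> \bar R}) (A U V : set E).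

(** Outer regularity of [A] and of its complement at once, so that the class is
    closed under complements. *)
Definition regular_set m A := forall e : R, 0 < e -> exists U V,
  [/\ open U, open V, A `<=` U, ~` A `<=` V & (m (U `&` V) <= e%:E)%E].

Lemma decreasing_measure_le m (F : (set E)^nat) (e e' : R) :
  (m setT < +oo)%E -> (forall n, measurable (F n)) ->
  (forall n, F n.+1 `<=` F n) -> (m (\bigcap_n F n) <= e%:E)%E -> e < e' ->
  exists n, (m (F n) <= e'%:E)%E.
Proof.
move=> mT mF Fd Fe ee'; apply: contrapT => /forallNP H.
have mI : measurable (\bigcap_n F n) by exact: bigcapT_measurable.
have F0 : (m (F 0%N) < +oo)%E.
  by apply: le_lt_trans mT; apply: le_measure; rewrite ?inE.
have cv := @nonincreasing_cvg_mu _ _ _ m F F0 mF mI.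
have {}cv := cv ltac:(by apply/nonincreasing_seqP => n; apply/subsetPset; exact: Fd).
suff : (e'%:E <= m (\bigcap_n F n))%E.
  by move=> /le_trans/(_ Fe); rewrite lee_fin leNgt ee'.
rewrite -(cvg_lim _ cv)//; apply: lime_ge; first by apply/cvg_ex; eexists; exact: cv.
by apply: nearW => n; have /negP := H n; rewrite -ltNge => /ltW.
Qed.

Lemma open_regular m A : (m setT < +oo)%E -> open A -> regular_set m A.
Proof.
move=> mT oA e e0.
pose V n : set E := \bigcup_(y in ~` A) ball y n.+1%:R^-1.
have oV n : open (V n) by apply: bigcup_open => y _; exact: ball_open.
have [n|n|||n Hn] := @decreasing_measure_le m (fun n => A `&` V n) 0 e mT.
- by apply: open_measurable_rV; exact: openI.
- move=> x [Ax [y Ay yx]]; split=> //; exists y => //.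
  apply: le_ball yx; rewrite lef_pV2 ?posrE//; by rewrite ler_nat.
- rewrite (_ : \bigcap_n _ = set0) ?measure0// -subset0 => x H.
  have [Ax _] := H 0%N I.
  have /nbhs_ballP[r /= r0 rA] := open_nbhs_nbhs (conj oA Ax).
  have [k kr] := ex_invn r0.
  have [_ [y Ay yx]] := H k I.
  by apply: Ay; apply: rA; apply: (@le_ball _ _ _ k.+1%:R^-1); [exact: ltW|exact: ball_sym].
- exact: e0.
exists A, (V n); split => // x Ax; exists x => //.
by apply: ballxx; rewrite invr_gt0.
Qed.

Lemma regular_setC m A : regular_set m A -> regular_set m (~` A).
Proof.
move=> H e e0; have [U [V [oU oV AU AV me]]] := H e e0.
by exists V, U; split => //; rewrite ?setCK// setIC.
Qed.

(** Infinite intersections of open sets need not be open: the neighbourhoods of the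
    complements are intersected up to a finite rank [n], chosen by continuity of the
    measure from above. *)
Lemma regular_bigcup m (A : (set E)^nat) : (m setT < +oo)%E ->
  (forall n, regular_set m (A n)) -> regular_set m (\bigcup_n A n).
Proof.
move=> mT rA e e0; have e20 : 0 < e / 2 by rewrite divr_gt0.
have /choice[UV HUV] : forall n, exists UV : set E * set E,
    [/\ open UV.1, open UV.2, A n `<=` UV.1, ~` A n `<=` UV.2 &
       (m (UV.1 `&` UV.2) <= (e / 2 / (2 ^ n.+1)%:R)%:E)%E].
  move=> n; have [|U [V H]] := rA n (e / 2 / (2 ^ n.+1)%:R).
    by rewrite divr_gt0// ltr0n expn_gt0.
  by exists (U, V).
pose U := \bigcup_n (UV n).1.
pose VN := fix VN n := if n is n'.+1 then VN n' `&` (UV n').2 else setT.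
have oVN n : open (VN n).
  elim: n => [|n IH]; first exact: openT.
  by apply: openI => //; have [] := HUV n.
have oU : open U by apply: bigcup_open => n _; have [] := HUV n.
have AVN n : ~` (\bigcup_n A n) `<=` VN n.
  elim: n => [//|n IH] x Ax; split; first exact: IH.
  have [_ _ _ + _] := HUV n; apply => Anx; apply: Ax; by exists n.
have [n|n|||n Hn] := @decreasing_measure_le m (fun n => U `&` VN n) (e / 2) e mT.
- by apply: open_measurable_rV; exact: openI.
- by move=> x [Ux [? _]].
- apply: (@le_trans _ _ (m (\bigcup_n ((UV n).1 `&` (UV n).2)))).
    have mUV k : measurable ((UV k).1 `&` (UV k).2).
      by have [? ? _ _ _] := HUV k; apply: open_measurable_rV; exact: openI.
    apply: le_measure; rewrite ?inE.
    + by apply: bigcapT_measurable => n; apply: open_measurable_rV; exact: openI.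
    + exact: bigcupT_measurable.
    move=> x H; have [[k _ Uk] _] := H 0%N I.
    by exists k => //; split=> //; have [_ [_ ]] := H k.+1 I.
  apply: le_trans (epsilon_trick0 xpredT (ltW e20)).
  apply: le_trans (generalized_Boole_inequality _ _ _) _ => //.
  - move=> k; have [? ? _ _ _] := HUV k; apply: open_measurable_rV; exact: openI.
  - apply: bigcupT_measurable => k; have [? ? _ _ _] := HUV k; apply: open_measurable_rV; exact: openI.
  by apply: lee_nneseries => // k _; have [] := HUV k.
- by rewrite ltr_pdivrMr// ltr_pMr// ltr1n.
exists U, (VN n); split => // x [k _ Ak]; exists k => //.
by have [_ _ + _ _] := HUV k; apply.
Qed.

Lemma finite_regular m A : (m setT < +oo)%E -> measurable A -> regular_set m A.
Proof.
move=> mT; have : <<s @open E >> `<=` regular_set m; last exact.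
apply: smallest_sub; last by move=> U; exact: open_regular.
split.
- by apply: open_regular => //; exact: open0.
- by move=> B; rewrite setTD; exact: regular_setC.
- by move=> B; exact: regular_bigcup.
Qed.

Lemma radon_bounded mu (r : R) (x : E) : radon mu -> (mu (ball x r) < +oo)%E.
Proof.
move=> rmu; have cB : compact (closed_ball x r).
  apply: bounded_closed_compact; last exact: closed_ball_closed.
  exists (`|x| + `|r|); split; first exact: num_real.
  move=> N HN y /= xy; have {}xy : `|x - y| <= `|r|.
    have [r0|r0] := leP r 0; first by move: xy; rewrite closed_ball0.
    by move: xy; rewrite closed_ballE// /closed_ball_ /= (gtr0_norm r0).
  have := ler_normB x (x - y); rewrite opprB addrC subrK; move: xy HN; clear; lra.
apply: le_lt_trans (rmu _ cB); apply: le_measure; rewrite ?inE.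
- exact: measurable_ball_rV.
- exact: compact_measurable_rV.
- exact: subset_closed_ball.
Qed.

(** The restrictions to balls of integer radii are finite, and the errors left by
    the open sets found for them are summed geometrically. *)
Lemma radon_outer_regular mu A : radon mu -> measurable A ->
  forall e : R, 0 < e ->
    exists U, [/\ open U, A `<=` U & (mu (U `\` A) <= e%:E)%E].
Proof.
move=> rmu mA e e0; pose B (n : nat) : set E := ball 0 n.+1%:R.
have mB n : measurable (B n) by exact: measurable_ball_rV.
have /choice[U HU] : forall n, exists U, [/\ open U, A `<=` U &
    (mu ((U `&` B n) `\` A) <= (e / (2 ^ n.+1)%:R)%:E)%E].
  move=> n; pose m := mrestr mu (mB n).
  have mT : (m setT < +oo)%E by rewrite /m /mrestr setTI; exact: radon_bounded.
  have [|U [V [oU oV AU AV UV]]] := finite_regular mT mA (e := e / (2 ^ n.+1)%:R).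
    by rewrite divr_gt0// ltr0n expn_gt0.
  exists U; split => //; apply: le_trans UV; rewrite /m /mrestr.
  apply: le_measure; rewrite ?inE.
  - by apply: measurableD => //; apply: measurableI => //; exact: open_measurable_rV.
  - by apply: measurableI => //; apply: open_measurable_rV; exact: openI.
  - by move=> x [[Ux Bx] Ax]; split=> //; split => //; exact: AV.
have oUB n : open (U n `&` B n).
  by apply: openI; [have [] := HU n|exact: ball_open].
exists (\bigcup_n (U n `&` B n)); split.
- by apply: bigcup_open => n _; exact: oUB.
- move=> x Ax; exists (Num.truncn `|x|) => //; split; first by have [_ + _] := HU (Num.truncn `|x|); apply.
  by apply/ballP; rewrite sub0r normrN truncnS_gt.
- rewrite setD_bigcupl; apply: le_trans (epsilon_trick0 xpredT (ltW e0)).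
  have mD k : measurable ((U k `&` B k) `\` A).
    by apply: measurableD => //; apply: open_measurable_rV.
  apply: le_trans (generalized_Boole_inequality _ mD _) _.
    exact: bigcupT_measurable.
  by apply: lee_nneseries => // k _; have [] := HU k.
Qed.

Lemma disjoint_balls_measure mu A D C : measurable A -> measurable C ->
  disjoint_balls D -> (forall p, p \in D -> ball p.1 p.2 `\` A `<=` C) ->
  (\sum_(p <- D) mu (ball p.1 p.2 `\` A) <= mu C)%E.
Proof.
move=> mA; elim: D C => [|p D IH] C mC [uD dD] DC.
  by rewrite big_nil measure_ge0.
rewrite big_cons.
have mp : measurable (ball p.1 p.2 : set E) by exact: measurable_ball_rV.
have mpA : measurable (ball p.1 p.2 `\` A) by exact: measurableD.
rewrite -(setDUK (DC p (mem_head _ _))) measureU//; first last.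
- by rewrite setIC setDKI.
- exact: measurableD.
apply: leeD2l; apply: IH; first exact: measurableD.
  split; first by case/andP: uD.
  by move=> q r qD rD; apply: dD; rewrite inE ?qD ?rD orbT.
move=> q qD x [qx Ax]; split; first by apply: (DC q); rewrite ?inE ?qD ?orbT.
move=> [px _]; apply: (dD p q _ _ _ x px qx); rewrite ?mem_head//.
  by rewrite inE qD orbT.
by case/andP: uD => /negP pD _; apply/eqP => pq; apply: pD; rewrite pq.
Qed.

(** Take an open [U] containing [A] with [mu (U `\` A)] small. Small balls centred in
    [A] lie in [U], hence the parts outside [A] of disjoint ones have total mass at
    most [mu (U `\` A)], and the Vitali criterion applies. *)
Lemma density_ae mu A : radon mu -> measurable A ->
  {ae mu, forall x, A x -> forall dl : R, 0 < dl -> exists2 rho : R, 0 < rho &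
    forall r, 0 < r -> r < rho ->
      (mu (ball x r `\` A) <= dl%:E * mu (ball x (3 * r)))%E}.
Proof.
move=> rmu mA.
pose P (n : nat) (x : E) (r : R) := A x /\
  (n.+1%:R^-1%:E * mu (ball x (3 * r)) < mu (ball x r `\` A))%E.
suff : forall n, {ae mu, forall x, exists2 rho : R, 0 < rho &
     forall r, 0 < r -> r < rho -> ~ P n x r}.
  move=> /ae_foralln; apply: filterS => x Hx Ax dl dl0.
  have [n ne] := ex_invn dl0.
  have [rho rho0 H] := Hx n; exists rho => // r r0 rr.
  rewrite leNgt; apply/negP => lt; apply: (H r r0 rr); split => //.
  by apply: le_lt_trans lt; rewrite lee_wpmul2r ?measure_ge0// lee_fin ltW.
move=> n; apply: vitali_ae => e e0.
have en0 : 0 < e / n.+1%:R by rewrite divr_gt0.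
have [U [oU AU Ue]] := radon_outer_regular rmu mA en0.
have /choice[rho rhoP] : forall x, exists rho : R, 0 < rho /\ (A x -> ball x rho `<=` U).
  move=> x; have [/AU Ux|nAx] := pselect (A x); last by exists 1.
  have /nbhs_ballP[r /= r0 rA] := open_nbhs_nbhs (conj oU Ux).
  by exists r.
exists rho; first by move=> x; exact: (rhoP x).1.
move=> D dD DP.
have n0 : 0 < n.+1%:R :> R by [].
rewrite -(@lee_pmul2l _ (n.+1%:R^-1)%:E) ?fin_numE// ?lte_fin ?invr_gt0//.
rewrite ge0_sume_distrr; last by move=> p _; exact: measure_ge0.
rewrite -EFinM mulrC; apply: le_trans Ue.
have mU := open_measurable_rV oU.
apply: (@le_trans _ _ (\sum_(p <- D) mu (ball p.1 p.2 `\` A))%E).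
  rewrite !big_seq; apply: lee_sum => p pD; apply: ltW.
  by have [_ _ [_ ]] := DP p pD.
apply: disjoint_balls_measure => //; first exact: measurableD.
move=> p pD x [px Ax]; split => //; have [p0 pr [Ap _]] := DP p pD.
by apply: (rhoP p.1).2 => //; exact: le_ball (ltW pr) _ px.
Qed.

End Regularity.

(** * Divergence of a field and Lebesgue points *)

Section Blowup.
Context {R : realType} {d : nat}.
Local Notation E := 'rV[R]_d.
Implicit Types (mu : {measure set E -> \bar R}) (u phi psi : E -> R).
Implicit Types (sigma : E -> E).

Lemma ae_countable mu (I : countType) (P : I -> E -> Prop) :
  (forall i, {ae mu, forall x, P i x}) -> {ae mu, forall x, forall i, P i x}.
Proof.
move=> H; have : {ae mu, forall x, forall n i, @unpickle I n = Some i -> P i x}.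
  apply: ae_foralln => n; case: (unpickle n) => [i|]; last first.
    by apply: aeW.
  by apply: filterS (H i) => x Px j [<-].
by apply: filterS => x Px i; apply: (Px (pickle i)); rewrite pickleK.
Qed.

Lemma Rintegral_sum mu (I : eqType) (s : seq I) (f : I -> E -> R) :
  (forall i, i \in s -> mu.-integrable setT (EFin \o f i)) ->
  mu.-integrable setT (EFin \o (fun x => \sum_(i <- s) f i x)) /\
  \int[mu]_x (\sum_(i <- s) f i x) = \sum_(i <- s) \int[mu]_x f i x.
Proof.
elim: s => [|i s IH] fi.
  split.
    rewrite (_ : _ \o _ = cst 0%E); first exact: integrable0.
    by apply/funext => x /=; rewrite big_nil.
  by rewrite big_nil; under eq_Rintegral do rewrite big_nil; rewrite Rintegral_cst ?mul0r.
have [|isum sum] := IH; first by move=> j js; apply: fi; rewrite inE js orbT.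
have ii : mu.-integrable setT (EFin \o f i) by apply: fi; exact: mem_head.
split.
  rewrite (_ : _ \o _ = (EFin \o f i) \+ (EFin \o (fun x => (\sum_(i <- s) f i x)%R)))%E.
    exact: integrableD.
  by apply/funext => x /=; rewrite big_cons EFinD.
rewrite big_cons -sum -RintegralD//.
by apply: eq_Rintegral => x _; rewrite big_cons.
Qed.

Lemma integrable_mul mu (f g : E -> R) (M : R) :
  mu.-integrable setT (EFin \o f) -> measurable_fun setT g ->
  (forall x, `|g x| <= M) -> mu.-integrable setT (EFin \o (fun x => f x * g x)).
Proof.
move=> fi mg gM.
have : mu.-integrable setT ((EFin \o f) \* (EFin \o g))%E.
  apply: integrableMl => //.
  by exists M; split; [exact: num_real|move=> t Mt x _; exact: le_trans (gM x) (ltW Mt)].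
by congr (integrable _ _ _); apply/funext => x /=; rewrite EFinM.
Qed.

Lemma Cc0_integrable mu phi : radon mu -> Cc0 phi ->
  mu.-integrable setT (EFin \o phi).
Proof.
move=> rmu cphi; have [M M0 HM] := Cc0_bounded cphi.
have [cont /compactly_supportedP[N N0 HN]] := cphi.
have mphi := continuous_measurable_rV cont.
have mB : measurable (ball (0 : E) (N + 1)) by exact: measurable_ball_rV.
have : mu.-integrable (ball (0 : E) (N + 1)) (EFin \o phi).
  apply: measurable_bounded_integrable => //.
  - exact: radon_bounded.
  - exact: measurable_funTS.
  - by exists M; split; [exact: num_real|move=> t Mt x _; exact: le_trans (HM x) (ltW Mt)].
move/(integrable_mkcond _ mB).
rewrite (_ : _ \_ _ = EFin \o phi)//; apply/funext => x.
rewrite patchE; case: ifPn => // /negP xB; rewrite /= HN//.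
rewrite ltNge; apply/negP => xN; apply: xB; rewrite inE; apply/ballP.
by rewrite sub0r normrN (le_lt_trans xN)// ltrDl.
Qed.

Lemma partial_sum_test (I : eqType) (s : seq I) (a : I -> R) (psi : I -> E -> R) i x :
  (forall k, k \in s -> testfun (psi k)) ->
  partial i (fun x => \sum_(k <- s) a k * psi k x) x =
  \sum_(k <- s) a k * partial i (psi k) x.
Proof.
elim: s => [|k s IH] ts.
  rewrite big_nil (_ : (fun x => _) = (fun=> 0)); first exact: derive_cst.
  by apply/funext => y; rewrite big_nil.
have tk : testfun (psi k) by apply: ts; exact: mem_head.
have {}ts l : l \in s -> testfun (psi l) by move=> ls; apply: ts; rewrite inE ls orbT.
rewrite big_cons -IH//.
have -> : (fun x => \sum_(k <- k :: s) a k * psi k x) =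
  (a k *: psi k) + (fun x => \sum_(k <- s) a k * psi k x).
  by apply/funext => y; rewrite big_cons.
have dk : differentiable (psi k) x by exact: testfun_diff.
have ds : differentiable (fun x => \sum_(k <- s) a k * psi k x) x.
  by apply: testfun_diff; apply: testfun_sum => l ls; apply: testfun_scale; exact: ts.
rewrite /partial deriveD; [|exact/derivableZ/diff_derivable|exact: diff_derivable].
by rewrite deriveZ//; exact: diff_derivable.
Qed.

Lemma neg_div_integrable mu sigma phi i : L1field mu sigma -> testfun phi ->
  mu.-integrable setT (EFin \o (fun x => sigma x ord0 i * partial i phi x)).
Proof.
move=> L1s tphi; have tp := testfun_partial i tphi.
have [M M0 HM] := Cc0_bounded (testfun_Cc0 tp).
apply: (@integrable_mul mu (fun x => sigma x ord0 i) (partial i phi) M) => //.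
by apply: continuous_measurable_rV; exact: testfun_cont.
Qed.

Lemma neg_divE mu sigma phi : L1field mu sigma -> testfun phi ->
  neg_div mu sigma phi = \sum_(i < d) \int[mu]_x (sigma x ord0 i * partial i phi x).
Proof.
move=> L1s tphi; rewrite /neg_div.
by have [|_ ->//] := @Rintegral_sum mu _ (index_enum 'I_d)
  (fun i x => sigma x ord0 i * partial i phi x) => i _; exact: neg_div_integrable.
Qed.

Lemma neg_div_test_linear mu sigma : L1field mu sigma ->
  test_linear (neg_div mu sigma).
Proof.
move=> L1s I s a psi ts.
rewrite neg_divE//; last first.
  by apply: testfun_sum => k ks; apply: testfun_scale; exact: ts.
under [RHS]eq_big_seq => k ks do rewrite (neg_divE L1s (ts _ ks)) mulr_sumr.
rewrite exchange_big; apply: eq_bigr => i _.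
have ik k : k \in s -> mu.-integrable setT
    (EFin \o (fun x => a k * (sigma x ord0 i * partial i (psi k) x))).
  move=> ks; have := neg_div_integrable i L1s (ts _ ks).
  by move=> /(integrableZl measurableT (a k)); congr (integrable _ _ _).
transitivity (\int[mu]_x (\sum_(k <- s) a k * (sigma x ord0 i * partial i (psi k) x))).
  apply: eq_Rintegral => x _; rewrite partial_sum_test// mulr_sumr.
  by apply: eq_bigr => k _; rewrite mulrCA.
have [_ ->] := @Rintegral_sum mu _ s _ ik.
rewrite !big_seq; apply: eq_bigr => k ks; rewrite RintegralZl//.
exact: neg_div_integrable (ts _ ks).
Qed.

Definition lebesgue_point mu u x := forall dl : R, 0 < dl -> exists2 rho : R, 0 < rho &
    forall r, 0 < r -> r < rho ->
      (\int[mu]_(y in ball x r) `|u y - u x|%:E <= dl%:E * mu (ball x (3 * r)))%E.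

(** Let [x] be a density point of all the sets [A (q, k)] of points where [u] is
    within 1/(k+1) of the rational [q] and that contain [x]. With [q] close to
    [u x], the deviation of [u] from [u x] is small on [A (q, k)], and at most [2 * M] on
    its complement, which has small mass near [x]. *)
Lemma lebesgue_ae mu u (M : R) : radon mu -> measurable_fun setT u ->
  (forall x, `|u x| <= M) -> {ae mu, forall x, lebesgue_point mu u x}.
Proof.
move=> rmu mu_ uM.
pose A (p : rat * nat) : set E := [set x | `|u x - ratr p.1| < p.2.+1%:R^-1].
have mA p : measurable (A p).
  have m1 : measurable_fun setT (fun x => `|u x - ratr p.1|).
    by apply: measurableT_comp => //; apply: measurable_funB.
  have -> : A p = setT `&` (fun x => `|u x - ratr p.1|) @^-1` `]-oo, p.2.+1%:R^-1[%classic.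
    by rewrite setTI; apply/seteqP; split => x; rewrite /= in_itv.
  exact: m1.
have M0 : 0 <= M by apply: le_trans (uM 0).
have := ae_countable (fun p => density_ae rmu (mA p)).
apply: filterS => x Hx dl dl0.
have [k k1] : exists k : nat, k.+1%:R^-1 < dl / 4.
  by apply: ex_invn; rewrite divr_gt0.
have k0 : 0 < k.+1%:R^-1 :> R by rewrite invr_gt0.
have [q] := @rat_in_itvoo R (u x - k.+1%:R^-1) (u x + k.+1%:R^-1)
     ltac:(by rewrite ltrBlDr -addrA ltrDl addr_gt0).
rewrite in_itv/= -ltr_distlC => qx.
have Ax : A (q, k) x by [].
(* half of [dl] is left for the complement of [A (q, k)], where the deviation may reach
   [2 * M] *)
have dl2 : 0 < dl / (4 * (M + 1)) by rewrite divr_gt0// mulr_gt0// ltr_wpDl.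
have [rho rho0 Hrho] := Hx (q, k) Ax _ dl2.
exists rho => // r r0 rr; have {}Hrho := Hrho r r0 rr.
have mB : measurable (ball x r) by exact: measurable_ball_rV.
have mAc : measurable (~` A (q, k)) by exact: measurableC.
apply: (@le_trans _ _ (\int[mu]_(y in ball x r) ((dl / 2)%:E + (2 * M)%:E * (\1_(~` A (q, k)) y)%:E))%E).
  apply: ge0_le_integral => //.
  - apply/measurable_EFinP; apply: measurableT_comp => //.
    by apply: measurable_funTS; apply: measurable_funB.
  - under eq_fun do rewrite -EFinM -EFinD.
    apply/measurable_EFinP; apply: measurable_funD => //.
    by apply: measurable_funM => //; exact: measurable_indic.
  - move=> y _; rewrite -EFinM -EFinD lee_fin indicE.
    have [/set_mem yA|/negP yA] := boolP (y \in ~` A (q, k)).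
      rewrite mulr1; apply: le_trans (ler_normB _ _) _.
      have := uM x; have := uM y; move: dl0; clear; lra.
    have {}yA : A (q, k) y by apply: contrapT => H; apply: yA; exact/mem_set.
    rewrite mulr0 addr0 -(subrKA (ratr q)); apply: le_trans (ler_normD _ _) _.
    move: yA; rewrite /A /= => yA; move: qx; rewrite distrC => qx.
    have -> : dl / 2 = dl / 4 + dl / 4 by field.
    by rewrite lerD// ltW// (lt_trans _ k1).
rewrite ge0_integralD//; last 3 first.
- by move=> y _; rewrite lee_fin divr_ge0// ltW.
- by move=> y _; rewrite -EFinM lee_fin !mulr_ge0.
- under eq_fun do rewrite -EFinM.
  by apply/measurable_EFinP; apply: measurable_funM => //; exact: measurable_indic.
rewrite integral_cst// ge0_integralZl_EFin//; last 2 first.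
- by apply/measurable_EFinP; exact: measurable_indic.
- by rewrite mulr_ge0.
rewrite integral_indic// [~` _ `&` _]setIC -setDE.
have dlE : dl = dl / 2 + dl / 2 by field.
rewrite [X in (_ <= X%:E * _)%E]dlE EFinD ge0_muleDl ?lee_fin ?divr_ge0 ?(ltW dl0)//.
apply: leeD.
  rewrite lee_wpmul2l ?lee_fin ?divr_ge0 ?(ltW dl0)//.
  apply: le_measure; rewrite ?inE//; first exact: measurable_ball_rV.
  by apply: le_ball; rewrite ler_peMl ?(ltW r0)// ler1n.
apply: (@le_trans _ _ ((2 * M)%:E * ((dl / (4 * (M + 1)))%:E * mu (ball x (3 * r))))%E).
  by rewrite lee_wpmul2l// lee_fin mulr_ge0.
rewrite muleA -EFinM lee_wpmul2r ?measure_ge0// lee_fin.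
have M10 : 0 < M + 1 by rewrite ltr_wpDl.
rewrite mulrA ler_pdivrMr ?mulr_gt0//.
have -> : dl / 2 * (4 * (M + 1)) = 2 * M * dl + 2 * dl by field.
by rewrite lerDl mulr_ge0// ltW.
Qed.

End Blowup.

(** * Blow-ups are free of divergence along the field *)

Section Blowup_limit.
Context {R : realType} {d : nat}.
Local Notation E := 'rV[R]_d.
Implicit Types (mu nu : {measure set E -> \bar R}) (u phi psi : E -> R).
Implicit Types (sigma : E -> E).

(** The notion shared by tangent measures and tangent spaces. The limit is recorded as a
    functional, so that it can be the integral against any measure. *)
Definition blowup mu (x0 : E) (Lam : (E -> R) -> R) := exists c r : nat -> R,
  [/\ forall j, 0 < c j, forall j, 0 < r j, r j @[j --> \oo] --> (0 : R) &
    forall phi, Cc0 phi ->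
      (c j * \int[mu]_x phi ((r j)^-1 *: (x - x0))) @[j --> \oo] --> Lam phi].

Lemma rescaleE (a : R) (x x0 : E) : a *: (x - x0) = a *: x + (- (a *: x0)).
Proof. by rewrite scalerDr scalerN. Qed.

Lemma tent_Cc0 (K : R) : 0 < K -> Cc0 (fun x : E => Num.max 0 (1 + K - `|x|)).
Proof.
move=> K0; split.
  move=> x; apply: (@continuous_max _ _ (fun=> 0) (fun x : E => 1 + K - `|x|)).
    exact: cst_continuous.
  by apply: continuousB; [exact: cst_continuous|exact: norm_continuous].
apply/compactly_supportedP; exists (1 + K); first by rewrite addr_gt0.
by move=> x Kx; apply/max_idPl; rewrite subr_le0 ltW.
Qed.

Lemma Cc0_affine phi (a : R) (w : E) : a != 0 -> Cc0 phi ->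
  Cc0 (fun x => phi (a *: x + w)).
Proof.
move=> a0 [cphi /compactly_supportedP[M M0 HM]]; split.
  exact: (@classC_affine _ _ 0 phi a w cphi).
have an : 0 < `|a| by rewrite normr_gt0.
apply/compactly_supportedP; exists ((M + `|w|) / `|a|).
  by rewrite divr_gt0// ltr_pwDl.
move=> x; rewrite ltr_pdivrMr// => Hx; apply: HM.
have := ler_normB (a *: x + w) w; rewrite addrK normrZ.
move: Hx; rewrite [_ * `|a|]mulrC; clear; lra.
Qed.

(** The normalising factors are controlled by testing the convergence on a tent that
    is at least 1 on the ball of radius [K]. *)
Lemma blowup_mass_bounded mu x0 (Lam : (E -> R) -> R) (c r : nat -> R) (K : R) : radon mu -> 0 < K ->
  (forall j, 0 < c j) -> (forall j, 0 < r j) ->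
  (forall phi, Cc0 phi ->
      (c j * \int[mu]_x phi ((r j)^-1 *: (x - x0))) @[j --> \oo] --> Lam phi) ->
  exists2 M : R, 0 < M & \forall j \near \oo, c j * fine (mu (ball x0 (K * r j))) <= M.
Proof.
move=> rmu K0 c0 r0 cvg; pose phi := fun x : E => Num.max 0 (1 + K - `|x|).
have cphi : Cc0 phi by exact: tent_Cc0.
exists (`|Lam phi| + 1); first by rewrite ltr_wpDl.
have : \forall j \near \oo, c j * \int[mu]_x phi ((r j)^-1 *: (x - x0)) < `|Lam phi| + 1.
  have /cvgrPdist_lt/(_ 1 ltr01) := cvg _ cphi.
  apply: filterS => j; set t := c j * _; rewrite ltr_norml => /andP[H _].
  have := ler_norm (Lam phi); move: H; clear; lra.
apply: filterS => j /ltW; apply: le_trans.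
rewrite ler_pM2l//.
have rj : (r j)^-1 != 0 by rewrite invr_eq0 gt_eqF.
have ci : mu.-integrable setT (EFin \o (fun x => phi ((r j)^-1 *: (x - x0)))).
  apply: Cc0_integrable => //; under eq_fun do rewrite rescaleE.
  exact: Cc0_affine.
have mB : measurable (ball x0 (K * r j) : set E) by exact: measurable_ball_rV.
have Bfin : (mu (ball x0 (K * r j)) < +oo)%E by exact: radon_bounded.
rewrite -[leLHS]mul1r -Rintegral_cst// Rintegral_mkcond.
apply: le_Rintegral => //.
  rewrite -[X in _.-integrable _ X]restrict_EFin; apply/(integrable_mkcond _ mB).
  apply: measurable_bounded_integrable => //.
  by exists 1; split; [exact: num_real|move=> t t1 x _ /=; rewrite normr1 ltW].
move=> x _; rewrite patchE; case: ifPn => [/set_mem/ballP xB|_]; last by rewrite le_max lexx.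
rewrite le_max; apply/orP; right.
rewrite normrZ gtr0_norm ?invr_gt0// -addrA lerDl subr_ge0 mulrC ler_pdivrMr//.
by rewrite distrC ltW.
Qed.

Lemma cvg0_lt (r : nat -> R) (e : R) : r j @[j --> \oo] --> (0 : R) ->
  0 < e -> \forall j \near \oo, r j < e.
Proof.
move=> rc e0; have /cvgrPdist_lt/(_ e e0) := rc.
by apply: filterS => j; rewrite sub0r normrN; apply: le_lt_trans; exact: ler_norm.
Qed.

(** The factor [r] compensates for the change of scale in the slope, and [s] normalises
    the slope and the size of [phi]. *)
Lemma adapted_rescale phi (K M L s : R) x0 (r : R) :
  testfun phi -> (forall x, K <= `|x| -> phi x = 0) ->
  (forall x, `|phi x| <= M) -> (forall x y, `|phi x - phi y| <= L * enorm (x - y)) ->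
  0 < s -> s * L <= 2^-1 -> s * M <= K -> 0 < r ->
  adapted x0 (K * r) (fun x => (s * r) * phi (r^-1 *: x + (- (r^-1 *: x0)))).
Proof.
move=> tphi phiK phiM phiL s0 sL sM r0.
have rn : r^-1 != 0 by rewrite invr_eq0 gt_eqF.
split.
- by apply: testfun_scale; exact: testfun_affine.
- move=> y z; rewrite -mulrBr normrM (gtr0_norm (mulr_gt0 s0 r0)).
  apply: (@le_trans _ _ (s * r * (L * (r^-1 * enorm (y - z))))).
    rewrite ler_pM2l ?mulr_gt0//; apply: le_trans (phiL _ _) _.
    by rewrite opprB addrA subrK -scalerBr enormZ gtr0_norm ?invr_gt0.
  rewrite (_ : _ * _ = (s * L) * enorm (y - z)); last by field; rewrite gt_eqF.
  by rewrite mulrC ler_wpM2l// enorm_ge0.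
- move=> y; rewrite normrM (gtr0_norm (mulr_gt0 s0 r0)).
  apply: (@le_trans _ _ (s * r * M)); first by rewrite ler_pM2l// mulr_gt0.
  by rewrite mulrAC ler_pM2r.
- move=> y yB; rewrite phiK ?mulr0// -rescaleE normrZ gtr0_norm ?invr_gt0//.
  rewrite mulrC ler_pdivlMr// leNgt; apply/negP => H; apply: yB; apply/ballP.
  by rewrite distrC.
Qed.

(** Let [psi] be [phi] rescaled to the ball of radius [K * r j] around [x0]. Testing the
    divergence on [psi] gives [s] times the integral of sigma . (grad phi)((x - x0) / r j), which
    is o(mu (ball x0 (3 * (K * r j)))) by [AE_blowup_point]. Freezing [sigma] at [x0]
    costs an error of the same order, because [x0] is a Lebesgue point. The factors
    [c j] keep the mass of the ball of radius [3 * (K * r j)] bounded, so both errors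
    vanish in the limit. *)
Lemma blowup_divergence_free mu sigma x0 Lam phi : radon mu -> L1field mu sigma ->
  AE_blowup_point mu (neg_div mu sigma) x0 ->
  (forall i, lebesgue_point mu (fun x => sigma x ord0 i) x0) ->
  blowup mu x0 Lam -> testfun phi ->
  Lam (fun x => \sum_(i < d) sigma x0 ord0 i * partial i phi x) = 0.
Proof.
move=> rmu L1s AEx Lx [c [r [c0 r0 rc Lc]]] tphi.
set g := fun x => _.
have tg : testfun g.
  by apply: testfun_sum => i _; apply: testfun_scale; exact: testfun_partial.
have cg := Lc g (testfun_Cc0 tg).
have [K K0 phiK] : exists2 K : R, 0 < K & forall x, K <= `|x| -> phi x = 0 /\ forall i, partial i phi x = 0.
  have /compactly_supportedP[K K0 HK] := tphi.2; exists (K + 1); first by rewrite ltr_wpDl// ltW.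
  move=> x Kx; have {}Kx : K < `|x| by apply: lt_le_trans Kx; rewrite ltrDl.
  by split=> [|i]; [exact: HK|exact: partial_out Kx].
have [M M0 phiM] := Cc0_bounded (testfun_Cc0 tphi).
have [L L0 phiL] := testfun_lipschitz tphi.
have /choice[C CP] : forall i, exists C : R, forall x, `|partial i phi x| <= C.
  by move=> i; have [C _ HC] := Cc0_bounded (testfun_Cc0 (testfun_partial i tphi)); exists C.
have C0 i : 0 <= C i by exact: le_trans (CP i 0).
(* [s] makes the slope of [psi] at most 1/2 and its size at most [K * r j] *)
pose s := Num.min (2^-1 / L) (K / M).
have s0 : 0 < s by rewrite /s lt_min !divr_gt0.
have sL : s * L <= 2^-1 by rewrite -ler_pdivlMr// /s ge_min lexx.
have sM : s * M <= K by rewrite -ler_pdivlMr// /s ge_min lexx orbT.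
have K30 : 0 < 3 * K by rewrite mulr_gt0.
have [B B0 HB] := blowup_mass_bounded rmu K30 c0 r0 Lc.
(* [Q] collects the constants of the two errors: 1/s for the divergence tested on
   [psi], the bounds on the partial derivatives for the freezing of [sigma] *)
pose Q := s^-1 + \sum_i C i.
have Q0 : 0 < Q by rewrite ltr_pwDl ?invr_gt0// sumr_ge0.
apply/eqP; rewrite -normr_eq0 eq_le normr_ge0 andbT.
apply/ler_addgt0Pr => e e0; rewrite add0r.
have dl0 : 0 < e / (Q * B) by rewrite divr_gt0// mulr_gt0.
set dl := e / (Q * B) in dl0.
have [rho1 rho10 H1] := AEx dl dl0.
have /choice[rho2 rho2P] : forall i, exists rho, 0 < rho /\ forall r, 0 < r -> r < rho ->
    (\int[mu]_(y in ball x0 r) `|sigma y ord0 i - sigma x0 ord0 i|%:E <=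
      dl%:E * mu (ball x0 (3 * r)))%E.
  by move=> i; have [rho ? ?] := Lx i dl dl0; exists rho.
suff : \forall j \near \oo, `|c j * \int[mu]_x g ((r j)^-1 *: (x - x0))| <= e.
  move=> H; have /cvg_norm cn := cg; rewrite -(cvg_lim _ cn)//.
  by apply: limr_le => //; apply/cvg_ex; eexists; exact: cn.
have N1 : \forall j \near \oo, r j < rho1 / K by apply: cvg0_lt => //; exact: divr_gt0.
have N2 : \forall j \near \oo, forall i, r j < rho2 i / K.
  apply: filter_forall => i; apply: cvg0_lt => //; apply: divr_gt0 => //.
  exact: (rho2P i).1.
near=> j.
have c0j := c0 j; have r0j := r0 j.
have hB : c j * fine (mu (ball x0 (3 * K * r j))) <= B by near: j.
have h1 : r j < rho1 / K by near: j.
have h2 : forall i, r j < rho2 i / K by near: j.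
have rn : (r j)^-1 != 0 by rewrite invr_eq0 gt_eqF.
pose w := - ((r j)^-1 *: x0).
pose psi x := (s * r j) * phi ((r j)^-1 *: x + w).
have apsi : adapted x0 (K * r j) psi.
  by apply: (adapted_rescale (M := M) (L := L)) => // x /phiK[].
have m3 : (mu (ball x0 (3 * (K * r j))) < +oo)%E by exact: radon_bounded.
have fin3 : (mu (ball x0 (3 * (K * r j))) \is a fin_num) by rewrite ge0_fin_numE ?measure_ge0.
have Kr0 : 0 < K * r j by rewrite mulr_gt0.
have Fpsi : `|neg_div mu sigma psi| <= dl * fine (mu (ball x0 (3 * (K * r j)))).
  rewrite -lee_fin EFinM fineK//; apply: H1 => //.
  by rewrite mulrC -ltr_pdivlMr.
have partpsi i x : partial i psi x = s * partial i phi ((r j)^-1 *: x + w).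
  rewrite /psi /partial.
  have -> : (fun x => s * r j * phi ((r j)^-1 *: x + w)) =
     (s * r j) *: (fun x => phi ((r j)^-1 *: x + w)) by [].
  have td : testfun (fun x => phi ((r j)^-1 *: x + w)) by exact: testfun_affine.
  rewrite deriveZ; last by apply: diff_derivable; exact: testfun_diff.
  rewrite derive_affine; last by move=> y; exact: testfun_diff.
  rewrite /GRing.scale /=; field; by rewrite gt_eqF.
pose h i x := partial i phi ((r j)^-1 *: x + w).
have th i : testfun (h i) by apply: testfun_affine => //; exact: testfun_partial.
have ih i : mu.-integrable setT (EFin \o h i) by apply: Cc0_integrable => //; exact: testfun_Cc0.
have mh i : measurable_fun setT (h i) by apply: continuous_measurable_rV; exact: testfun_cont.
have ish i : mu.-integrable setT (EFin \o (fun x => sigma x ord0 i * h i x)).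
  apply: (@integrable_mul R d mu (fun x => sigma x ord0 i) (h i) (C i)) => //.
  by move=> x; exact: CP.
have mB : measurable (ball x0 (K * r j) : set E) by exact: measurable_ball_rV.
have e1 : \int[mu]_x g ((r j)^-1 *: (x - x0)) = \sum_i sigma x0 ord0 i * \int[mu]_x h i x.
  transitivity (\int[mu]_x (\sum_i sigma x0 ord0 i * h i x)).
    by apply: eq_Rintegral => x _; rewrite rescaleE.
  have ii i : mu.-integrable setT (EFin \o (fun x => sigma x0 ord0 i * h i x)).
    by have := integrableZl measurableT (sigma x0 ord0 i) (ih i); congr (integrable _ _ _).
  have [//|_ ->] := @Rintegral_sum R d mu _ (index_enum 'I_d) (fun i x => sigma x0 ord0 i * h i x).
  by apply: eq_bigr => i _; rewrite RintegralZl.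
have e2 : neg_div mu sigma psi = s * \sum_i \int[mu]_x (sigma x ord0 i * h i x).
  rewrite neg_divE//; last by have [] := apsi.
  rewrite mulr_sumr; apply: eq_bigr => i _; rewrite -RintegralZl//.
  by apply: eq_Rintegral => x _; rewrite partpsi mulrCA.
have e3 i : `|\int[mu]_x (sigma x ord0 i * h i x) - sigma x0 ord0 i * \int[mu]_x h i x| <=
    C i * (dl * fine (mu (ball x0 (3 * (K * r j))))).
  rewrite -RintegralZl// -RintegralB//; last first.
    by have := integrableZl measurableT (sigma x0 ord0 i) (ih i); congr (integrable _ _ _).
  rewrite -lee_fin EFin_normr_Rintegral//; last first.
    have i0 : mu.-integrable setT (EFin \o (fun x => sigma x0 ord0 i * h i x)).
      by have := integrableZl measurableT (sigma x0 ord0 i) (ih i); congr (integrable _ _ _).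
    have := integrableB measurableT (ish i) i0; congr (integrable _ _ _).
  apply: le_trans (le_abse_integral _ _ _) _ => //.
    apply/measurable_EFinP; apply: measurable_funB.
      by have /integrableP[/measurable_EFinP] := ish i.
    exact: measurable_funM.
  rewrite EFinM EFinM fineK//.
  have msig : measurable_fun setT (fun x => sigma x ord0 i).
    by have /integrableP[/measurable_EFinP] := L1s i.
  apply: (@le_trans _ _ (\int[mu]_(x in ball x0 (K * r j)) ((C i)%:E * `|sigma x ord0 i - sigma x0 ord0 i|%:E))%E).
    rewrite [leRHS]integral_mkcond; apply: ge0_le_integral => //.
    - apply: measurableT_comp => //; apply/measurable_EFinP; apply: measurable_funB.
        by have /integrableP[/measurable_EFinP] := ish i.
      exact: measurable_funM.
    - apply/(measurable_restrictT _ mB); under eq_fun do rewrite -EFinM.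
      apply/measurable_EFinP; apply: measurable_funTS; apply: measurable_funM => //.
      by apply: measurableT_comp => //; exact: measurable_funB.
    - move=> x _; rewrite patchE -mulrBl; case: ifPn => [xB|/negP xB].
        by rewrite /= -EFinM lee_fin normrM mulrC ler_wpM2r//; exact: CP.
      rewrite /= lee_fin (_ : h i x = 0) ?mulr0 ?normr0// /h /w -rescaleE.
      apply: (phiK _ _).2; rewrite normrZ gtr0_norm ?invr_gt0//.
      rewrite mulrC ler_pdivlMr// leNgt; apply/negP => H; apply: xB; rewrite inE; apply/ballP.
      by rewrite distrC.
  rewrite ge0_integralZl_EFin//; last first.
    apply/measurable_EFinP; apply: measurable_funTS.
    by apply: measurableT_comp => //; exact: measurable_funB.
  rewrite lee_wpmul2l ?lee_fin//; apply: (rho2P i).2 => //.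
  by rewrite mulrC -ltr_pdivlMr.
have sn : s != 0 by rewrite gt_eqF.
have main : `|\int[mu]_x g ((r j)^-1 *: (x - x0))| <= Q * (dl * fine (mu (ball x0 (3 * (K * r j))))).
  rewrite e1.
  have -> : \sum_i sigma x0 ord0 i * \int[mu]_x h i x = s^-1 * neg_div mu sigma psi -
     \sum_i (\int[mu]_x (sigma x ord0 i * h i x) - sigma x0 ord0 i * \int[mu]_x h i x).
    by rewrite e2 mulKf// sumrB opprB addrC subrK.
  apply: le_trans (ler_normB _ _) _; rewrite /Q mulrDl lerD//.
    by rewrite normrM gtr0_norm ?invr_gt0// ler_pM2l// invr_gt0.
  apply: le_trans (ler_norm_sum _ _ _) _; rewrite mulr_suml.
  by apply: ler_sum => i _; exact: e3.
rewrite normrM gtr0_norm//.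
apply: (@le_trans _ _ (c j * (Q * (dl * fine (mu (ball x0 (3 * (K * r j)))))))).
  by rewrite ler_pM2l.
rewrite (_ : c j * _ = (Q * dl) * (c j * fine (mu (ball x0 (3 * K * r j))))); last first.
  rewrite -[3 * K * r j]mulrA.
  by rewrite (mulrA Q) mulrCA.
apply: (@le_trans _ _ (Q * dl * B)); first by rewrite ler_pM2l// mulr_gt0.
rewrite /dl le_eqVlt; apply/orP; left; apply/eqP; field.
by rewrite !gt_eqF.
Unshelve. all: end_near. Qed.

End Blowup_limit.

(** * Smooth functions supported in boxes *)

Section Bump.
Context {R : realType}.
Implicit Types (p : {poly R}) (t s : R).

(** The functions p(1/t) exp(-1/t), extended by 0 to t <= 0, are stable under
    differentiation, which gives the smoothness of exp(-1/t) by induction. *)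
Definition flat p t : R := if 0 < t then p.[t^-1] * expR (- t^-1) else 0.

Lemma exp_pow_bound (n : nat) s : 0 < s -> s ^+ n * expR (- s) <= n%:R ^+ n.
Proof.
move=> s0; case: n => [|n]; first by rewrite !expr0 mul1r -[leRHS]expR0 ler_expR oppr_le0 ltW.
rewrite expRN -ler_pdivlMr ?invr_gt0 ?expR_gt0// invrK.
have n0 : 0 < n.+1%:R :> R by [].
have -> : s = n.+1%:R * (s / n.+1%:R) by field; rewrite gt_eqF.
rewrite expRM_natl exprMn ler_pM2l ?exprn_gt0//.
have s1 : 0 <= s / n.+1%:R by rewrite divr_ge0// ltW.
apply: lerXn2r; rewrite ?nnegrE ?expR_ge0//.
by apply: le_trans (expR_ge1Dx _); rewrite lerDr.
Qed.

Lemma flat_bound p : exists2 C : R, 0 <= C & forall t, `|flat p t| <= C * `|t|.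
Proof.
exists (\sum_(i < size p) `|p`_i| * i.+1%:R ^+ i.+1).
  by apply: sumr_ge0 => i _; rewrite mulr_ge0// exprn_ge0.
move=> t; rewrite /flat; case: ifPn => t0; last first.
  by rewrite normr0 mulr_ge0// sumr_ge0// => i _; rewrite mulr_ge0// exprn_ge0.
have i0 : 0 < t^-1 by rewrite invr_gt0.
rewrite (gtr0_norm t0) -ler_pdivrMr// normrM (gtr0_norm (expR_gt0 _)).
apply: (@le_trans _ _ ((\sum_(i < size p) `|p`_i| * t^-1 ^+ i) * expR (- t^-1) / t)).
  rewrite ler_pM2r// ler_pM2r ?expR_gt0// horner_coef.
  apply: le_trans (ler_norm_sum _ _ _) _; apply: ler_sum => i _.
  by rewrite normrM normrX (gtr0_norm i0).
rewrite !mulr_suml; apply: ler_sum => i _; rewrite -!mulrA ler_wpM2l//.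
apply: le_trans (exp_pow_bound i.+1 i0).
by rewrite exprSr -!mulrA (mulrC (expR _)).
Qed.

(** From (p(1/t) exp(-1/t))' = t^-2 (p(1/t) - p'(1/t)) exp(-1/t). *)
Definition flat' p : {poly R} := 'X^2 * (p - p^`()).

Lemma flat_derive p t : is_derive t 1 (flat p) (flat (flat' p) t).
Proof.
have [t0|t0|->] := ltrgt0P t; last first.
- have fp0 : flat p 0 = 0 by rewrite /flat ltxx.
  have q0 : flat (flat' p) 0 = 0 by rewrite /flat ltxx.
  have [C C0 HC] := flat_bound ('X * p).
  have cv : (fun h : R => h^-1 *: ((flat p \o shift 0) (h *: 1) - flat p 0)) @ 0^' --> (0 : R).
    apply/cvgrPdist_le => e e0; near=> h.
    rewrite sub0r normrN fp0 subr0 /= addr0.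
    have -> : h *: (1 : R) = h by exact: mulr1.
    have -> : h^-1 *: flat p h = flat ('X * p) h.
      rewrite /flat; case: ifPn => h0; last by rewrite scaler0.
      by rewrite /GRing.scale /= hornerM hornerX mulrA.
    apply: le_trans (HC h) _.
    have hC : `|h| < e / (C + 1).
      near: h; apply: dnbhs0_lt; rewrite divr_gt0// ltr_wpDl//.
    apply: (@le_trans _ _ ((C + 1) * (e / (C + 1)))).
      by apply: ler_pM => //; [rewrite lerDl|exact: ltW].
    by rewrite mulrC divfK// gt_eqF// ltr_wpDl.
  rewrite q0; split; first by rewrite /derivable; apply/cvg_ex; exists 0.
  by rewrite /derive; exact: cvg_lim cv.
- have -> : flat (flat' p) t = 0 by rewrite /flat ltNge ltW.
  apply: (@near_eq_is_derive _ _ _ (cst 0)) => //.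
  near=> s; rewrite /flat ltNge ltW//.
  near: s; exact: lt_nbhsl.
- have tn : t != 0 by rewrite gt_eqF.
  apply: (@near_eq_is_derive _ _ _ (fun s => p.[s^-1] * expR (- s^-1))) => //.
    near=> s; rewrite /flat ifT//.
    near: s; exact: lt_nbhsr.
  have d1 : is_derive t 1 (fun s : R => s^-1) (- t ^- 2).
    have H := @is_deriveV _ id t 1 1 tn (is_derive_id t (1 : R)).
    by apply: (is_derive_eq H); rewrite /GRing.scale /= mulr1.
  have d2 : is_derive t 1 (fun s : R => p.[s^-1]) ((- t ^- 2) * p^`().[t^-1]).
    have H := @is_derive1_comp R (horner p) (fun s : R => s^-1) t _ _ (is_derive_poly p t^-1) d1.
    by apply: (is_derive_eq H); rewrite mulrC.
  have d3 : is_derive t 1 (fun s : R => - s^-1) (t ^- 2).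
    by apply: (is_derive_eq (is_deriveN d1)); rewrite opprK.
  have d4 : is_derive t 1 (fun s : R => expR (- s^-1)) (expR (- t^-1) * t ^- 2).
    exact: (@is_derive1_comp R (@expR R) (fun s : R => - s^-1) t _ _ (is_derive_expR _) d3).
  apply: (is_derive_eq (is_deriveM d2 d4)).
  rewrite /flat t0 /flat' !(hornerM, hornerX, hornerXn, hornerD, hornerN) /GRing.scale /= -exprVn.
  ring.
Unshelve. all: end_near. Qed.

Lemma flat1_ge0 t : 0 <= flat 1 t.
Proof. by rewrite /flat; case: ifPn => // _; rewrite hornerC mul1r expR_ge0. Qed.

Lemma flat1_le1 t : flat 1 t <= 1.
Proof.
rewrite /flat; case: ifPn => // t0.
by rewrite hornerC mul1r -expR0 ler_expR oppr_le0 invr_ge0 ltW.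
Qed.

Lemma flat1_out t : t <= 0 -> flat 1 t = 0.
Proof. by move=> t0; rewrite /flat ltNge t0. Qed.

Lemma flat1_cvg t : 0 < t -> flat 1 (n.+1%:R * t) @[n --> \oo] --> (1 : R).
Proof.
move=> t0; rewrite (_ : (fun n => _) = (fun n : nat => expR (- (n.+1%:R^-1 * t^-1)))); last first.
  by apply/funext => n; rewrite /flat mulr_gt0// hornerC mul1r invfM.
rewrite -[X in _ --> X](@expR0 R); apply: continuous_cvg; first exact: continuous_expR.
rewrite -oppr0; apply: cvgN; rewrite -[X in _ --> X](mul0r t^-1).
apply: cvgM; last exact: cvg_cst.
exact: cvg_harmonic.
Qed.

End Bump.

Section SmoothBoxes.
Context {R : realType} {d : nat}.
Local Notation E := 'rV[R]_d.

(** Stated for a class [P] of functions of one variable that is stable under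
    differentiation: the induction on the order then passes to the derivatives. *)
Lemma classC_coord (P : (R -> R) -> Prop) (i : 'I_d) :
  (forall g, P g -> exists2 g', P g' & forall t : R, is_derive t 1 g (g' t)) ->
  forall n g, P g -> classC n (fun x : E => g (x ord0 i)).
Proof.
move=> HP; have diffg g : P g -> forall x : E, differentiable (fun x : E => g (x ord0 i)) x.
  move=> /HP[g' Pg' dg] x.
  apply: (@differentiable_comp _ _ _ _ (fun x : E => x ord0 i) g).
    exact: differentiable_coord.
  by apply/derivable1_diffP; case: (dg (x ord0 i)).
elim=> [|n IH] g Pg.
  by move=> x; exact: (differentiable_continuous (diffg _ Pg x)).
split=> [|j]; first exact: diffg.
have [g' Pg' dg] := HP g Pg.
rewrite (_ : partial j _ = (fun x => (j == i)%:R * g' (x ord0 i))).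
  by apply: classC_mul; [exact: classC_cst|exact: IH].
apply/funext => x; rewrite /partial; have [->|ji] := eqVneq j i.
  rewrite mul1r -[RHS](@derive_val _ _ _ _ _ _ _ (dg (x ord0 i))) /derive.
  have -> : (fun h : R => h^-1 *: (((fun z : E => g (z ord0 i)) \o shift x) (h *: delta_mx ord0 i) - g (x ord0 i))) =
      (fun h : R => h^-1 *: ((g \o shift (x ord0 i)) (h *: 1) - g (x ord0 i))).
    by apply/funext => h /=; rewrite !mxE !eqxx.
  by [].
rewrite mul0r -[RHS](derive_cst (g (x ord0 i)) x (delta_mx ord0 j)) /derive.
have -> : (fun h : R => h^-1 *: (((fun z : E => g (z ord0 i)) \o shift x) (h *: delta_mx ord0 j) - g (x ord0 i))) =
    (fun h : R => h^-1 *: ((cst (g (x ord0 i)) \o shift x) (h *: delta_mx ord0 j) - cst (g (x ord0 i)) x)).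
  by apply/funext => h /=; rewrite !mxE (eq_sym i) (negbTE ji) andbF mulr0 add0r.
by [].
Qed.

Lemma classC_flat (i : 'I_d) n (p : {poly R}) (a b : R) :
  classC n (fun x : E => flat p (a * x ord0 i + b)).
Proof.
pose P (g : R -> R) := exists c p a b, g = (fun t => c * flat p (a * t + b)).
apply: (@classC_coord P i _ n (fun t => flat p (a * t + b))); last first.
  by exists 1, p, a, b; apply/funext => t; rewrite mul1r.
move=> _ [c [{}p [{}a [{}b ->]]]].
exists (fun t => (c * a) * flat (flat' p) (a * t + b)).
  by exists (c * a), (flat' p), a, b.
move=> t.
have d1 : is_derive t 1 (fun s : R => a * s + b) a.
  have H := is_deriveD (is_deriveZ a (is_derive_id t 1)) (is_derive_cst b t 1).
  by apply: (is_derive_eq H); rewrite addr0 /GRing.scale /= mulr1.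
have d2 := @is_derive1_comp R (flat p) (fun s => a * s + b) t _ _ (flat_derive p (a * t + b)) d1.
apply: (is_derive_eq (is_deriveZ c d2)).
by rewrite /GRing.scale /=; ring.
Qed.

Definition box (a b : E) : set E := [set x | forall i, a ord0 i < x ord0 i < b ord0 i].

(** A smooth approximation of the indicator of the box, exact outside of it. *)
Definition box_bump (a b : E) (n : nat) (x : E) : R :=
  \prod_(i < d) (flat 1 (n.+1%:R * (x ord0 i - a ord0 i)) *
                 flat 1 (n.+1%:R * (b ord0 i - x ord0 i))).

Lemma box_bump_out a b n x : ~ box a b x -> box_bump a b n x = 0.
Proof.
move=> /existsNP[i xi]; rewrite /box_bump (bigD1 i)//=.
move: xi => /negP; rewrite negb_and -!leNgt => /orP[xa|bx].
  by rewrite flat1_out ?mul0r// pmulr_rle0// subr_le0.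
by rewrite (@flat1_out _ (_ * (b _ _ - _))) ?mulr0 ?mul0r// pmulr_rle0// subr_le0.
Qed.

Lemma box_bump_ge0 a b n x : 0 <= box_bump a b n x.
Proof. by apply: prodr_ge0 => i _; rewrite mulr_ge0// flat1_ge0. Qed.

Lemma box_bump_le1 a b n x : box_bump a b n x <= 1.
Proof.
apply: prodr_ile1 => i _; rewrite mulr_ge0 ?flat1_ge0//=.
by rewrite -[leRHS]mul1r ler_pM// ?flat1_ge0// flat1_le1.
Qed.

Lemma box_bump_cvg a b x : box a b x -> box_bump a b n x @[n --> \oo] --> (1 : R).
Proof.
move=> xab.
suff H (s : seq 'I_d) : \prod_(i <- s) (flat 1 (n.+1%:R * (x ord0 i - a ord0 i)) *
    flat 1 (n.+1%:R * (b ord0 i - x ord0 i))) @[n --> \oo] --> (1 : R) by exact: H.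
elim: s => [|i s IH]; first by under eq_fun do rewrite big_nil; exact: cvg_cst.
under eq_fun do rewrite big_cons.
have /andP[xa xb] := xab i; rewrite -subr_gt0 in xa; rewrite -subr_gt0 in xb.
by have := cvgM (cvgM (flat1_cvg xa) (flat1_cvg xb)) IH; rewrite !mulr1; exact.
Qed.

Lemma box_bounded a b x : box a b x -> `|x| <= `|a| + `|b|.
Proof.
move=> H; apply: norm_le_coord; first exact: addr_ge0.
move=> i; have /andP[ax xb] := H i.
have := norm_coord a i; have := norm_coord b i.
rewrite !ler_norml => /andP[? ?] /andP[? ?].
have := normr_ge0 a; have := normr_ge0 b => ? ?.
by apply/andP; split; lra.
Qed.

Lemma box_bump_testfun a b n : testfun (box_bump a b n).
Proof.
split.
  move=> k; apply: classC_prod => i; apply: classC_mul.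
    rewrite (_ : (fun x => _) = (fun x : E => flat 1 (n.+1%:R * x ord0 i + (- (n.+1%:R * a ord0 i))))).
      exact: classC_flat.
    by apply/funext => x; rewrite mulrBr.
  rewrite (_ : (fun x => _) = (fun x : E => flat 1 ((- n.+1%:R) * x ord0 i + (n.+1%:R * b ord0 i)))).
    exact: classC_flat.
  by apply/funext => x; rewrite mulrBr addrC mulNr.
apply/compactly_supportedP; exists (`|a| + `|b| + 1); first by rewrite ltr_wpDl// addr_ge0.
move=> x Mx; apply: box_bump_out => /box_bounded.
by move: Mx; clear; lra.
Qed.

Lemma open_box a b : open (box a b).
Proof.
rewrite openE => x xab; suff : nbhs x (box a b) by [].
exists (fun _ i => [set t : R | a ord0 i < t < b ord0 i]).
  move=> k i; rewrite (ord1 k).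
  apply: filterS (near_in_itvoo (xab i : x ord0 i \in `]a ord0 i, b ord0 i[)) => t.
  by rewrite in_itv.
by move=> y H i; exact: H.
Qed.

End SmoothBoxes.

(** * Divergence-free directions are directions of invariance *)

Section Invariance.
Context {R : realType} {d : nat}.
Local Notation E := 'rV[R]_d.
Implicit Types (nu : {measure set E -> \bar R}) (phi : E -> R) (v : E).

Definition dirderiv v phi : E -> R := fun x => \sum_(i < d) v ord0 i * partial i phi x.

Definition divergence_free nu v :=
  forall phi, testfun phi -> \int[nu]_x dirderiv v phi x = 0.

Lemma dirderiv_testfun v phi : testfun phi -> testfun (dirderiv v phi).
Proof.
move=> tphi; apply: testfun_sum => i _; apply: testfun_scale.
exact: testfun_partial.
Qed.

Lemma dirderivE v phi x : testfun phi -> 'D_v phi x = dirderiv v phi x.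
Proof. by move=> tphi; apply: derive_partial; exact: testfun_diff. Qed.

Lemma testfun_shift w phi : testfun phi -> testfun (fun x => phi (x + w)).
Proof.
move=> tphi; have := testfun_affine w (oner_neq0 R) tphi.
by under eq_fun do rewrite scale1r.
Qed.

Lemma dirderiv_shift v w phi x : testfun phi ->
  dirderiv v (fun y => phi (y + w)) x = dirderiv v phi (x + w).
Proof.
move=> tphi; apply: eq_bigr => i _; congr (_ * _).
have := partial_affine i 1 w x (fun z => testfun_diff z tphi).
by rewrite scale1r mul1r; under eq_fun do rewrite scale1r.
Qed.

Lemma taylor_bound v phi : testfun phi -> exists2 C : R, 0 <= C &
  forall x (s : R), `|phi (x + s *: v) - phi x - s * dirderiv v phi x| <= C * s ^+ 2.
Proof.
move=> tphi; have [L L0 HL] := testfun_lipschitz (dirderiv_testfun v tphi).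
exists (L * enorm v); first by rewrite mulr_ge0 ?enorm_ge0// ltW.
move=> x s; have [t /andP[t0 t1] ->] := mean_value x (s *: v) (fun z => testfun_diff z tphi).
have -> : 'D_(s *: v) phi (x + t *: (s *: v)) = s * dirderiv v phi (x + t *: (s *: v)).
  rewrite dirderivE// /dirderiv mulr_sumr; apply: eq_bigr => i _.
  by rewrite mxE mulrA.
rewrite -mulrBr normrM; apply: le_trans (ler_wpM2l (normr_ge0 s) (HL _ _)) _.
rewrite addrAC subrr add0r !enormZ (ger0_norm t0) -real_normK ?num_real//.
have -> : `|s| * (L * (t * (`|s| * enorm v))) = t * (L * enorm v * `|s| ^+ 2) by ring.
by rewrite ler_piMl// !mulr_ge0 ?enorm_ge0// ltW.
Qed.

(** The function g(t), the integral of phi(x + t v), has increments of order s^2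
    over intervals of length s, because the first-order term is the integral of
    a directional derivative. Cutting [0, 1] into n + 1 intervals bounds g(1) - g(0) by
    a multiple of 1/(n + 1). *)
Lemma shift_integral nu v phi : radon nu -> divergence_free nu v -> testfun phi ->
  \int[nu]_x phi (x + v) = \int[nu]_x phi x.
Proof.
move=> rnu dnu tphi.
pose g (t : R) := \int[nu]_x phi (x + t *: v).
have it (t : R) : nu.-integrable setT (EFin \o (fun x => phi (x + t *: v))).
  by apply: Cc0_integrable => //; apply: testfun_Cc0; exact: testfun_shift.
have [C C0 HC] := taylor_bound v tphi.
have [K K0 HK] := (compactly_supportedP phi).1 tphi.2.
have HD x i : K < `|x| -> partial i phi x = 0 by exact: partial_out.
(* the points met below are [x + u *: v] with [0 <= u <= 2] *)
pose K' := K + 2 * `|v|.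
pose B : set E := ball 0 (K' + 1).
have mB : measurable B by exact: measurable_ball_rV.
pose N := fine (nu B).
have Bf : (nu B < +oo)%E by exact: radon_bounded.
have N0 : 0 <= N by rewrite fine_ge0.
have step (t s : R) : 0 <= t <= 1 -> 0 <= s <= 1 -> `|g (t + s) - g t| <= C * s ^+ 2 * N.
  move=> t01 s01.
  pose D x := dirderiv v phi (x + t *: v).
  have tD : testfun D by apply: testfun_shift; exact: dirderiv_testfun.
  have iD : nu.-integrable setT (EFin \o D) by apply: Cc0_integrable => //; exact: testfun_Cc0.
  have isD : nu.-integrable setT (EFin \o (fun x => s * D x)).
    by have := integrableZl measurableT s iD; congr (integrable _ _ _).
  have D0 : \int[nu]_x D x = 0.
    have := dnu _ (testfun_shift (t *: v) tphi).
    by under eq_Rintegral do rewrite dirderiv_shift//.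
  have iB1 : nu.-integrable setT (EFin \o (fun x => phi (x + (t + s) *: v) - phi (x + t *: v))).
    by have := integrableB measurableT (it (t + s)) (it t); congr (integrable _ _ _).
  have -> : g (t + s) - g t = \int[nu]_x (phi (x + (t + s) *: v) - phi (x + t *: v) - s * D x).
    by rewrite RintegralB// RintegralB// RintegralZl// D0 mulr0 subr0.
  have iB2 : nu.-integrable setT (EFin \o (fun x => phi (x + (t + s) *: v) - phi (x + t *: v) - s * D x)).
    by have := integrableB measurableT iB1 isD; congr (integrable _ _ _).
  apply: le_trans (le_normr_Rintegral measurableT iB2) _.
  rewrite -Rintegral_cst// [leRHS]Rintegral_mkcond; apply: le_Rintegral => //.
  - by have := integrable_norm iB2; congr (integrable _ _ _).
  - rewrite -[X in _.-integrable _ X]restrict_EFin; apply/(integrable_mkcond _ mB).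
    apply: measurable_bounded_integrable => //.
    exact: bounded_cst.
  move=> x _; rewrite patchE; case: ifPn => [_|/negP xB].
    by rewrite scalerDl addrA; exact: HC.
  have Kx : K' < `|x|.
    rewrite ltNge; apply/negP => H; apply: xB; rewrite inE; apply/ballP.
    by rewrite sub0r normrN (le_lt_trans H)// ltrDl.
  have far (u : R) : 0 <= u <= 2 -> K < `|x + u *: v|.
    move=> /andP[u0 u2].
    have := ler_normB (x + u *: v) (u *: v); rewrite addrK normrZ (ger0_norm u0).
    have : u * `|v| <= 2 * `|v| by rewrite ler_wpM2r.
    by move: Kx; rewrite /K'; clear; lra.
  have f1 : K < `|x + (t + s) *: v|.
    by apply: far; move: t01 s01; clear => /andP[? ?] /andP[? ?]; apply/andP; split; lra.
  have f2 : K < `|x + t *: v|.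
    by apply: far; move: t01; clear => /andP[? ?]; apply/andP; split; lra.
  rewrite (HK _ f1) (HK _ f2) /D /dirderiv big1 ?mulr0 ?subrr ?normr0//.
  by move=> i _; rewrite HD// mulr0.
have bound (n : nat) : `|g 1 - g 0| <= C * N * n.+1%:R^-1.
  have n0 : 0 < n.+1%:R :> R by [].
  have tele : g 1 - g 0 = \sum_(0 <= k < n.+1) (g (k.+1%:R / n.+1%:R) - g (k%:R / n.+1%:R)).
    by rewrite (telescope_sumr (fun k => g (k%:R / n.+1%:R)))// divff ?gt_eqF// mul0r.
  rewrite tele big_mkord; apply: le_trans (ler_norm_sum _ _ _) _.
  apply: (@le_trans _ _ (\sum_(k < n.+1) C * n.+1%:R^-1 ^+ 2 * N)).
    apply: ler_sum => k _.
    have -> : k.+1%:R / n.+1%:R = k%:R / n.+1%:R + n.+1%:R^-1 :> R.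
      by rewrite -natr1 mulrDl mul1r.
    apply: step.
      by rewrite divr_ge0//= ler_pdivrMr// mul1r ler_nat ltnW.
    by rewrite invr_ge0 ler0n /= invf_le1// ler1n.
  rewrite sumr_const card_ord -mulr_natl.
  by rewrite le_eqVlt; apply/orP; left; apply/eqP; field; rewrite gt_eqF.
have : g 1 - g 0 = 0.
  apply/eqP; rewrite -normr_eq0 eq_le normr_ge0 andbT.
  apply/ler_addgt0Pr => e e0; rewrite add0r.
  have [|n ne] := @ex_invn R (e / (C * N + 1)).
    by rewrite divr_gt0// ltr_wpDl// mulr_ge0.
  apply: le_trans (bound n) _.
  have CN : 0 <= C * N by rewrite mulr_ge0.
  apply: (@le_trans _ _ ((C * N + 1) * n.+1%:R^-1)).
    by rewrite ler_wpM2r// lerDl.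
  by rewrite mulrC -ler_pdivlMr ?ltr_wpDl// ltW.
rewrite /g => /eqP; rewrite subr_eq0 => /eqP.
under eq_Rintegral do rewrite scale1r.
by move=> ->; apply: eq_Rintegral => x _; rewrite scale0r addr0.
Qed.

Lemma measurable_box (a b : E) : measurable (box a b).
Proof. by apply: open_measurable_rV; exact: open_box. Qed.

Lemma measurable_shift v : measurable_fun setT (fun x : E => x + v).
Proof.
apply: measurable_fun_rV => i.
under eq_fun do rewrite mxE.
by apply: measurable_funD => //; exact: measurable_coord.
Qed.

Lemma box_lty nu (a b : E) : radon nu -> (nu (box a b) < +oo)%E.
Proof.
move=> rnu; apply: le_lt_trans (@radon_bounded _ _ nu (`|a| + `|b| + 1) 0 rnu).
apply: le_measure; rewrite ?inE; [exact: measurable_box|exact: measurable_ball_rV|].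
by move=> x /box_bounded H; apply/ballP; rewrite sub0r normrN (le_lt_trans H)// ltrDl.
Qed.

Lemma measurable_bump (a b : E) n : measurable_fun setT (box_bump a b n).
Proof. by apply: continuous_measurable_rV; apply: testfun_cont; exact: box_bump_testfun. Qed.

Lemma bump_integral_cvg nu (a b : E) : radon nu ->
  (\int[nu]_x box_bump a b n x) @[n --> \oo] --> fine (nu (box a b)).
Proof.
move=> rnu; have mb := measurable_box a b.
have ib : nu.-integrable setT (EFin \o \1_(box a b)).
  apply/integrableP; split; first by apply/measurable_EFinP; exact: measurable_indic.
  under eq_integral do rewrite /= ger0_norm//.
  by rewrite integral_indic// setIT box_lty.
have := @dominated_cvg _ _ _ nu setT measurableT (fun n => EFin \o box_bump a b n)
  (EFin \o \1_(box a b)) (EFin \o \1_(box a b)).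
move=> H; have : (\int[nu]_x (box_bump a b n x)%:E)%E @[n --> \oo] --> (\int[nu]_x (\1_(box a b) x)%:E)%E.
  apply: H.
  - by move=> n; apply/measurable_EFinP; exact: measurable_bump.
  - move=> x _; apply: cvg_EFin; first exact: nearW.
    rewrite /= indicE; have [/set_mem xb|/negP xb] := boolP (x \in box a b).
      exact: box_bump_cvg.
    rewrite (_ : _ \o _ = cst 0); first exact: cvg_cst.
    by apply/funext => n; rewrite /= box_bump_out// => xb'; apply: xb; exact/mem_set.
  - by [].
  - exact: ib.
  - move=> n x _; rewrite /= lee_fin indicE ger0_norm ?box_bump_ge0//.
    have [_|/negP xb] := boolP (x \in box a b); first exact: box_bump_le1.
    by rewrite box_bump_out// => xb'; apply: xb; exact/mem_set.
rewrite integral_indic// setIT -[X in _ --> X]fineK ?ge0_fin_numE ?box_lty//.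
by move=> /fine_cvgP[_]; exact.
Qed.

Lemma boxes_generate : @measurable _ E = <<s [set A : set E | exists a b, A = box a b] >>.
Proof.
apply/seteqP; split.
  apply: smallest_sub; first exact: smallest_sigma_algebra.
  move=> U oU.
  pose P (p : 'rV[rat]_d * nat) := `[<ball (map_mx ratr p.1 : 'rV[R]_d) p.2.+1%:R^-1 `<=` U>].
  have -> : U = \bigcup_(p in [set p | P p]) (ball (map_mx ratr p.1 : 'rV[R]_d) p.2.+1%:R^-1).
    apply/seteqP; split => x /=.
      by move=> /(rat_ball oU)[q [n [xq qU]]]; exists (q, n) => //; apply/asboolP.
    by move=> [p /asboolP pU] /pU.
  rewrite bigcup_mkcond.
  apply: (@countable_bigcupT_measurable _ (g_sigma_algebraType [set A : set E | exists a b, A = box a b])) => // p.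
  case: ifPn => // _.
  apply: sub_sigma_algebra.
  exists (map_mx ratr p.1 - const_mx p.2.+1%:R^-1), (map_mx ratr p.1 + const_mx p.2.+1%:R^-1).
  apply/seteqP; split => x.
    move=> /ballP xb i; rewrite !mxE -ltr_distlC.
    by apply: le_lt_trans xb; have := norm_coord (map_mx ratr p.1 - x) i; rewrite !mxE.
  move=> H; apply/ballP; apply: norm_lt_coord; first by rewrite invr_gt0.
  by move=> i; have := H i; rewrite !mxE -ltr_distlC.
apply: smallest_sub; first exact: sigma_algebra_measurable.
by move=> _ [a [b ->]]; exact: measurable_box.
Qed.

Lemma box_shift (a b v : E) : (fun x : E => x + v) @^-1` box a b = box (a - v) (b - v).
Proof.
by apply/seteqP; split => x H i; have := H i; rewrite /= !mxE ltrBlDr ltrBrDr.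
Qed.

Lemma bump_shift (a b v : E) n x : box_bump a b n (x + v) = box_bump (a - v) (b - v) n x.
Proof.
apply: eq_bigr => i _; rewrite !mxE; congr (flat 1 (_ * _) * flat 1 (_ * _)); ring.
Qed.

(** The indicators of boxes are limits of test functions, and boxes form a pi-system
    that generates the Borel sets. *)
Lemma shift_invariant nu v (A : set E) : radon nu -> divergence_free nu v -> measurable A ->
  nu ((fun x : E => x + v) @^-1` A) = nu A.
Proof.
move=> rnu dnu mA.
have msh : measurable_fun setT (fun x : E => x + v) by exact: measurable_shift.
have [m1 m1E] : exists m1 : {measure set E -> \bar R}, forall B, m1 B = nu ((fun x : E => x + v) @^-1` B).
  by eexists (measure_function_pushforward__canonical__measure_function_Measure nu msh).
pose g n : set E := box (const_mx (- n%:R)) (const_mx n%:R).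
have H (B : set E) : (exists a b, B = box a b) -> m1 B = nu B.
  move=> [a [b ->]]; rewrite m1E box_shift.
  have c1 := @bump_integral_cvg nu a b rnu.
  have c2 := @bump_integral_cvg nu (a - v) (b - v) rnu.
  have e n : \int[nu]_x box_bump (a - v) (b - v) n x = \int[nu]_x box_bump a b n x.
    rewrite -(shift_integral rnu dnu (box_bump_testfun a b n)).
    by apply: eq_Rintegral => x _; rewrite bump_shift.
  rewrite (eq_cvg _ _ e) in c2.
  have := cvg_unique _ c1 c2 => ee.
  rewrite -[LHS]fineK ?ge0_fin_numE ?box_lty// -[RHS]fineK ?ge0_fin_numE ?box_lty//.
  by rewrite ee.
have := @measure_unique _ R E [set A : set E | exists a b, A = box a b] g boxes_generate.
move=> U; rewrite -m1E; apply: U => //.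
- move=> _ _ [a [b ->]] [a' [b' ->]].
  exists (\row_i Num.max (a ord0 i) (a' ord0 i)), (\row_i Num.min (b ord0 i) (b' ord0 i)).
  apply/seteqP; split => x.
    move=> [H1 H2] i; have /andP[? ?] := H1 i; have /andP[? ?] := H2 i.
    by rewrite !mxE gt_max lt_min; apply/andP; split; apply/andP; split.
  move=> H1; split => i; have := H1 i; rewrite !mxE gt_max lt_min => /andP[/andP[? ?] /andP[? ?]].
    by apply/andP; split.
  by apply/andP; split.
- by move=> n; exists (const_mx (- n%:R)), (const_mx n%:R).
- rewrite -subTset => x _; exists (Num.truncn `|x|).+1 => // i; rewrite !mxE.
  by rewrite -ltr_norml; apply: le_lt_trans (norm_coord x i) (truncnS_gt _).
- by move=> n; rewrite H; [exact: box_lty|exists (const_mx (- n%:R)), (const_mx n%:R)].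
Qed.

End Invariance.

(** * Hausdorff measure as an outer measure *)

Lemma set0P_or (T : Type) (A : set T) : A = set0 \/ exists x, A x.
Proof. by have [->|/set0P[x Ax]] := eqVneq A set0; [left|right; exists x]. Qed.

Section HausdorffMeasure.
Context {R : realType} {d : nat}.
Local Notation E := 'rV[R]_d.
Implicit Types (A B C X : set E) (m : nat) (dl : R).

Lemma ball_volume_gt0 m : 0 < ball_volume m :> R.
Proof.
suff : 0 < ball_volume m :> R /\ 0 < ball_volume m.+1 :> R by case.
elim: m => [|m [IH1 IH2]]; first by split; rewrite /= ?ltr01.
by split => //=; rewrite mulr_gt0// divr_gt0// mulr_gt0// pi_gt0.
Qed.

Definition gauge_cst m : R := ball_volume m / 2 ^+ m.

Lemma gauge_cst_gt0 m : 0 < gauge_cst m.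
Proof. by rewrite divr_gt0 ?ball_volume_gt0// exprn_gt0. Qed.

Lemma ediam_le A dl : (ediam A <= dl%:E)%E <->
  forall x y, A x -> A y -> enorm (x - y) <= dl.
Proof.
split=> [H x y Ax Ay|H].
  rewrite -lee_fin; apply: le_trans H; apply: ereal_sup_ubound.
  by exists x => //; exists y.
by apply: ge_ereal_sup => _ [x Ax [y Ay <-]]; rewrite lee_fin; exact: H.
Qed.

Lemma ediam_ge0 A x : A x -> (0 <= ediam A)%E.
Proof.
move=> Ax; apply: ereal_sup_ubound; exists x => //; exists x => //.
by rewrite subrr enorm0.
Qed.

Lemma ediam_mono A B : A `<=` B -> (ediam A <= ediam B)%E.
Proof.
move=> AB; apply: ereal_sup_le => _ [x Ax [y Ay <-]].
by exists x; [exact: AB|exists y => //; exact: AB].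
Qed.

Lemma gauge0 m : hausdorff_gauge m (set0 : set E) = 0%E.
Proof. by rewrite /hausdorff_gauge; case: asboolP. Qed.

Lemma gauge_nonempty m A x : A x ->
  hausdorff_gauge m A = ((gauge_cst m)%:E * ediam A ^+ m)%E.
Proof.
move=> Ax; rewrite /hausdorff_gauge; case: asboolP => // A0.
by move: Ax; rewrite A0.
Qed.

Lemma gauge_ge0 m A : (0 <= hausdorff_gauge m A)%E.
Proof.
have [->|[x Ax]] := set0P_or A; first by rewrite gauge0.
rewrite (gauge_nonempty m Ax) mule_ge0 ?lee_fin ?(ltW (gauge_cst_gt0 m))//.
by rewrite expe_ge0// (ediam_ge0 Ax).
Qed.

Lemma lee_expn (x y : \bar R) n : (0 <= x -> x <= y -> x ^+ n <= y ^+ n)%E.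
Proof.
move=> x0 xy; elim: n => [|n IH]; first by rewrite !expe0.
by rewrite !expeS lee_pmul// expe_ge0.
Qed.

Lemma gauge_mono m A B : A `<=` B -> (hausdorff_gauge m A <= hausdorff_gauge m B)%E.
Proof.
move=> AB; have [->|[x Ax]] := set0P_or A; first by rewrite gauge0 gauge_ge0.
rewrite (gauge_nonempty m Ax) (gauge_nonempty m (AB _ Ax)).
rewrite lee_wpmul2l ?lee_fin ?(ltW (gauge_cst_gt0 m))//.
by apply: lee_expn; [exact: ediam_ge0 Ax|exact: ediam_mono].
Qed.

Lemma gauge_le m A (s : R) : 0 <= s -> (forall x y, A x -> A y -> enorm (x - y) <= s) ->
  (hausdorff_gauge m A <= (gauge_cst m * s ^+ m)%:E)%E.
Proof.
move=> s0 H; have [->|[x Ax]] := set0P_or A.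
  by rewrite gauge0 lee_fin mulr_ge0 ?exprn_ge0// ltW// gauge_cst_gt0.
rewrite (gauge_nonempty m Ax) (EFinM (gauge_cst m)) EFin_expe lee_wpmul2l ?lee_fin ?(ltW (gauge_cst_gt0 m))//.
by apply: lee_expn; [exact: ediam_ge0 Ax|exact/ediam_le].
Qed.

Lemma gauge_fin m A dl x : A x -> (ediam A <= dl%:E)%E ->
  exists s : R, [/\ 0 <= s, forall x y, A x -> A y -> enorm (x - y) <= s &
    hausdorff_gauge m A = (gauge_cst m * s ^+ m)%:E].
Proof.
move=> Ax Ad; have D0 := ediam_ge0 Ax.
have Df : ediam A \is a fin_num by rewrite ge0_fin_numE// (le_lt_trans Ad)// ltry.
exists (fine (ediam A)); split; first exact: fine_ge0.
  by apply/ediam_le; rewrite fineK.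
by rewrite (gauge_nonempty m Ax) (EFinM (gauge_cst m)) EFin_expe fineK.
Qed.

(** Giving the value +oo to the sets that are too large turns the constraint on the
    coverings into a set function, of which [hausdorff_delta] is the outer measure. *)
Definition gauge_delta m dl A : \bar R :=
  if (ediam A <= dl%:E)%E then hausdorff_gauge m A else +oo%E.

Lemma gauge_delta_ge0 m dl A : (0 <= gauge_delta m dl A)%E.
Proof. by rewrite /gauge_delta; case: ifPn => // _; exact: gauge_ge0. Qed.

Local Notation T := (g_sigma_algebraType [set: set E]).

Lemma hausdorff_deltaE m dl : hausdorff_delta m dl = @mu_ext _ T R (gauge_delta m dl).
Proof.
apply/funext => A; apply/eqP; rewrite eq_le; apply/andP; split.
  apply: le_ereal_inf_tmp => _ [C [_ AC] <-].
  have [H|/existsNP[i /negP Hi]] := pselect (forall i, (ediam (C i) <= dl%:E)%E).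
    rewrite (eq_eseriesr (g := fun i => hausdorff_gauge m (C i))).
      by apply: ereal_inf_lbound; exists C.
    by move=> i _; rewrite /gauge_delta H.
  rewrite (@eseries_pinfty _ _ xpredT i) ?leey//.
    by move=> n _; rewrite gt_eqF// (lt_le_trans _ (gauge_delta_ge0 _ _ _))// ltNy0.
  by rewrite /gauge_delta (negbTE Hi).
apply: le_ereal_inf_tmp => _ [C [AC Cd] <-].
apply: ereal_inf_lbound; exists C; first by split => // i; apply: sub_sigma_algebra.
by apply: eq_eseriesr => i _; rewrite /gauge_delta Cd.
Qed.

Lemma hausdorff_delta_ge0 m dl A : (0 <= hausdorff_delta m dl A)%E.
Proof. by rewrite hausdorff_deltaE; apply: mu_ext_ge0; exact: gauge_delta_ge0. Qed.

Lemma hausdorff_delta_mono m dl A B : A `<=` B ->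
  (hausdorff_delta m dl A <= hausdorff_delta m dl B)%E.
Proof. by rewrite hausdorff_deltaE; exact: (@le_mu_ext _ T R (gauge_delta m dl)). Qed.

Lemma hausdorff_delta0 m dl : hausdorff_delta m dl (set0 : set E) = 0%E.
Proof.
rewrite hausdorff_deltaE; apply: mu_ext0; last exact: gauge_delta_ge0.
rewrite /gauge_delta gauge0 ifT//; apply/ediam_le => x y [].
Qed.

Lemma hausdorff_delta_subadd m dl : sigma_subadditive (hausdorff_delta m dl : set E -> _).
Proof.
by rewrite hausdorff_deltaE; apply: (@mu_ext_sigma_subadditive _ T R (gauge_delta m dl)); exact: gauge_delta_ge0.
Qed.

Lemma hausdorff_delta_anti m (d1 d2 : R) A : d1 <= d2 ->
  (hausdorff_delta m d2 A <= hausdorff_delta m d1 A)%E.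
Proof.
move=> d12; apply: ereal_inf_le_tmp => _ [C [AC Cd] <-]; exists C => //.
by split => // i; apply: le_trans (Cd i) _; rewrite lee_fin.
Qed.

Lemma hausdorff_delta_le m dl A : 0 < dl -> (hausdorff_delta m dl A <= hausdorff m A)%E.
Proof. by move=> dl0; apply: ereal_sup_ubound; exists dl. Qed.

Lemma hausdorff_le m A (c : \bar R) :
  (forall dl, 0 < dl -> (hausdorff_delta m dl A <= c)%E) -> (hausdorff m A <= c)%E.
Proof. by move=> H; apply: ge_ereal_sup => _ [dl /= dl0 <-]; exact: H. Qed.

Lemma hausdorff0 m : hausdorff m (set0 : set E) = 0%E.
Proof.
apply/eqP; rewrite eq_le; apply/andP; split.
  by apply: hausdorff_le => dl _; rewrite hausdorff_delta0.
by apply: le_trans (hausdorff_delta_le m _ ltr01); exact: hausdorff_delta_ge0.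
Qed.

Lemma hausdorff_ge0 m A : (0 <= hausdorff m A)%E.
Proof. exact: le_trans (hausdorff_delta_ge0 m 1 A) (hausdorff_delta_le m _ ltr01). Qed.

Lemma hausdorff_mono m : {homo (hausdorff m : set E -> \bar R) : A B / A `<=` B >-> (A <= B)%E}.
Proof.
move=> A B AB; apply: hausdorff_le => dl dl0.
exact: le_trans (hausdorff_delta_mono m dl AB) (hausdorff_delta_le m _ dl0).
Qed.

Lemma hausdorff_subadd m : sigma_subadditive (hausdorff m : set E -> \bar R).
Proof.
move=> A; apply: hausdorff_le => dl dl0.
apply: le_trans (hausdorff_delta_subadd m dl A) _.
by apply: lee_nneseries => [n _ _|n _]; [exact: hausdorff_delta_ge0|exact: hausdorff_delta_le].
Qed.

HB.instance Definition _ m := isOuterMeasure.Build R E (hausdorff m : set E -> \bar R)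
  (hausdorff0 m) (hausdorff_ge0 m) (@hausdorff_mono m) (@hausdorff_subadd m).

(** A set of diameter less than [eta] meets at most one of [A] and [B], so a fine
    covering of the union splits into coverings of the two parts. *)
Lemma hausdorff_separated m A B (eta : R) : 0 < eta ->
  (forall x y, A x -> B y -> eta <= enorm (x - y)) ->
  (hausdorff m A + hausdorff m B <= hausdorff m (A `|` B))%E.
Proof.
move=> eta0 AB.
have key dl : 0 < dl -> dl < eta ->
    (hausdorff_delta m dl A + hausdorff_delta m dl B <= hausdorff m (A `|` B))%E.
  move=> dl0 dle; apply: le_trans (hausdorff_delta_le m _ dl0).
  apply: le_ereal_inf_tmp => _ [C [ABC Cd] <-].
  have cov D : D `<=` A `|` B -> (hausdorff_delta m dl D <= \sum_(0 <= i <oo) hausdorff_gauge m (C i `&` D))%E.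
    move=> DAB; apply: ereal_inf_lbound; exists (fun i => C i `&` D) => //.
    split=> [x Dx|i]; first by have [i _ Ci] := ABC x (DAB x Dx); exists i.
    exact: le_trans (ediam_mono (@subIsetl _ (C i) D)) (Cd i).
  apply: le_trans (leeD (cov A _) (cov B _)) _; [exact: subsetUl|exact: subsetUr|].
  rewrite -nneseriesD//; last 2 first.
  - by move=> i _ _; exact: gauge_ge0.
  - by move=> i _ _; exact: gauge_ge0.
  apply: lee_nneseries => i _.
    by move=> _; rewrite adde_ge0// gauge_ge0.
  have [CA|[x [Cx Ax]]] := set0P_or (C i `&` A).
    by rewrite CA gauge0 add0e; apply: gauge_mono; exact: subIsetl.
  have [CB|[y [Cy By]]] := set0P_or (C i `&` B).
    by rewrite CB gauge0 adde0; apply: gauge_mono; exact: subIsetl.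
  exfalso; have /ediam_le/(_ x y Cx Cy) := Cd i.
  by rewrite leNgt (lt_le_trans dle)// AB.
have H1 dl : 0 < dl -> dl < eta -> (hausdorff_delta m dl A + hausdorff m B <= hausdorff m (A `|` B))%E.
  move=> dl0 dle.
  have [->|Bf] := eqVneq (hausdorff m (A `|` B)) +oo%E; first by rewrite leey.
  have Af : (hausdorff_delta m dl A \is a fin_num).
    rewrite ge0_fin_numE ?hausdorff_delta_ge0//.
    apply: le_lt_trans (_ : hausdorff m (A `|` B) < +oo)%E; last by rewrite ltey.
    apply: le_trans (hausdorff_delta_le m _ dl0) _; apply: hausdorff_mono; exact: subsetUl.
  rewrite addeC -leeBrDr//; apply: hausdorff_le => e e0; rewrite leeBrDr// addeC.
  have mn0 : 0 < Num.min e dl by rewrite lt_min e0.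
  apply: le_trans (key _ mn0 _); last by rewrite gt_min dle orbT.
  by apply: leeD; apply: hausdorff_delta_anti; rewrite ge_min lexx ?orbT.
have [->|Bf] := eqVneq (hausdorff m (A `|` B)) +oo%E; first by rewrite leey.
have Bfin : (hausdorff m B \is a fin_num).
  rewrite ge0_fin_numE ?hausdorff_ge0//.
  apply: le_lt_trans (_ : hausdorff m (A `|` B) < +oo)%E; last by rewrite ltey.
  by apply: hausdorff_mono; exact: subsetUr.
rewrite -leeBrDr//; apply: hausdorff_le => e e0; rewrite leeBrDr//.
have e20 : 0 < eta / 2 by rewrite divr_gt0.
have mn0 : 0 < Num.min e (eta / 2) by rewrite lt_min e0.
apply: le_trans (H1 _ mn0 _).
  by apply: leeD => //; apply: hausdorff_delta_anti; rewrite ge_min lexx.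
by rewrite gt_min ltr_pdivrMr// ltr_pMr// ltr1n orbT.
Qed.

End HausdorffMeasure.

(** * Hausdorff measure on Borel sets *)

Section HausdorffBorel.
Context {R : realType} {d : nat}.
Local Notation E := 'rV[R]_d.
Implicit Types (A B C X : set E) (m : nat).
Local Open Scope ereal_scope.

Section layers.
Variables (m : nat) (f : E -> R) (X : set E).
Hypothesis f_lip : forall x y, (f x - f y <= enorm (x - y))%R.
Hypothesis Xfin : hausdorff m X < +oo.

Let u (k : nat) : R := k.+1%:R^-1.

Let u_gt0 k : (0 < u k)%R. Proof. by rewrite invr_gt0. Qed.

Let u_lt j k : (j < k)%N -> (u k < u j)%R.
Proof. by move=> jk; rewrite ltf_pV2 ?posrE// ltr_nat. Qed.

Let u_le j k : (j <= k)%N -> (u k <= u j)%R.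
Proof. by move=> jk; rewrite lef_pV2 ?posrE// ler_nat. Qed.

Let layer k : set E := X `&` [set x | (u k.+1 <= f x < u k)%R].

Let parity_layer b k : set E := if odd k == b then layer k else set0.

Let parity_sum b n :
  \sum_(k < n) hausdorff m (parity_layer b k) <=
  hausdorff m (\bigcup_(k in [set k | (k < n)%N]) parity_layer b k).
Proof.
elim: n => [|n IH]; first by rewrite big_ord0 hausdorff_ge0.
rewrite big_ord_recr /=.
have [nb|nb] := eqVneq (odd n) b; last first.
  rewrite {2}/parity_layer (negbTE nb) hausdorff0 adde0; apply: le_trans IH _.
  apply: hausdorff_mono => x [k /= kn kx]; exists k => //=; exact: ltnW.
case: n nb IH => [|n] nb IH.
  rewrite big_ord0 add0e; apply: hausdorff_mono => x x0; by exists 0%N.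
have u0 : (0 < u n - u n.+1)%R by rewrite subr_gt0 u_lt.
apply: le_trans (leeD2r _ IH) _.
apply: le_trans (hausdorff_separated m u0 _) _; last first.
  apply: hausdorff_mono => x [[k /= kn kx]|nx]; first by exists k => //=; exact: ltnW.
  by exists n.+1 => /=.
move=> x y [k /= kn].
rewrite {1}/parity_layer; case: ifPn => // /eqP kb [_ /= /andP[kx _]].
rewrite /parity_layer nb eqxx => -[_ /= /andP[_ yn]].
have kn' : (k < n)%N.
  rewrite ltn_neqAle -ltnS kn andbT; apply/eqP => kn'.
  by move: nb; rewrite -kb kn' /=; case: (odd n).
apply: le_trans (f_lip x y); apply: lerB; last exact: ltW.
by apply: le_trans kx; exact: u_le.
Qed.

Let layer_sum n : \sum_(k < n) hausdorff m (layer k) <= hausdorff m X + hausdorff m X.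
Proof.
have -> : \sum_(k < n) hausdorff m (layer k) =
   \sum_(k < n) hausdorff m (parity_layer true k) + \sum_(k < n) hausdorff m (parity_layer false k).
  rewrite -big_split; apply: eq_bigr => k _ /=; rewrite /parity_layer.
  by case: (odd k); rewrite /= hausdorff0 ?adde0 ?add0e.
have H b : \sum_(k < n) hausdorff m (parity_layer b k) <= hausdorff m X.
  apply: le_trans (parity_sum b n) _; apply: hausdorff_mono => x [k _].
  by rewrite /parity_layer; case: ifPn => // _ [].
by apply: leeD; exact: H.
Qed.

(** Caratheodory's argument. The set where [f <= 0] is at positive distance from
    the set [P n] where [f] is at least [u n], so the claim holds with [P n] in place
    of the set where [f > 0]. What is missed is covered by layers; those of equal
    parity are at positive distance from one another, so the masses of the layers are
    summable and the missing part is negligible for large [n]. *)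
Lemma hausdorff_split :
  hausdorff m (X `&` [set x | (f x <= 0)%R]) + hausdorff m (X `&` ~` [set x | (f x <= 0)%R]) <=
  hausdorff m X.
Proof.
pose P n : set E := X `&` [set x | (u n <= f x)%R].
have HP n : hausdorff m (X `&` [set x | (f x <= 0)%R]) + hausdorff m (P n) <= hausdorff m X.
  rewrite addeC; apply: le_trans (hausdorff_separated m (u_gt0 n) _) _.
    move=> x y [_ /= ux] [_ /= y0]; apply: le_trans (f_lip x y).
    by rewrite (le_trans ux)// lerBrDr gerDl.
  by apply: hausdorff_mono => x [[]|[]].
have sum_lty : \sum_(k <oo) hausdorff m (layer k) < +oo.
  apply: (@le_lt_trans _ _ (hausdorff m X + hausdorff m X)); last by rewrite lte_add_pinfty.
  apply: lime_le; first by apply: is_cvg_nneseries => n _ _; exact: hausdorff_ge0.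
  by apply: nearW => n; rewrite big_mkord; exact: layer_sum.
have tail := nneseries_tail_cvg sum_lty (fun k _ => hausdorff_ge0 m (layer k)).
have Xf : hausdorff m X \is a fin_num by rewrite ge0_fin_numE ?hausdorff_ge0.
apply/lee_addgt0Pr => e e0.
have [n ne] : exists n, \sum_(n <= k <oo) hausdorff m (layer k) <= e%:E.
  have /fine_cvgP[tf /cvgrPdist_le/(_ e e0)] := tail.
  move=> te; have [N _ HN] : \forall n \near \oo, \sum_(n <= k <oo) hausdorff m (layer k) <= e%:E.
    near=> n.
    have fn : \sum_(n <= k <oo) hausdorff m (layer k) \is a fin_num by near: n.
    rewrite -(fineK fn) lee_fin; apply: le_trans (ler_norm _) _.
    by rewrite -normrN -sub0r; near: n.
  by exists N; apply: HN => /=.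
have Hn := HP n.
apply: le_trans (_ : hausdorff m (X `&` [set x | (f x <= 0)%R]) + (hausdorff m (P n) + e%:E) <= _); last first.
  by rewrite addeA leeD2r.
apply: leeD2l.
have sub : X `&` ~` [set x | (f x <= 0)%R] `<=` P n `|` \bigcup_(k in ~` `I_n) layer k.
  move=> x [Xx /= /negP]; rewrite -ltNge => fx.
  have [un|un] := leP (u n) (f x); first by left.
  right.
  have [N HN] := ex_invn fx.
  have : exists k, (u k <= f x)%R by exists N; rewrite ltW.
  move=> exk; case: (ex_minnP exk) => k uk kmin.
  have nk : (n < k)%N.
    rewrite ltnNge; apply/negP => kn; move: un.
    by rewrite ltNge (le_trans (u_le kn) uk).
  case: k uk kmin nk => // k uk kmin nk.
  exists k => //=; first by apply/negP; rewrite -leqNgt -ltnS.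
  split => //=; rewrite uk /= ltNge; apply/negP => uk'.
  by have := kmin _ uk'; rewrite ltnn.
apply: le_trans (hausdorff_mono m sub) _.
apply: le_trans (outer_measureU2 _ _ _) _.
apply: leeD2l; apply: le_trans ne.
exact: outer_measure_sigma_subadditive_tail.
Unshelve. all: end_near. Qed.

End layers.

Lemma caratheodory_sublevel m (f : E -> R) :
  (forall x y, (f x - f y <= enorm (x - y))%R) ->
  (hausdorff m : set E -> \bar R).-caratheodory [set x | (f x <= 0)%R].
Proof.
move=> fl; apply: le_caratheodory_measurable => X.
have [Xe|Xf] := eqVneq (hausdorff m X) +oo.
  by apply: (@le_trans _ _ +oo); [exact: leey|rewrite -Xe].
by apply: hausdorff_split => //; rewrite ltey.
Qed.

(** Boxes are finite intersections of sublevel sets of 1-Lipschitz functions. *)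
Lemma caratheodory_borel m A : measurable A -> (hausdorff m : set E -> \bar R).-caratheodory A.
Proof.
have -> : @measurable _ E = <<s [set A : set E | exists a b, A = box a b] >>.
  exact: boxes_generate.
apply: smallest_sub.
  split; [exact: caratheodory_measurable_set0| |exact: caratheodory_measurable_bigcup].
  by move=> B mB; rewrite setTD; exact: caratheodory_measurable_setC.
move=> _ [a [b ->]].
have Hlt (i : 'I_d) (c : R) : (hausdorff m : set E -> \bar R).-caratheodory [set x : E | (c < x ord0 i)%R].
  rewrite (_ : [set x : E | (c < x ord0 i)%R] = ~` [set x : E | (x ord0 i - c <= 0)%R]).
    apply: caratheodory_measurable_setC; apply: caratheodory_sublevel => x y.
    by rewrite opprB addrA subrK; exact: coord_le_enorm.
  by apply/seteqP; split => x /=; rewrite subr_le0 ltNge => /negP.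
have Hgt (i : 'I_d) (c : R) : (hausdorff m : set E -> \bar R).-caratheodory [set x : E | (x ord0 i < c)%R].
  rewrite (_ : [set x : E | (x ord0 i < c)%R] = ~` [set x : E | (c - x ord0 i <= 0)%R]).
    apply: caratheodory_measurable_setC; apply: caratheodory_sublevel => x y.
    have -> : (c - x ord0 i - (c - y ord0 i) = y ord0 i - x ord0 i)%R by ring.
    by rewrite -(enormN (x - y)) opprB; exact: coord_le_enorm.
  by apply/seteqP; split => x /=; rewrite subr_le0 ltNge => /negP.
have -> : box a b = \big[setI/setT]_(i <- index_enum 'I_d)
    ([set x : E | (a ord0 i < x ord0 i)%R] `&` [set x : E | (x ord0 i < b ord0 i)%R]).
  apply/seteqP; split => x.
    by move=> xab; elim/big_ind : _ => // i _; have /andP[] := xab i.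
  rewrite -bigcap_seq => H i.
  by have [/= ? ?] := H i (mem_index_enum i); apply/andP.
elim/big_ind : _ => //.
- rewrite -setC0; apply: caratheodory_measurable_setC; exact: caratheodory_measurable_set0.
- move=> ? ? ? ?; exact: caratheodory_measurable_setI.
- move=> i _; exact: caratheodory_measurable_setI.
Qed.

Lemma hausdorff_sigma_additive m : semi_sigma_additive (hausdorff m : set E -> \bar R).
Proof.
move=> A mA tA mU.
apply: (@caratheodory_measure_sigma_additive R E (hausdorff m : {outer_measure set E -> \bar R})) => //.
- by move=> i; exact: caratheodory_borel.
- exact: caratheodory_borel.
Qed.

HB.instance Definition _ m := isMeasure.Build _ E R (hausdorff m : set E -> \bar R)
  (hausdorff0 m) (hausdorff_ge0 m) (@hausdorff_sigma_additive m).

Lemma hausdorff_shift_le m A (w : E) :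
  hausdorff m ((fun x : E => (x + w)%R) @^-1` A) <= hausdorff m A.
Proof.
apply: hausdorff_le => dl dl0; apply: le_trans (hausdorff_delta_le m _ dl0).
apply: le_ereal_inf_tmp => _ [C [AC Cd] <-].
have e i : ediam ((fun x : E => (x + w)%R) @^-1` C i) = ediam (C i).
  congr ereal_sup; apply/seteqP; split => _ [x Cx [y Cy <-]].
    exists (x + w)%R => //; exists (y + w)%R => //.
    by rewrite opprD addrACA subrr addr0.
  exists (x - w)%R; first by rewrite /= subrK.
  exists (y - w)%R; first by rewrite /= subrK.
  by rewrite opprB addrA subrK.
apply: ereal_inf_lbound; exists (fun i => (fun x : E => (x + w)%R) @^-1` C i).
  split=> [x Ax|i]; last by rewrite e.
  by have [i _ Ci] := AC _ Ax; exists i.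
apply: eq_eseriesr => i _.
have [C0|[x Cx]] := set0P_or (C i); first by rewrite C0 preimage_set0.
rewrite (gauge_nonempty m Cx) -e.
by rewrite (@gauge_nonempty _ _ m _ (x - w)%R)//= subrK.
Qed.

Lemma hausdorff_shift m A (w : E) :
  hausdorff m ((fun x : E => (x + w)%R) @^-1` A) = hausdorff m A.
Proof.
apply/eqP; rewrite eq_le hausdorff_shift_le /=.
apply: le_trans (hausdorff_shift_le m ((fun x : E => (x + w)%R) @^-1` A) (- w)).
by apply: hausdorff_mono => x Ax; rewrite /= subrK.
Qed.

End HausdorffBorel.

(** * Hausdorff measure of balls in a subspace *)

Section SubspaceMass.
Context {R : realType} {d : nat}.
Local Notation E := 'rV[R]_d.
Implicit Types (V : {vspace E}).

(** The volume bound for coverings of the unit cube by cubes, by induction on the dimension: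
    the cubes that meet a hyperplane at height [s] cover a cube of dimension
    [k], and integrating over [s] multiplies each term by the missing side. *)
Lemma cube_cover (k : nat) (y : nat -> nat -> R) (w : nat -> R) (P : pred nat) :
  (forall i, 0 <= w i) ->
  (forall t : nat -> R, (forall l, (l < k)%N -> 0 <= t l <= 1) ->
     exists2 i, P i & forall l, (l < k)%N -> `|t l - y i l| <= w i) ->
  (1%:E <= \sum_(0 <= i <oo | P i) ((2 * w i) ^+ k)%:E)%E.
Proof.
move=> w0; elim: k P => [|k IH] P cov.
  have [i Pi _] := cov (fun=> 0) ltac:(by []).
  rewrite eseries_mkcond.
  apply: (@le_trans _ _ (\sum_(0 <= j < i.+1) (if P j then ((2 * w j) ^+ 0)%:E else 0))%E).
    rewrite big_nat_recr//= Pi expr0 leeDr//.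
    by apply: sume_ge0 => j _; case: ifPn => // _; rewrite lee_fin.
  apply: nneseries_lim_ge => j _ _; by case: ifPn.
pose mu := @lebesgue_measure R.
pose itv : set R := `[0, 1]%classic.
pose J i : set R := `[y i k - w i, y i k + w i]%classic.
have mJ i : measurable (J i) by exact: measurable_itv.
pose F i (s : R) : \bar R := if P i then (((2 * w i) ^+ k) * \1_(J i) s)%:E else 0%E.
have F0 i s : (0 <= F i s)%E.
  by rewrite /F; case: ifPn => // _; rewrite lee_fin mulr_ge0// exprn_ge0// mulr_ge0.
have mF i : measurable_fun itv (F i).
  rewrite /F; case: (P i); last exact: measurable_cst.
  by apply/measurable_EFinP; apply: measurable_funM.
have step s : itv s -> (1%:E <= \sum_(0 <= i <oo) F i s)%E.
  rewrite /itv /= in_itv /= => s01.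
  have := IH [pred i | P i & `|s - y i k| <= w i] _.
  rewrite eseries_mkcond.
  rewrite (eq_eseriesr (g := fun i => F i s)); last first.
    move=> i _; rewrite /F /=; case: (P i) => //=.
    rewrite indicE /J mem_setE in_itv /= -ler_distlC distrC.
    by case: ifPn; rewrite ?mulr1 ?mulr0.
  apply => t t01.
  have [|i Pi H] := cov (fun l => if l == k then s else t l).
    by move=> l; rewrite ltnS leq_eqVlt; case: eqVneq => [_ //|_ /= /t01].
  exists i; last first.
    by move=> l lk; have := H l (leqW lk); rewrite (ltn_eqF lk).
  by rewrite /= Pi /=; have := H k (ltnSn k); rewrite eqxx.
have : (\int[mu]_(s in itv) 1%:E <= \int[mu]_(s in itv) \sum_(0 <= i <oo) F i s)%E.
  apply: ge0_le_integral => //.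
    exact: measurable_itv.
  by apply: ge0_emeasurable_sum => // i _; exact: mF.
have mitv : measurable itv by exact: measurable_itv.
have -> : (\int[mu]_(s in itv) 1 = 1)%E.
  have muitv : mu itv = 1%E.
    by rewrite /mu /itv lebesgue_measure_itv/= lte_fin ltr01 oppr0 adde0.
  by rewrite (integral_cst mu mitv) mul1e.
move=> /le_trans; apply.
rewrite integral_nneseries//.
rewrite [leRHS]eseries_mkcond; apply: lee_nneseries => i _.
  by move=> _; apply: integral_ge0.
rewrite /F; case: (P i); last by rewrite integral0.
under eq_integral do rewrite EFinM.
rewrite ge0_integralZl_EFin//; last 2 first.
- have mI : measurable_fun itv (\1_(J i) : R -> R) by apply: measurable_indic.
  exact: (measurableT_comp _ mI).
- by rewrite exprn_ge0// mulr_ge0.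
have -> : (\int[lebesgue_measure]_(x in itv) (\1_(J i) x)%:E = mu (J i `&` itv))%E.
  exact: (@integral_indic _ (measurableTypeR R) R lebesgue_measure itv mitv (J i) (mJ i)).
rewrite (exprSr (2 * w i)) EFinM lee_wpmul2l ?lee_fin ?exprn_ge0 ?mulr_ge0//.
apply: (@le_trans _ _ (mu (J i))).
  have mJI : measurable (J i `&` itv) := measurableI _ _ (mJ i) mitv.
  exact: (@le_measure _ _ _ (@lebesgue_measure R) _ _ (mem_set mJI) (mem_set (mJ i)) (@subIsetl _ _ _)).
rewrite /mu lebesgue_measure_itv /= lte_fin.
case: ifPn => // _; last by rewrite lee_fin mulr_ge0.
by rewrite -EFinD lee_fin le_eqVlt; apply/orP; left; apply/eqP; ring.
Qed.

Section basis.
Variable V : {vspace E}.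
Local Notation k := (\dim V).
Let b : k.-tuple E := vbasis V.

Definition vcoord (i : 'I_k) (x : E) : R := coord b i x.

Lemma vcoord_bound : exists2 C : R, 0 < C & forall i x, `|vcoord i x| <= C * enorm x.
Proof.
exists (\sum_i \sum_(j < d) `|vcoord i (delta_mx ord0 j)| + 1).
  by rewrite ltr_wpDl// sumr_ge0// => i _; rewrite sumr_ge0.
move=> i x; rewrite mulrDl mul1r ler_wpDr ?enorm_ge0//.
apply: (@le_trans _ _ ((\sum_(j < d) `|vcoord i (delta_mx ord0 j)|) * enorm x)).
  rewrite {1}(row_sum_delta x) /vcoord linear_sum mulr_suml.
  apply: le_trans (ler_norm_sum _ _ _) _; apply: ler_sum => j _.
  rewrite linearZ normrM mulrC ler_wpM2l//.
  exact: le_trans (norm_coord _ _) (norm_le_enorm _).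
rewrite ler_wpM2r ?enorm_ge0// (bigD1 i)//= lerDl sumr_ge0// => j _.
by rewrite sumr_ge0.
Qed.

Lemma vcoordK x : x \in V -> x = \sum_i vcoord i x *: b`_i.
Proof. exact: coord_vbasis. Qed.

Definition vpoint (t : nat -> R) : E := \sum_(i < k) t i *: b`_i.

Lemma vpoint_in t : vpoint t \in V.
Proof.
apply: memv_suml => i _; apply: memvZ; apply: vbasis_mem.
by apply: mem_nth; rewrite size_tuple.
Qed.

Lemma vcoord_point t (i : 'I_k) : vcoord i (vpoint t) = t i.
Proof.
rewrite /vcoord /vpoint; apply: coord_sum_free.
exact: basis_free (vbasisP V).
Qed.

(** A radius for which the ball contains all the points with coordinates in [0, 1]. *)
Definition bmass : R := \sum_(i < k) enorm b`_i.

Lemma bmass_ge0 : 0 <= bmass. Proof. by apply: sumr_ge0 => i _; exact: enorm_ge0. Qed.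

Lemma enorm_vpoint t (M : R) : (forall i, (i < k)%N -> `|t i| <= M) ->
  enorm (vpoint t) <= M * bmass.
Proof.
move=> H; rewrite /vpoint /bmass mulr_sumr.
apply: (@le_trans _ _ (\sum_(i < k) enorm (t i *: b`_i))).
  elim/big_ind2 : _ => [|x1 y1 x2 y2 H1 H2|//]; first by rewrite enorm0.
  by apply: le_trans (enormD _ _) _; rewrite lerD.
by apply: ler_sum => i _; rewrite enormZ ler_wpM2r ?enorm_ge0// H.
Qed.

(** In coordinates, a set of diameter [s] fits in a cube of side proportional to [s], and
    the ball contains the image of the unit cube, so [cube_cover] bounds the sum of
    the gauges of any covering from below. *)
Lemma hausdorff_subspace_gt0 (rho : R) : bmass <= rho ->
  (0 < hausdorff k ([set` V] `&` [set x : E | (enorm x <= rho)%R]))%E.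
Proof.
move=> rhob; have [C C0 HC] := vcoord_bound.
have C2 : 0 < (2 * C) ^+ k by rewrite exprn_gt0// mulr_gt0.
have g0 : 0 < gauge_cst k / (2 * C) ^+ k :> R by rewrite divr_gt0// gauge_cst_gt0.
apply: (@lt_le_trans _ _ (gauge_cst k / (2 * C) ^+ k)%:E); first by rewrite lte_fin.
apply: le_trans (hausdorff_delta_le k _ ltr01).
apply: le_ereal_inf_tmp => _ [A [cov Ad] <-].
have /choice[ps psP] : forall i, exists ps : E * R, 0 <= ps.2 /\ forall x0, A i x0 ->
    [/\ A i ps.1, forall x, A i x -> enorm (x - ps.1) <= ps.2 &
     hausdorff_gauge k (A i) = (gauge_cst k * ps.2 ^+ k)%:E].
  move=> i; have [A0|[x Ax]] := set0P_or (A i).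
    by exists (0, 0); split => // x0; rewrite A0.
  have [s [s0 Hs Hg]] := gauge_fin k Ax (Ad i).
  by exists (x, s); split => // x0 _; split => // z Az; exact: Hs.
(* the indices from [k] on never occur in the cubes, hence the default 0 *)
pose y i l := if insub l is Some j then vcoord j (ps i).1 else 0.
have := @cube_cover k y (fun i => C * (ps i).2) (fun i => `[<exists x, A i x>]).
move=> H; have {}H := H _ _.
have : (1%:E <= \sum_(0 <= i <oo | `[<exists x, A i x>]) ((2 * (C * (ps i).2)) ^+ k)%:E)%E.
  apply: H => [i|t t01]; first by rewrite mulr_ge0 ?(ltW C0)//; exact: (psP i).1.
  have tV : ([set` V] `&` [set x : E | enorm x <= rho]) (vpoint t).
    split; first exact: vpoint_in.
    rewrite /=; apply: le_trans rhob; rewrite -[leRHS]mul1r; apply: enorm_vpoint => i ik.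
    by have /andP[t0 t1] := t01 i ik; rewrite ger0_norm.
  have [i _ Ai] := cov _ tV; exists i; first by apply/asboolP; exists (vpoint t).
  move=> l lk; rewrite /y insubT.
  rewrite -(vcoord_point t (Ordinal lk)) /vcoord -linearB.
  have [_ Hs _] := (psP i).2 _ Ai.
  apply: le_trans (HC _ _) _; rewrite ler_wpM2l ?(ltW C0)//; exact: Hs.
move=> {}H.
rewrite -(@lee_pmul2l _ ((2 * C) ^+ k / gauge_cst k)%:E) ?lte_fin ?divr_gt0 ?gauge_cst_gt0//.
rewrite -EFinM (_ : _ / _ * _ = 1); last first.
  move: (@gauge_cst_gt0 R k) C2; set gk := gauge_cst k; set c := (2 * C) ^+ k => gk0 c0.
  by field; rewrite !gt_eqF.
apply: le_trans H _.
rewrite -nneseriesZl; last by move=> i _; exact: gauge_ge0.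
  rewrite [leLHS]eseries_mkcond; apply: lee_nneseries => i _.
    move=> _; case: ifPn => // _; rewrite lee_fin exprn_ge0// !mulr_ge0 ?(ltW C0)//.
    exact: (psP i).1.
  case: ifPn => [/asboolP[x Ax]|_]; last first.
    by rewrite mule_ge0 ?gauge_ge0// lee_fin ltW// divr_gt0// gauge_cst_gt0.
  have [_ _ ->] := (psP i).2 _ Ax.
  rewrite -EFinM lee_fin mulrA exprMn le_eqVlt; apply/orP; left; apply/eqP.
  move: (@gauge_cst_gt0 R k); set gk := gauge_cst k => gk0.
  by field; rewrite gt_eqF.
exact: ball_volume_gt0.
Qed.

Lemma hausdorff_delta_bigcup (m : nat) (dl : R) (I : Type) (s : seq I) (A : I -> set E) :
  (hausdorff_delta m dl (\big[setU/set0]_(i <- s) A i) <= \sum_(i <- s) hausdorff_delta m dl (A i))%E.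
Proof.
elim: s => [|i s IH]; first by rewrite !big_nil hausdorff_delta0.
rewrite !big_cons.
have U2 (A1 B1 : set E) : (hausdorff_delta m dl (A1 `|` B1) <= hausdorff_delta m dl A1 + hausdorff_delta m dl B1)%E.
  have := hausdorff_delta_subadd m dl (bigcup2 A1 B1).
  rewrite bigcup2E => /le_trans; apply.
  rewrite (nneseries_split _ 2); last by move=> *; exact: hausdorff_delta_ge0.
  rewrite eseries0 ?adde0; first by rewrite !big_nat_recr//= big_nil add0e.
  by move=> [|[|n]] //= _ _; rewrite /bigcup2/= hausdorff_delta0.
by apply: le_trans (U2 _ _) _; rewrite leeD2l.
Qed.

Lemma hausdorff_delta_gauge (m : nat) (dl s : R) (A : set E) : 0 <= s -> s <= dl ->
  (forall x y, A x -> A y -> enorm (x - y) <= s) ->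
  (hausdorff_delta m dl A <= (gauge_cst m * s ^+ m)%:E)%E.
Proof.
move=> s0 sd As; apply: le_trans (gauge_le m s0 As).
apply: ereal_inf_lbound; exists (fun i : nat => (if i == 0%N then A else set0) : set E).
  split=> [x Ax|[|i]]; first by exists 0%N.
    by apply/ediam_le => x y Ax Ay; exact: le_trans (As _ _ Ax Ay) sd.
  by apply/ediam_le => x y [].
rewrite (nneseries_split _ 1); last by move=> *; exact: gauge_ge0.
rewrite eseries0 ?adde0; first by rewrite big_nat1.
by move=> [|i] //= _ _; rewrite gauge0.
Qed.

(** The coordinates of the ball fill a cube, which is cut into (N + 1)^k cells of
    diameter O(1/(N + 1)): their gauges add up to a bound independent of [N]. *)
Lemma hausdorff_subspace_lty (rho : R) : 0 < rho ->
  (hausdorff k ([set` V] `&` [set x : E | (enorm x <= rho)%R]) < +oo)%E.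
Proof.
move=> rho0; have [C C0 HC] := vcoord_bound.
pose M := C * rho.
have M0 : 0 < M by rewrite mulr_gt0.
pose D := 2 * M * bmass.
have D0 : 0 <= D by rewrite mulr_ge0 ?bmass_ge0// mulr_ge0// ltW.
apply: (@le_lt_trans _ _ (gauge_cst k * D ^+ k)%:E); last exact: ltry.
apply: hausdorff_le => dl dl0.
have [N Ndl] : exists N : nat, D / N.+1%:R <= dl.
  have [|N HN] := @ex_invn R (dl / (D + 1)); first by rewrite divr_gt0// ltr_wpDl.
  exists N; apply: (@le_trans _ _ ((D + 1) / N.+1%:R)).
    by rewrite ler_wpM2r// lerDl.
  by rewrite mulrC -ler_pdivlMr ?ltr_wpDl// ltW.
have N0 : 0 < N.+1%:R :> R by [].
pose Q (f : {ffun 'I_k -> 'I_N.+1}) : set E :=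
  [set x | x \in V /\ forall i, - M + (2 * M) * ((f i)%:R / N.+1%:R) <= vcoord i x <=
                                - M + (2 * M) * ((f i).+1%:R / N.+1%:R)].
apply: le_trans (hausdorff_delta_mono k dl (B := \big[setU/set0]_(f <- index_enum _) Q f) _) _.
  move=> x [/= xV xr]; rewrite -bigcup_seq.
  have cx i : `|vcoord i x| <= M.
    by apply: le_trans (HC i x) _; rewrite ler_wpM2l// ltW.
  have /choice[f fP] : forall i : 'I_k, exists j : 'I_N.+1,
      - M + (2 * M) * (j%:R / N.+1%:R) <= vcoord i x <= - M + (2 * M) * (j.+1%:R / N.+1%:R).
    move=> i; pose u := (vcoord i x + M) / (2 * M) * N.+1%:R.
    have u0 : 0 <= u.
      apply: mulr_ge0 => //; apply: divr_ge0; last by rewrite mulr_ge0// ltW.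
      by have := cx i; rewrite ler_norml => /andP[? _]; lra.
    have uN : u <= N.+1%:R.
      rewrite -[leRHS]mul1r ler_pM2r// ler_pdivrMr ?mulr_gt0// mul1r.
      by have := cx i; rewrite ler_norml => /andP[_ ?]; lra.
    have vE : vcoord i x = - M + 2 * M * (u / N.+1%:R).
      by rewrite /u; field; rewrite !gt_eqF.
    have H (j : nat) (jN : (j < N.+1)%N) : j%:R <= u -> u <= j.+1%:R -> exists j : 'I_N.+1,
      - M + (2 * M) * (j%:R / N.+1%:R) <= vcoord i x <= - M + (2 * M) * (j.+1%:R / N.+1%:R).
      move=> ju uj; exists (Ordinal jN); rewrite vE /= !lerD2l !ler_pM2l ?mulr_gt0//.
      by rewrite !ler_pM2r ?invr_gt0// ju uj.
    have tu := truncn_le u; rewrite u0 in tu.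
    have [tN|tN] := ltnP (Num.truncn u) N.+1.
      by apply: (H _ tN) => //; rewrite ltW// truncnS_gt.
    apply: (H N) => //; apply: le_trans tu; rewrite ler_nat; exact: ltnW.
  by exists [ffun i => f i]; [exact: mem_index_enum|split => // i; rewrite ffunE].
apply: le_trans (hausdorff_delta_bigcup _ _ _ _) _.
apply: (@le_trans _ _ (\sum_(f : {ffun 'I_k -> 'I_N.+1}) (gauge_cst k * (D / N.+1%:R) ^+ k)%:E)%E).
  apply: lee_sum => f _; apply: hausdorff_delta_gauge => //; first by rewrite divr_ge0.
  move=> x z [xV xf] [zV zf].
  have xzV : x - z \in V by exact: memvB.
  rewrite (vcoordK xzV).
  have := @enorm_vpoint (fun l => if insub l is Some j then vcoord j (x - z) else 0) (2 * M / N.+1%:R).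
  rewrite /vpoint.
  under eq_bigr => i _ do rewrite valK.
  move=> /(_ _)/le_trans; apply; last by rewrite /D mulrAC.
  move=> l lk; rewrite insubT /vcoord linearB /= ler_norml.
  have /andP[] := xf (Ordinal lk); have /andP[] := zf (Ordinal lk).
  have E1 (j : nat) : 2 * M * (j.+1%:R / N.+1%:R) = 2 * M * (j%:R / N.+1%:R) + 2 * M / N.+1%:R.
    by rewrite -(natr1 j) (mulrDl j%:R) mul1r (mulrDr (2 * M)).
  rewrite E1 /vcoord; set c := 2 * M * _; set e := 2 * M / _.
  by move=> ? ? ? ?; apply/andP; split; lra.
rewrite sumEFin sumr_const cardT -cardE card_ffun !card_ord.
rewrite lee_fin -(mulr_natl _ (N.+1 ^ k)) natrX expr_div_n.
rewrite le_eqVlt; apply/orP; left; apply/eqP.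
by field; rewrite expf_eq0 gt_eqF// andbF.
Qed.

End basis.

End SubspaceMass.

(** * Orthogonal projection *)

Section Projection.
Context {R : realType} {d : nat}.
Local Notation E := 'rV[R]_d.
Implicit Types (V : {vspace E}).

(** The Gram-Schmidt step: [w] is the part of the new vector orthogonal to the previous
    ones, and its coefficient 0/0 = 0 is harmless when [w] vanishes. *)
Lemma orth_exists V (x : E) : exists2 y, y \in V & orth V (x - y).
Proof.
suff H (s : seq E) : exists2 y, y \in << s >>%VS & orth << s >>%VS (x - y).
  by have [y yV xy] := H (vbasis V); exists y; rewrite (span_basis (vbasisP V)) in yV xy.
elim: s x => [|v s IH] x.
  exists 0; rewrite ?mem0v// => y; rewrite span_nil memv0 => /eqP ->; exact: dot0r.
have [v0 v0s vv0] := IH v; have [x0 x0s xx0] := IH x.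
have [w wE] : exists w, w = v - v0 by eexists.
have [x1 xE] : exists x1, x1 = x - x0 by eexists.
rewrite -wE in vv0; rewrite -xE in xx0.
exists (x0 + (dot x1 w / dot w w) *: w).
  rewrite span_cons memvD//; first exact: subvP (addvSr _ _) _ x0s.
  rewrite memvZ// wE memvB//; first exact: subvP (addvSl _ _) _ (memv_line _).
  exact: subvP (addvSr _ _) _ v0s.
move=> z; rewrite span_cons => /memv_addP[u /vlineP[a ->] [t ts ->]].
rewrite (_ : a *: v + t = a *: w + (a *: v0 + t)); last by rewrite wE addrA -scalerDr subrK.
have ts' : a *: v0 + t \in << s >>%VS by rewrite memvD// memvZ.
move: ts'; move: (a *: v0 + t) => t' ts'.
rewrite opprD addrA -xE dotDl !dotDr !dotNl !dotZr !dotZl (xx0 _ ts') (vv0 _ ts').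
have [w0|w0] := eqVneq (dot w w) 0.
  by rewrite (dot_eq0 w0) !dot0r; ring.
by field.
Qed.

Definition proj V (x : E) : E := xget 0 [set y | y \in V /\ orth V (x - y)].

Lemma proj_spec V x : proj V x \in V /\ orth V (x - proj V x).
Proof.
have [y yV xy] := orth_exists V x.
by apply: (@xgetPex _ 0 [set y | y \in V /\ orth V (x - y)]); exists y.
Qed.

Lemma proj_in V x : proj V x \in V. Proof. exact: (proj_spec V x).1. Qed.

Lemma proj_orth V x : orth V (x - proj V x). Proof. exact: (proj_spec V x).2. Qed.

Lemma proj_unique V x y : y \in V -> orth V (x - y) -> proj V x = y.
Proof.
move=> yV xy; apply/eqP; rewrite -subr_eq0; apply/eqP; apply: dot_eq0.
set p := proj V x.
have pV : p - y \in V by rewrite memvB// proj_in.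
rewrite {1}(_ : p - y = (x - y) - (x - p)); last by rewrite opprB [RHS]addrC addrA subrK.
by rewrite dotDl dotNl xy// proj_orth// subrr.
Qed.

Lemma proj_id V x : x \in V -> proj V x = x.
Proof. by move=> xV; apply: proj_unique => // y _; rewrite subrr dot0l. Qed.

Lemma projD V x y : proj V (x + y) = proj V x + proj V y.
Proof.
apply: proj_unique => [|z zV]; first by rewrite memvD// proj_in.
by rewrite opprD addrACA dotDl !proj_orth// addr0.
Qed.

Lemma projZ V a x : proj V (a *: x) = a *: proj V x.
Proof.
apply: proj_unique => [|z zV]; first by rewrite memvZ// proj_in.
by rewrite -scalerBr dotZl proj_orth// mulr0.
Qed.

Lemma projN V x : proj V (- x) = - proj V x.
Proof. by rewrite -scaleN1r projZ scaleN1r. Qed.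

Lemma projB V x y : proj V (x - y) = proj V x - proj V y.
Proof. by rewrite projD projN. Qed.

Lemma dot_proj V x y : dot (proj V x) y = dot x (proj V y).
Proof.
have H u v : dot (proj V u) v = dot (proj V u) (proj V v).
  rewrite -{1}(subrK (proj V v) v) dotDr dotC proj_orth ?add0r//; exact: proj_in.
by rewrite H dotC -H dotC.
Qed.

Lemma proj_pythagoras V x : dot x x = dot (proj V x) (proj V x) + dot (x - proj V x) (x - proj V x).
Proof.
have := @proj_orth V x _ (proj_in V x); set p := proj V x => o.
have := o; rewrite dotDl dotNl => o2.
rewrite [in RHS]dotDr dotNr o dotDl dotNl (dotC p x); lra.
Qed.

Lemma enorm_proj V x : enorm (proj V x) <= enorm x.
Proof. by rewrite ler_sqrt ?dot_ge0// (proj_pythagoras V x) lerDl dot_ge0. Qed.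

Lemma proj_coord V x i : proj V x ord0 i = dot x (proj V (delta_mx ord0 i)).
Proof. by rewrite -dot_delta dot_proj. Qed.

Lemma measurable_proj V : measurable_fun setT (proj V).
Proof.
apply: measurable_fun_rV => i.
under eq_fun do rewrite proj_coord.
apply: continuous_measurable_rV; exact: continuous_dot.
Qed.

Lemma closed_dot0 (F : 'I_d -> E) : closed [set x : E | forall i, dot x (F i) = 0].
Proof.
rewrite (_ : [set x : E | forall i, dot x (F i) = 0] =
  \bigcap_(i in [set: 'I_d]) ((fun x : E => dot x (F i)) @^-1` [set 0])); last first.
  by apply/seteqP; split => x /= H => [i _|i]; exact: H.
apply: closed_bigI => i _; apply: closed_comp; last exact: closed_eq.
by move=> x _; exact: continuous_dot.
Qed.

Lemma closed_subspace V : closed [set` V].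
Proof.
rewrite (_ : [set` V] = [set x : E | forall i, dot x (delta_mx ord0 i - proj V (delta_mx ord0 i)) = 0]).
  exact: closed_dot0.
apply/seteqP; split => x /= H.
  by move=> i; rewrite dotDr dotNr -dot_proj proj_id// subrr.
suff -> : x = proj V x by exact: proj_in.
apply/rowP => i; rewrite proj_coord -dot_delta; apply/eqP.
by rewrite -subr_eq0 -dotNr -dotDr H.
Qed.

Lemma measurable_subspace V : measurable [set` V].
Proof. by apply: closed_measurable_rV; exact: closed_subspace. Qed.

Lemma measurable_enorm_ball (rho : R) : measurable [set x : E | enorm x <= rho].
Proof.
rewrite (_ : [set x : E | enorm x <= rho] = setT `&` enorm @^-1` `]-oo, rho]%classic).
  exact: (continuous_measurable_rV continuous_enorm).
by rewrite setTI; apply/seteqP; split => x /=; rewrite in_itv.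
Qed.

End Projection.

Section Product.
Context {R : realType} {d : nat}.
Local Notation E := 'rV[R]_d.
Implicit Types (V : {vspace E}) (nu : {measure set E -> \bar R}).

Lemma radon_sigma_finite nu : radon nu -> sigma_finite setT nu.
Proof.
move=> rnu; exists (fun n => ball (0 : E) n%:R) => [|n].
  apply/seteqP; split => // x _; exists (Num.truncn `|x|).+1 => //.
  by apply/ballP; rewrite sub0r normrN truncnS_gt.
by split; [exact: measurable_ball_rV|exact: radon_bounded].
Qed.

Section swap.
Variables (m1 m2 : {measure set E -> \bar R}).
Hypotheses (s1 : sigma_finite setT m1) (s2 : sigma_finite setT m2).

(* [n1] and [n2] are [m1] and [m2] with their sigma-finite structures *)
Let n1 : set E -> \bar R := m1.
HB.instance Definition _ := Measure.on n1.
HB.instance Definition _ := @Measure_isSigmaFinite.Build _ E R n1 s1.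

Let n2 : set E -> \bar R := m2.
HB.instance Definition _ := Measure.on n2.
HB.instance Definition _ := @Measure_isSigmaFinite.Build _ E R n2 s2.

Lemma sections_swap (X : set (E * E)) : measurable X ->
  (\int[m1]_y m2 (xsection X y) = \int[m2]_x m1 (ysection X x))%E.
Proof.
move=> mX.
have := @product_measure_unique _ _ E E R n1 n2 (n1 \x^ n2)%E _ X mX.
by apply => A B mA mB; exact: product_measure2E.
Qed.

Lemma measurable_sections (X : set (E * E)) : measurable X ->
  measurable_fun setT (fun y => m2 (xsection X y)).
Proof. by move=> mX; exact: (@measurable_fun_xsection _ _ E E R n2 X mX). Qed.

End swap.

End Product.

(** * Measures invariant along a subspace are products *)

Section ProductDecomposition.
Context {R : realType} {d : nat}.
Local Notation E := 'rV[R]_d.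
Implicit Types (V : {vspace E}) (nu : {measure set E -> \bar R}).

Definition plane_measure V : {measure set E -> \bar R} :=
  mrestr (hausdorff (\dim V)) (measurable_subspace V).

Lemma plane_measureE V A : plane_measure V A = hausdorff (\dim V) (A `&` [set` V]).
Proof. by []. Qed.

Lemma plane_measure_radon V : radon (plane_measure V).
Proof.
move=> K cK; have [M [_ HM]] := compact_bounded cK.
pose rho := d%:R * (`|M| + 1) + 1.
have rho0 : 0 < rho by rewrite ltr_wpDl// mulr_ge0// addr_ge0.
apply: le_lt_trans (hausdorff_subspace_lty V rho0).
apply: hausdorff_mono => x [Kx Vx]; split => //=.
apply: le_trans (enorm_le_norm _) _; rewrite /rho ler_wpDr// ler_wpM2l//.
by apply: HM => //; rewrite (le_lt_trans (ler_norm M))// ltrDl.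
Qed.

Lemma plane_measure_shift V v A : v \in V ->
  plane_measure V ((fun x : E => x + v) @^-1` A) = plane_measure V A.
Proof.
move=> vV; rewrite !plane_measureE -(hausdorff_shift _ (A `&` _) v); congr hausdorff.
apply/seteqP; split => x [/= Ax Vx]; split => //=; first exact: memvD.
by rewrite -(addrK v x) memvB.
Qed.

Lemma measurable_funDrV dT (T : measurableType dT) (f g : T -> E) :
  measurable_fun setT f -> measurable_fun setT g -> measurable_fun setT (fun t => f t + g t).
Proof.
move=> mf mg; apply: measurable_fun_rV => i.
under eq_fun do rewrite mxE.
by apply: measurable_funD; [exact: (measurableT_comp (measurable_coord i) mf)|
  exact: (measurableT_comp (measurable_coord i) mg)].
Qed.

Lemma measurable_funNrV dT (T : measurableType dT) (f : T -> E) :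
  measurable_fun setT f -> measurable_fun setT (fun t => - f t).
Proof.
move=> mf; apply: measurable_fun_rV => i.
under eq_fun do rewrite mxE.
by apply: measurable_funN; exact: (measurableT_comp (measurable_coord i) mf).
Qed.

(** Let [Q] be the cylinder over a ball of [V] and [r] the mass of that ball. The factor
    [eta] gives to [C] the mass of the points of [Q] whose component along [orth V]
    lies in [C], divided by [r]. Tonelli's theorem then evaluates the product on [A]:
    the component of [x] along [V] moves into the [V] variable by invariance
    of the Hausdorff measure ([X1] to [X1']), and the [V] variable moves into [x] by
    invariance of [nu] ([X1'] to [X2]). What remains is the mass of [A] times [r]. *)
Lemma product_decomposition V nu : radon nu ->
  (forall v A, v \in V -> measurable A -> nu ((fun x : E => x + v) @^-1` A) = nu A) ->
  exists2 eta : {measure set E -> \bar R}, radon eta & is_hausdorff_product V eta nu.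
Proof.
move=> rnu inv; pose H := plane_measure V; pose P := proj V.
have mP : measurable_fun setT P by exact: measurable_proj.
pose rho := bmass V + 1.
have rho0 : 0 < rho by rewrite ltr_wpDl// bmass_ge0.
pose Q : set E := [set x | enorm (P x) <= rho].
have mQ : measurable Q.
  rewrite (_ : Q = setT `&` P @^-1` [set x : E | enorm x <= rho]); last by rewrite setTI.
  by apply: mP => //; exact: measurable_enorm_ball.
have HQE : H Q = hausdorff (\dim V) ([set` V] `&` [set x : E | enorm x <= rho]).
  rewrite /H plane_measureE setIC; congr hausdorff.
  by apply/seteqP; split => x [/= xV]; rewrite /Q /= /P proj_id.
pose r := fine (H Q).
have HQ : H Q = r%:E.
  rewrite /r fineK// ge0_fin_numE// HQE; exact: hausdorff_subspace_lty.
have r0 : 0 < r.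
  by rewrite -lte_fin -HQ HQE; apply: hausdorff_subspace_gt0; rewrite lerDl.
pose pi_ (x : E) := x - P x.
have mpi : measurable_fun setT pi_.
  by apply: measurable_funDrV => //; exact: measurable_funNrV.
have ri0 : 0 <= r^-1 by rewrite invr_ge0 ltW.
have [eta etaE] : exists eta : {measure set E -> \bar R},
    forall A, eta A = (r^-1%:E * nu (pi_ @^-1` A `&` Q))%E.
  pose m1 := mrestr nu mQ.
  pose m2 := measure_function_pushforward__canonical__measure_function_Measure m1 mpi.
  by exists (mscale (NngNum ri0) m2).
have reta : radon eta.
  move=> K cK; rewrite etaE.
  have mK : measurable K by exact: compact_measurable_rV.
  suff : (nu (pi_ @^-1` K `&` Q) < +oo)%E.
    move=> fin; rewrite -(@fineK _ (nu _)) ?ge0_fin_numE//.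
    by rewrite -EFinM ltry.
  have [M [_ HM]] := compact_bounded cK.
  apply: le_lt_trans (@radon_bounded _ _ nu (rho + (`|M| + 1) + 1) 0 rnu).
  apply: le_measure; rewrite ?inE; last 1 first.
  - move=> x [/= Kx Qx]; apply/ballP; rewrite sub0r normrN.
    rewrite (_ : x = P x + pi_ x); last by rewrite /pi_ addrC subrK.
    apply: le_lt_trans (ler_normD _ _) _; rewrite ltr_pwDr// lerD//.
      exact: le_trans (norm_le_enorm _) Qx.
    by apply: HM => //; rewrite (le_lt_trans (ler_norm M))// ltrDl.
  - by apply: measurableI => //; rewrite -[X in measurable X]setTI; exact: mpi.
  - exact: measurable_ball_rV.
exists eta => //; split.
  rewrite etaE (_ : _ `&` _ = set0) ?measure0 ?mule0//.
  by apply/seteqP; split => // x [/= + _]; apply; exact: proj_orth.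
move=> A mA.
have sH := radon_sigma_finite (@plane_measure_radon V).
have snu := radon_sigma_finite rnu.
have seta := radon_sigma_finite reta.
have m1 : measurable_fun setT (fun p : E * E => p.1) by exact: measurable_fst.
have m2 : measurable_fun setT (fun p : E * E => p.2) by exact: measurable_snd.
have mP1 : measurable_fun setT (fun p : E * E => P p.1) by exact: (measurableT_comp mP m1).
have mpre (f : E * E -> E) B : measurable_fun setT f -> measurable B -> measurable (f @^-1` B).
  by move=> mf mB; rewrite -[X in measurable X]setTI; exact: mf.
pose X : set (E * E) := (fun p => p.1 + p.2) @^-1` A.
have mX : measurable X by apply: mpre => //; exact: measurable_funDrV.
(* [P y] is [y] for almost every [y], and unlike [y] it always lies in [V] *)
pose X0 : set (E * E) := (fun p => P p.1 + p.2) @^-1` A.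
have mX0 : measurable X0 by apply: mpre => //; exact: measurable_funDrV.
pose X1 : set (E * E) := (fun p => P p.1 + pi_ p.2) @^-1` A `&` (fun p => p.2) @^-1` Q.
have mX1 : measurable X1.
  apply: measurableI; apply: mpre => //; apply: measurable_funDrV => //.
  exact: (measurableT_comp mpi m2).
pose X1' : set (E * E) := (fun p => P p.1 + p.2) @^-1` A `&` (fun p => p.2) @^-1` Q.
have mX1' : measurable X1' by apply: measurableI => //; exact: mpre.
pose X2 : set (E * E) := (fun p => p.2) @^-1` A `&` (fun p => p.2 - P p.1) @^-1` Q.
have mX2 : measurable X2.
  apply: measurableI; apply: mpre => //; apply: measurable_funDrV => //.
  exact: measurable_funNrV.
rewrite /pushforward /product_measure1 -/X.
transitivity (\int[H]_y eta (xsection X y))%E; last by [].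
have -> : (\int[H]_y eta (xsection X y) = \int[H]_y eta (xsection X0 y))%E.
  apply: ae_eq_integral => //; [exact: measurable_sections|exact: measurable_sections|].
  exists (~` [set` V]); split.
  - by apply: measurableC; exact: measurable_subspace.
  - by rewrite /H plane_measureE setICl hausdorff0.
  - move=> y /= + Vy; apply=> _.
    congr (eta _).
    by apply/seteqP; split => z /=; rewrite /xsection /= !inE /X /X0 /= /P proj_id.
have e1 y : eta (xsection X0 y) = (r^-1%:E * nu (xsection X1 y))%E.
  rewrite etaE; congr (_ * nu _)%E.
  by apply/seteqP; split => x /=; rewrite /xsection /= !inE.
under eq_integral do rewrite e1.
rewrite ge0_integralZl_EFin//; last exact: measurable_sections.
rewrite (sections_swap sH snu mX1).
have -> : (\int[nu]_x H (ysection X1 x) = \int[nu]_x H (ysection X1' x))%E.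
  apply: eq_integral => x _.
  rewrite -(plane_measure_shift (ysection X1 x) (proj_in V x)); congr (H _).
  have e y : P (y + P x) + pi_ x = P y + x.
    by rewrite /P projD (proj_id (proj_in V x)) /pi_ -addrA [_ + (x - _)]addrC subrK.
  by apply/seteqP; split => y /=; rewrite /ysection /= !inE /X1 /X1' /= e.
rewrite -(sections_swap sH snu mX1').
have -> : (\int[H]_y nu (xsection X1' y) = \int[H]_y nu (xsection X2 y))%E.
  apply: eq_integral => y _.
  rewrite -(inv _ (xsection X2 y) (proj_in V y)); last exact: measurable_xsection.
  congr (nu _).
  by apply/seteqP; split => x /=; rewrite /xsection /= !inE /X1' /X2 /= addrK (addrC x).
rewrite (sections_swap sH snu mX2).
have e2 x : H (ysection X2 x) = (r%:E * (\1_A x)%:E)%E.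
  rewrite indicE; case: (boolP (x \in A)) => xA; last first.
    rewrite mule0 (_ : ysection X2 x = set0) ?measure0//.
    apply/seteqP; split => // y; rewrite /ysection /= inE => -[/= Ax].
    by move: xA; rewrite notin_setE.
  rewrite mule1 -HQ -(plane_measure_shift (ysection X2 x) (proj_in V x)); congr (H _).
  rewrite inE in xA.
  have e y : P (x - P (y + P x)) = - P y.
    by rewrite /P projB (proj_id (proj_in V (y + _))) projD (proj_id (proj_in V x)) opprD addrCA subrr addr0.
  by apply/seteqP; split => y /=; rewrite /ysection /= inE /X2 /Q /= e enormN => // -[].
under [X in (_ * X)%E]eq_integral do rewrite e2.
rewrite ge0_integralZl_EFin//; last 2 first.
- by apply/measurable_EFinP; exact: measurable_indic.
- exact: ltW.
by rewrite integral_indic// setIT muleA -EFinM mulVf ?gt_eqF// mul1e.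
Qed.

End ProductDecomposition.

(** * Borel sections of the tangent bundle *)

Section Sections.
Context {R : realType} {d : nat}.
Local Notation E := 'rV[R]_d.
Implicit Types (V : {vspace E}) (mu : {measure set E -> \bar R}).

(** Measurability for the completion of [mu]. *)
Definition borel_ae mu (f : E -> R) :=
  exists2 g : E -> R, measurable_fun setT g & {ae mu, forall x, f x = g x}.

Lemma borel_ae_sublevel mu (f : E -> R) :
  (forall q : rat, exists2 B, measurable B & mu.-negligible ([set x | f x < ratr q] `+` B)) ->
  borel_ae mu f.
Proof.
move=> H.
have /choice[B HB] : forall q : rat, exists B, measurable B /\
    mu.-negligible ([set x | f x < ratr q] `+` B).
  by move=> q; have [B mB nB] := H q; exists B.
have [N [mN N0 NP]] : {ae mu, forall x, forall q : rat, f x < ratr q <-> B q x}.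
  apply: ae_countable => q.
  apply: negligibleS (HB q).2 => x /= nP.
  apply: contrapT => nX; apply: nP; split => [fx|Bx]; apply: contrapT => nB; apply: nX;
    by [left|right].
have {}NP x : ~ N x -> forall q : rat, f x < ratr q <-> B q x.
  by move=> Nx; apply: contrapT => nP; apply: Nx; exact: NP.
exists (fun x => if x \in N then 0 else f x); last first.
  exists N; split => // x /= H1; apply: contrapT => Nx; apply: H1.
  by rewrite memNset.
move=> mT; apply: (measurability _ (RGenInftyO.measurableE R)) => //.
move=> _ [_ [r ->] <-].
rewrite (_ : _ `&` _ = (N `&` [set x | 0 < r]) `|`
  (~` N `&` \bigcup_q (B q `&` [set x | ratr q <= r]))); last first.
  apply/seteqP; split => x /=; rewrite in_itv /=.
    case: (boolP (x \in N)) => [/set_mem Nx [_ r0]|]; first by left.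
    rewrite notin_setE => Nx [_ fr]; right; split => //.
    have [q] := rat_in_itvoo fr; rewrite in_itv /= => /andP[fq qr].
    by exists q => //; split; [exact/(NP x Nx)|exact: ltW].
  case=> [[Nx r0]|[Nx [q _ [Bq qr]]]]; first by rewrite mem_set.
  rewrite memNset//; split => //; apply: lt_le_trans qr; exact/(NP x Nx).
have mP (P : Prop) : measurable [set x : E | P].
  by have [h|h] := pselect P; [rewrite (_ : mkset _ = setT)|rewrite (_ : mkset _ = set0)];
    rewrite ?set_true ?set_false //; apply/seteqP; split.
apply: measurableU; first exact: measurableI.
apply: measurableI; first exact: measurableC.
apply: bigcupT_measurable_rat => q; apply: measurableI => //; exact: (HB q).1.
Qed.

Lemma borel_ae_cst mu (a : R) : borel_ae mu (fun=> a).
Proof. by exists (fun=> a) => //; apply: aeW. Qed.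

Lemma borel_aeD mu (f g : E -> R) : borel_ae mu f -> borel_ae mu g ->
  borel_ae mu (fun x => f x + g x).
Proof.
move=> [f1 mf ef] [g1 mg eg]; exists (fun x => f1 x + g1 x).
  exact: measurable_funD.
by apply: filterS2 ef eg => x -> ->.
Qed.

Lemma borel_aeM mu (f g : E -> R) : borel_ae mu f -> borel_ae mu g ->
  borel_ae mu (fun x => f x * g x).
Proof.
move=> [f1 mf ef] [g1 mg eg]; exists (fun x => f1 x * g1 x).
  exact: measurable_funM.
by apply: filterS2 ef eg => x -> ->.
Qed.

Lemma proj_nearest V (w v : E) : v \in V -> enorm (w - proj V w) <= enorm (w - v).
Proof.
move=> vV; rewrite ler_sqrt ?dot_ge0// (proj_pythagoras V (w - v)).
by rewrite projB (proj_id vV) opprB addrA subrK lerDr dot_ge0.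
Qed.

(** The distance from [w] to [T x] is attained at the projection of [w], so it is less
    than [q] exactly when [T x] meets the open ball of radius [q] around [w]. *)
Lemma borel_ae_dist mu T (w : E) : mu_measurable_bundle mu T ->
  borel_ae mu (fun x => enorm (w - proj (T x) w)).
Proof.
move=> mT; apply: borel_ae_sublevel => q.
pose U : set E := [set v | enorm (v - w) < ratr q].
have oU : open U.
  have c : continuous (fun v : E => enorm (v - w)).
    move=> v; apply: (@continuous_comp _ _ _ (fun v : E => v - w) enorm); last exact: continuous_enorm.
    by apply: continuousB; [exact: cvg_id|exact: cst_continuous].
  have := @open_comp _ _ (fun v : E => enorm (v - w)) [set t : R | t < ratr q].
  by apply; [move=> x _; exact: c|exact: open_lt].
have [B mB nB] := mT U oU; exists B => //.
rewrite (_ : [set x | enorm (w - proj (T x) w) < ratr q] = [set x | exists2 v, v \in T x & U v])//.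
apply/seteqP; split => x /= => [H|[v vT]].
  by exists (proj (T x) w); [exact: proj_in|rewrite /U /= -enormN opprB].
rewrite /U /= -enormN opprB; apply: le_lt_trans; exact: proj_nearest.
Qed.

(** Expresses the projection by distances to [V], which are what the measurability of
    a bundle controls. *)
Lemma proj_polarization V (u w : E) : dot (proj V u) w = 4^-1 *
  ((dot (u + w) (u + w) - enorm ((u + w) - proj V (u + w)) ^+ 2) -
   (dot (u - w) (u - w) - enorm ((u - w) - proj V (u - w)) ^+ 2)).
Proof.
have q z : dot z z - enorm (z - proj V z) ^+ 2 = dot (proj V z) (proj V z).
  by rewrite sqr_enorm (proj_pythagoras V z) addrK.
rewrite !q projB projD !dotDl !dotDr !dotNl !dotNr (dotC (proj V w) (proj V u)).
have -> : dot (proj V u) w = dot (proj V u) (proj V w).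
  by rewrite -dot_proj (proj_id (proj_in V u)).
by field.
Qed.

Lemma borel_ae_proj mu T (u w : E) : mu_measurable_bundle mu T ->
  borel_ae mu (fun x => dot (proj (T x) u) w).
Proof.
move=> mT; have D z : borel_ae mu (fun x => dot z z + -1 * (enorm (z - proj (T x) z) * enorm (z - proj (T x) z))).
  apply: borel_aeD; first exact: borel_ae_cst.
  apply: borel_aeM; first exact: borel_ae_cst.
  by apply: borel_aeM; exact: borel_ae_dist.
have [g mg eg] := borel_aeM (borel_ae_cst mu 4^-1)
  (borel_aeD (D (u + w)) (borel_aeM (borel_ae_cst mu (-1)) (D (u - w)))).
exists g => //; apply: filterS eg => x <-.
by rewrite proj_polarization !expr2 !mulN1r.
Qed.

(** The projections of the basis vectors on [T x] span [T x]. Borel representatives of them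
    are clipped to stay bounded and cut off outside balls to be integrable; as
    sections of the tangent bundle, they have a divergence in the Arens-Eells space. *)
Lemma tangent_sections mu T : radon mu -> MK_tangent_bundle mu T ->
  exists sigma : 'I_d -> nat -> E -> E,
  [/\ forall i n, L1field mu (sigma i n),
      forall i n, AE (neg_div mu (sigma i n)),
      forall i n j, measurable_fun setT (fun x => sigma i n x ord0 j),
      forall i n j x, `|sigma i n x ord0 j| <= 1 &
      {ae mu, forall x, exists n, forall i, sigma i n x = proj (T x) (delta_mx ord0 i)}].
Proof.
move=> rmu [mT MK].
have /choice[G GP] : forall p : 'I_d * 'I_d, exists g : E -> R,
    [/\ measurable_fun setT g, forall x, `|g x| <= 1 &
     {ae mu, forall x, proj (T x) (delta_mx ord0 p.1) ord0 p.2 = g x}].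
  move=> [i j] /=.
  have [g mg eg] := @borel_ae_proj mu T (delta_mx ord0 i) (delta_mx ord0 j) mT.
  exists (fun x => Num.max (-1) (Num.min 1 (g x))); split.
  - by apply: measurable_maxr => //; exact: measurable_minr.
  - move=> x; rewrite ler_norml le_max lexx /= ge_max ge_min lexx /= andbT.
    by rewrite (@le_trans _ _ 0)// lerN10.
  - apply: filterS eg => x <-; rewrite dot_delta.
    have : `|proj (T x) (delta_mx ord0 i) ord0 j| <= 1.
      apply: le_trans (norm_coord _ _) _; apply: le_trans (norm_le_enorm _) _.
      apply: le_trans (enorm_proj _ _) _.
      by rewrite /enorm dot_delta mxE !eqxx sqrtr1.
    by rewrite ler_norml => /andP[h1 h2]; rewrite (min_idPr h2) (max_idPr h1).
have aeG : {ae mu, forall x, forall p : 'I_d * 'I_d,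
    proj (T x) (delta_mx ord0 p.1) ord0 p.2 = G p x}.
  by apply: ae_countable => p; have [] := GP p.
pose B n : set E := ball 0 n%:R.
have mB n : measurable (B n) by exact: measurable_ball_rV.
pose sigma i n (x : E) : E := \row_j (G (i, j) x * \1_(B n) x).
have ms i n j : measurable_fun setT (fun x => sigma i n x ord0 j).
  under eq_fun do rewrite mxE.
  by apply: measurable_funM; [have [] := GP (i, j)|exact: measurable_indic].
have bs i n j x : `|sigma i n x ord0 j| <= 1.
  rewrite mxE normrM indicE; have [_ h _] := GP (i, j).
  by case: (_ \in _); rewrite ?normr1 ?normr0 ?mulr1 ?mulr0.
have L1s i n : L1field mu (sigma i n).
  move=> j.
  have im : mu.-integrable (B n) (EFin \o (fun x => sigma i n x ord0 j)).
    apply: measurable_bounded_integrable => //.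
    - exact: radon_bounded.
    - exact: measurable_funS (ms i n j).
    - exists 1; split; first exact: num_real.
      by move=> t t1 x _; exact: le_trans (bs i n j x) (ltW t1).
  have -> : (EFin \o (fun x => sigma i n x ord0 j)) =
      ((EFin \o (fun x => sigma i n x ord0 j)) \_ (B n)).
    apply/funext => x; rewrite patchE; case: ifPn => //= xB.
    by rewrite mxE indicE (negbTE xB) mulr0.
  by apply/(integrable_mkcond _ (mB n)).
exists sigma; split => //.
- move=> i n; have [] // := (MK (sigma i n) (L1s i n)).2 _.
  apply: filterS aeG => x Hx.
  have [xB|xB] := boolP (x \in B n).
    suff -> : sigma i n x = proj (T x) (delta_mx ord0 i) by exact: proj_in.
    by apply/rowP => j; rewrite mxE indicE xB mulr1 -(Hx (i, j)).
  suff -> : sigma i n x = 0 by exact: mem0v.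
  by apply/rowP => j; rewrite !mxE indicE (negbTE xB) mulr0.
- apply: filterS aeG => x Hx; exists (Num.truncn `|x|).+1 => i.
  apply/rowP => j; rewrite mxE indicE mem_set ?mulr1 -?(Hx (i, j))//.
  by apply/ballP; rewrite sub0r normrN truncnS_gt.
Qed.

End Sections.

(** * Tangent measures and tangent spaces *)

Section Tangency.
Context {R : realType} {d : nat}.
Local Notation E := 'rV[R]_d.
Implicit Types (V W : {vspace E}) (mu m : {measure set E -> \bar R}).

Lemma dirderiv_sum m V v phi : radon m -> testfun phi -> v \in V ->
  (forall i, \int[m]_x dirderiv (proj V (delta_mx ord0 i)) phi x = 0) ->
  \int[m]_x dirderiv v phi x = 0.
Proof.
move=> rm tphi vV H0.
have e x : dirderiv v phi x = \sum_(i < d) v ord0 i * dirderiv (proj V (delta_mx ord0 i)) phi x.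
  under [RHS]eq_bigr => i _ do rewrite mulr_sumr.
  rewrite exchange_big; apply: eq_bigr => j _ /=.
  rewrite -{1}(proj_id vV) proj_coord mulr_suml; apply: eq_bigr => i _.
  by rewrite mulrA; congr (_ * _ * _); rewrite -dot_delta dot_proj dotC dot_delta.
under eq_Rintegral => x _ do rewrite e.
have ii i : m.-integrable setT (EFin \o dirderiv (proj V (delta_mx ord0 i)) phi).
  by apply: Cc0_integrable => //; apply: testfun_Cc0; exact: dirderiv_testfun.
have [|_ ->] := @Rintegral_sum _ _ m 'I_d (index_enum 'I_d)
    (fun i x => v ord0 i * dirderiv (proj V (delta_mx ord0 i)) phi x).
  move=> i _; have := @integrableZl _ _ _ m _ measurableT (v ord0 i) _ (ii i).
  by apply: eq_integrable => // x _ /=; rewrite EFinM.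
by rewrite big1// => i _; rewrite RintegralZl// H0 mulr0.
Qed.

(** Countably many sections span the tangent bundle, so the exceptional null set depends
    neither on the blow-up nor on the direction. *)
Lemma ae_blowup_divergence_free mu T : radon mu -> MK_tangent_bundle mu T ->
  {ae mu, forall x0, forall m, radon m -> blowup mu x0 (fun phi => \int[m]_x phi x) ->
    forall v, v \in T x0 -> divergence_free m v}.
Proof.
move=> rmu /(tangent_sections rmu)[sigma [L1s AEs ms bs es]].
have H1 : {ae mu, forall x, forall p : 'I_d * nat, AE_blowup_point mu (neg_div mu (sigma p.1 p.2)) x}.
  apply: ae_countable => p; apply: AE_blowup; first exact: AEs.
  exact: neg_div_test_linear.
have H2 : {ae mu, forall x, forall p : 'I_d * nat * 'I_d,
    lebesgue_point mu (fun x => sigma p.1.1 p.1.2 x ord0 p.2) x}.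
  by apply: ae_countable => p; apply: (@lebesgue_ae _ _ _ _ 1) => //.
apply: filterS3 H1 H2 es => x h1 h2 [n hn] m rm bm v vT phi tphi.
apply: (@dirderiv_sum m (T x)) => // i; rewrite -hn.
apply: (blowup_divergence_free rmu (L1s i n) (h1 (i, n)) _ bm tphi) => j.
exact: (h2 (i, n, j)).
Qed.

Lemma plane_measure_gt0 V : (0 < plane_measure V setT)%E.
Proof.
apply: lt_le_trans (@hausdorff_subspace_gt0 _ _ V (bmass V) (lexx _)) _.
by rewrite plane_measureE; apply: hausdorff_mono => x [].
Qed.

(** A translation by a vector outside of [V] maps [V] to a disjoint set, so it cannot
    preserve a nonzero measure carried by [V]. *)
Lemma plane_measure_directions V W :
  (forall v, v \in W -> divergence_free (plane_measure V) v) -> (W <= V)%VS.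
Proof.
move=> H; apply/subvP => v vW; apply: contrapT => vV.
have := @shift_invariant _ _ (plane_measure V) v [set` V] (@plane_measure_radon _ _ V)
  (H v vW) (measurable_subspace V).
rewrite !plane_measureE (_ : _ `&` _ = set0).
  rewrite hausdorff0 setIid => h; have := plane_measure_gt0 V.
  by rewrite plane_measureE setTI -h ltxx.
apply/seteqP; split => // x [/= xvV xV]; apply: vV.
by rewrite -(addKr x v) memvD// memvN.
Qed.

Lemma plane_integral V (phi : E -> R) : measurable_fun setT phi ->
  fine (\int[hausdorff (\dim V)]_(x in [set` V]) (phi x)%:E)%E = \int[plane_measure V]_x phi x.
Proof.
move=> mphi; congr fine.
have mV := measurable_subspace V.
transitivity (\int[plane_measure V]_(x in [set` V]) (phi x)%:E)%E.
  by apply: eq_measure_integral => A mA AV; rewrite plane_measureE setIidl.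
rewrite [LHS]integral_mkcond; apply: ae_eq_integral => //.
- apply/(measurable_restrictT _ mV); apply: measurable_funS (_ : measurable_fun setT _) => //.
  exact/measurable_EFinP.
- exact/measurable_EFinP.
exists (~` [set` V]); split.
- exact: measurableC.
- by rewrite plane_measureE setICl hausdorff0.
- by move=> x /= + xV; apply=> _; rewrite patchE mem_set.
Qed.

Lemma tangent_space_blowup mu x0 V : tangent_space mu x0 V ->
  blowup mu x0 (fun phi => \int[plane_measure V]_x phi x).
Proof.
move=> [theta theta0 H].
exists (fun j => theta^-1 * ((j.+1%:R^-1) ^+ \dim V)^-1), (fun j => j.+1%:R^-1); split.
- by move=> j; rewrite mulr_gt0 ?invr_gt0// exprn_gt0// invr_gt0.
- by move=> j; rewrite invr_gt0.
- exact: cvg_harmonic.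
move=> phi cphi.
have /cvg_at_rightP/(_ (fun j => j.+1%:R^-1)) := H phi cphi.
move=> c; have {}c := c (conj (fun n => _) (@cvg_harmonic R)).
pose L := fine (\int[hausdorff (\dim V)]_(x in [set` V]) (phi x)%:E)%E.
have cc : theta^-1 * ((j.+1%:R^-1 ^+ \dim V)^-1 *
    \int[mu]_x phi (j.+1%:R^-1^-1 *: (x - x0))) @[j --> \oo] --> theta^-1 * (theta * L).
  by apply: cvgM; [exact: cvg_cst|apply: c => n; rewrite invr_gt0].
have e : theta^-1 * (theta * L) = L by rewrite mulKf// gt_eqF.
rewrite e in cc.
rewrite -(plane_integral V (continuous_measurable_rV cphi.1)).
by under eq_fun do rewrite -mulrA.
Qed.

End Tangency.

(** * Structure of tangent measures *)

Theorem proposition5p11 (R : realType) (d : nat)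
    (mu : {measure set 'rV[R]_d -> \bar R}) (radon_mu : radon mu)
    (T : 'rV[R]_d -> {vspace 'rV[R]_d}) (T_mu : MK_tangent_bundle mu T) :
  {ae mu, forall x0,
    [/\ forall nu, tangent_measures mu x0 nu ->
          exists2 eta : {measure set 'rV[R]_d -> \bar R},
            radon eta & is_hausdorff_product (T x0) eta nu,
        forall V : {vspace 'rV[R]_d}, tangent_space mu x0 V ->
          \dim V = \dim (T x0) -> T x0 = V &
        forall V : {vspace 'rV[R]_d}, tangent_space mu x0 V ->
          (T x0 <= V)%VS]}.

Proof.
apply: filterS (ae_blowup_divergence_free radon_mu T_mu) => x0 H.
have sub (V : {vspace 'rV[R]_d}) : tangent_space mu x0 V -> (T x0 <= V)%VS.
  move=> tV; apply: plane_measure_directions => v vT.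
  exact: (H _ (@plane_measure_radon _ _ V) (tangent_space_blowup tV)).
split.
- move=> nu [rnu _ tnu]; apply: product_decomposition => // v A vT mA.
  exact: (shift_invariant rnu (H nu rnu tnu v vT) mA).
- by move=> V tV dV; apply/eqP; rewrite eqEdim sub//= dV.
- exact: sub.
Qed.
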